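(* Let $M$ be a closed Riemannian manifold and $\Gamma$ an object of $\mathcal C_{b,p+q}$. The graph flow map $\Phi:\mathcal P_\Gamma(M)\to\mathcal P_\Gamma(TM)$, which is a section of the vector bundle $\mathcal P_\Gamma(TM)\to\mathcal P_\Gamma(M)$, intersects the zero section transversally.
   Context: Graphs and structures. $\mathcal C_{b,p+q}$ is the category whose objects are finite connected graphs (subspaces of $\mathbb R^\infty$) of first Betti number $b$ with oriented edges, $p$ incoming leaves (univalent vertices on edges oriented away from them), $q$ outgoing leaves (on edges oriented toward them), and a non-univalent basepoint. Morphisms are cellular maps preserving edge orientations and basepoints, for which inverse images of vertices are trees and inverse images of open edges are open edges. $\mathcal C_\Gamma$ is the category of objects $\Gamma_0\to\Gamma$ over $\Gamma$. $\mathcal S_\Gamma$ is the homotopy colimit over $\mathcal C_\Gamma$ of the functor sending $\Gamma_0\to\Gamma$ to the space of labelings of the edges of $\Gamma_0$ by distinct functions in $C^\infty(M)$ (morphisms forget labels of collapsed edges and permute the others). A point $(\Gamma_k,\vec f)\in\mathcal S_\Gamma$ is given by $\vec t\in\Delta^k$, a chain $\Gamma_k\to\cdots\to\Gamma_0\to\Gamma$ and labels $f_E$ of the edges of $\Gamma_k$; $\Gamma_k$ is a metric graph, edge $E$ having length $\ell_E=\sum_it_i\lambda_i(E)$, $\lambda_i(E)=0$ if $E$ is collapsed in $\Gamma_i$ and $1$ otherwise. The manifold structure on $\mathcal S_\Gamma$ is obtained by building it up as a union of finite-dimensional pieces $\mathcal S^{(m)}_\Gamma$, in which labels are taken in an $m$-dimensional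 subspace $V\subset C^\infty(M)$ (chosen spanned by functions $f_1,\dots,f_m$ whose gradients span $T_xM$ at every $x\in M$) and only simplices with $k<m$ are used. Mapping spaces. $\mathcal P_{\Gamma_k}(M)$ is the set of continuous maps $\gamma:\Gamma_k\to M$ with $\int_{\Gamma_k}|d\gamma/dt|^2dt<\infty$, a Banach manifold modeled on continuous sections $s$ of $\gamma^*TM$ with $W^{1,2}$-norm $\|s\|^2=\int_{\Gamma_k}(|ds/dt|^2+|s|^2)dt$. $\mathcal P_\Gamma(M)=\bigcup_{(\Gamma_k,\vec f)\in\mathcal S_\Gamma}\{(\Gamma_k,\vec f)\}\times\mathcal P_{\Gamma_k}(M)$, with the topology and manifold structure induced from $\mathcal S_\Gamma$ and $\mathcal P_{\Gamma_k}(M)$. $\mathcal P_\Gamma(TM)\to\mathcal P_\Gamma(M)$ is the vector bundle whose fibre over $\gamma$ is the space of $L^2$ sections of $\gamma^*TM$ over $\Gamma_k$. The section $\Phi$ sends $(\Gamma_k,\vec f,\gamma)$ to $\frac{d\gamma_E}{dt}+\nabla f_E(\gamma_E(t))$ on each edge $E$ of $\Gamma_k$. Transversality to the zero section means that at each zero of $\Phi$ the vertical linearization of $\Phi$, with values in the $L^2$ sections, is surjective with a right inverse. *)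

(* Defs.v *)
From HB Require Import structures.
From mathcomp Require Import all_boot all_order all_algebra.
From mathcomp Require Import all_classical all_reals all_analysis.
Set Implicit Arguments.
Unset Strict Implicit.
Unset Printing Implicit Defensive.
Import Order.TTheory GRing.Theory Num.Theory numFieldNormedType.Exports.
Local Open Scope ring_scope.

Record graph := Graph {
  vert : finType;
  edge : finType;
  src : edge -> vert;
  tgt : edge -> vert;
  base : vert }.

(* A loop contributes two to the valence of its vertex. *)
Definition valence (G : graph) (v : vert G) : nat :=
  (#|[set e : edge G | src e == v]| + #|[set e : edge G | tgt e == v]|)%N.

Definition incoming_leaf (G : graph) (v : vert G) : bool :=
  (valence v == 1)%N && [exists e : edge G, src e == v].

Definition outgoing_leaf (G : graph) (v : vert G) : bool :=
  (valence v == 1)%N && [exists e : edge G, tgt e == v].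

Definition adjacent (G : graph) (B : {set edge G}) : rel (vert G) :=
  fun u v => [exists e in B, ((src e == u) && (tgt e == v))
                          || ((src e == v) && (tgt e == u))].

(* Dimension over Q of the kernel of the cellular boundary map of the subgraph
   with edge set B; isolated vertices do not contribute. *)
Definition betti1 (G : graph) (B : {set edge G}) : nat :=
  \rank (kermx (\matrix_(i < #|B|, j < #|vert G|)
    ((tgt (enum_val i) == enum_val j)%:R - (src (enum_val i) == enum_val j)%:R
      : rat))).

Definition connected_on (G : graph) (A : {set vert G}) (B : {set edge G}) :=
  A != finset.set0 /\
  forall u v : vert G, u \in A -> v \in A -> connect (adjacent B) u v.

(* Objects: the embeddings in R^oo only make the category small and are
   dropped. *)
Record gobj (b p q : nat) := GObj {
  gobj_graph :> graph;
  gobj_connected : connected_on [set: vert gobj_graph] [set: edge gobj_graph];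
  gobj_betti : betti1 [set: edge gobj_graph] = b;
  gobj_in : #|[set v : vert gobj_graph | incoming_leaf v]| = p;
  gobj_out : #|[set v : vert gobj_graph | outgoing_leaf v]| = q;
  gobj_base : valence (base gobj_graph) != 1%N }.

(* [emap e = None] means that the edge e is collapsed to a vertex. *)
Record gmor (G H : graph) := GMor {
  vmap : vert G -> vert H;
  emap : edge G -> option (edge H);
  gmor_edge : forall e e', emap e = Some e' ->
    vmap (src e) = src e' /\ vmap (tgt e) = tgt e';
  gmor_collapse : forall e, emap e = None -> vmap (src e) = vmap (tgt e);
  gmor_base : vmap (base G) = base H;
  gmor_open_edge : forall e' : edge H, exists! e : edge G, emap e = Some e';
  gmor_tree : forall w : vert H,
    let A := [set v : vert G | vmap v == w] in
    let B := [set e : edge G | (emap e == None) && (vmap (src e) == w)] in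
    connected_on A B /\ betti1 B = 0%N }.

(* [chain G K] : chains K = G_k -> ... -> G_0 -> G, i.e. k-simplices of the
   nerve of the category of objects over G. *)
Inductive chain (b p q : nat) (G : gobj b p q) : gobj b p q -> Type :=
| Chain0 (G0 : gobj b p q) : gmor G0 G -> chain G G0
| ChainS (K L : gobj b p q) : chain G K -> gmor L K -> chain G L.

Fixpoint chain_dim b p q (G K : gobj b p q) (c : chain G K) : nat :=
  match c with
  | Chain0 _ _ => 0%N
  | ChainS _ _ c' _ => (chain_dim c').+1
  end.

(* lambda_i(e): false iff the edge e of G_k is collapsed in G_i (i <= k). *)
Fixpoint survives b p q (G K : gobj b p q) (c : chain G K) (i : nat) :
    edge K -> bool :=
  match c in chain _ K return edge K -> bool with
  | Chain0 _ _ => fun _ => true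
  | ChainS _ _ c' m => fun e =>
      (i == (chain_dim c').+1) ||
      (if emap m e is Some e' then survives c' i e' else false)
  end.

Local Open Scope classical_set_scope.

Fixpoint iter_derive (R : realType) (V W : normedModType R)
    (vs : seq V) (F : V -> W) : V -> W :=
  if vs is v :: vs' then fun x => 'D_v (iter_derive vs' F) x else F.

(* C^oo on an open set: all iterated directional derivatives exist and are
   continuous. *)
Definition smooth_on (R : realType) (V W : normedModType R)
    (O : set V) (F : V -> W) : Prop :=
  forall (vs : seq V) (v x : V), O x ->
    derivable (iter_derive vs F) x v /\
    {for x, continuous (iter_derive vs F)}.

Definition bilin (R : realType) (n : nat) (g : 'M[R]_n) (v w : 'rV[R]_n) : R :=
  (v *m g *m w^T) 0 0.

(* [mcoord i] and [mparam i] are mutually inverse homeomorphisms between the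
   open sets [mdom i] of the manifold and [mcoord i @` mdom i] of R^n;
   [mmet i] is the Gram matrix of the metric in the i-th chart, as a function
   of the coordinates; [mchart x] is some chart around x. *)
Record closed_riemannian (R : realType) (n : nat) := ClosedRiemannian {
  mcarrier :> topologicalType;
  mhausdorff : hausdorff_space mcarrier;
  mcompact : compact [set: mcarrier];
  mindex : Type;
  mdom : mindex -> set mcarrier;
  mcoord : mindex -> mcarrier -> 'rV[R]_n;
  mparam : mindex -> 'rV[R]_n -> mcarrier;
  mchart : mcarrier -> mindex;
  mchartP : forall x, mdom (mchart x) x;
  mdom_open : forall i, open (mdom i);
  mcod_open : forall i, open (mcoord i @` mdom i);
  mcoordK : forall i x, mdom i x -> mparam i (mcoord i x) = x;
  mcoord_cts : forall i, {within mdom i, continuous (mcoord i)};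
  mparam_cts : forall i,
    {within mcoord i @` mdom i, continuous (mparam i)};
  mtrans_smooth : forall i j,
    smooth_on (mcoord i @` (mdom i `&` mdom j)) (mcoord j \o mparam i);
  mmet : mindex -> 'rV[R]_n -> 'M[R]_n;
  mmet_smooth : forall i, smooth_on (mcoord i @` mdom i) (mmet i);
  mmet_sym : forall i y, (mcoord i @` mdom i) y -> (mmet i y)^T = mmet i y;
  mmet_pos : forall i y v, (mcoord i @` mdom i) y -> v != 0 ->
    0 < bilin (mmet i y) v v;
  mmet_trans : forall i j x v w, mdom i x -> mdom j x ->
    bilin (mmet i (mcoord i x)) v w =
    bilin (mmet j (mcoord j x))
      ('D_v (mcoord j \o mparam i) (mcoord i x))
      ('D_w (mcoord j \o mparam i) (mcoord i x)) }.

Section Manifold.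
Context (R : realType) (n : nat) (M : closed_riemannian R n).

Local Notation mu := (@lebesgue_measure R).
Local Notation vec := 'rV[R]_n.
(* A tangent vector at x is given by its components in every chart around x;
   the components in the other charts are irrelevant. *)
Local Notation tuplevec := (mindex M -> 'rV[R]_n).

Definition smooth_fun (f : M -> R) : Prop :=
  forall i, smooth_on (mcoord i @` mdom (c := M) i) (f \o mparam i).

Definition is_tangent (x : M) (v : tuplevec) : Prop :=
  forall i j, mdom i x -> mdom j x ->
    v j = 'D_(v i) (mcoord j \o mparam i) (mcoord i x).

Definition eq_tangent (x : M) (v w : tuplevec) : Prop :=
  forall i, mdom i x -> v i = w i.

Definition inner (x : M) (v w : tuplevec) : R :=
  let i := mchart x in bilin (mmet i (mcoord i x)) (v i) (w i).

Definition grad (f : M -> R) (i : mindex M) (y : vec) : vec :=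
  (\row_j 'D_(delta_mx 0 j) (f \o mparam i) y) *m invmx (mmet i y).

(* Gamma^k_(jl) u^j v^l for the Levi-Civita connection, by Koszul's formula. *)
Definition christoffel (i : mindex M) (y u v : vec) : vec :=
  let e (l : 'I_n) : vec := delta_mx 0 l in
  let G (a b : vec) : vec -> R := fun z => bilin (mmet i z) a b in
  (\row_l (2^-1 * ('D_u (G v (e l)) y + 'D_v (G u (e l)) y
                   - 'D_(e l) (G u v) y))) *m invmx (mmet i y).

(* x is absolutely continuous on [a, b] with integrable derivative v. *)
Definition weak_derivative (a b : R) (x v : R -> vec) : Prop :=
  forall j : 'I_n,
    mu.-integrable `[a, b] (fun t => (v t 0 j)%:E) /\
    forall t, a <= t <= b ->
      x t 0 j = x a 0 j + \int[mu]_(u in `[a, t]) (v u 0 j).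

Definition in_chart (l : R) (c : R -> M) (i : mindex M) (a b : R) : Prop :=
  [/\ 0 <= a, a <= b, b <= l & forall t, a <= t <= b -> mdom i (c t)].

Definition l2sq (l : R) (c : R -> M) (X : R -> tuplevec) : \bar R :=
  (\int[mu]_(t in `[0%R, l]) (inner (c t) (X t) (X t))%:E)%E.

Definition L2_section (l : R) (c : R -> M) (X : R -> tuplevec) : Prop :=
  [/\ forall t, 0 <= t <= l -> is_tangent (c t) (X t),
      forall i j, measurable_fun [set t | 0 <= t <= l /\ mdom i (c t)]
                    (fun t => X t i 0 j)
    & (l2sq l c X < +oo)%E].

(* Here v is the velocity dc/dt; it is determined almost everywhere. *)
Definition W12_curve (l : R) (c : R -> M) (v : R -> tuplevec) : Prop :=
  [/\ {within `[0, l], continuous c},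
      L2_section l c v
    & forall i a b, in_chart l c i a b ->
        weak_derivative a b (fun t => mcoord i (c t)) (fun t => v t i)].

(* s is a continuous section of c^*TM whose covariant derivative ds along c is
   square integrable; in the i-th chart ds = s' + Gamma(dc/dt, s). *)
Definition W12_section (l : R) (c : R -> M) (v s ds : R -> tuplevec) : Prop :=
  [/\ forall t, 0 <= t <= l -> is_tangent (c t) (s t),
      L2_section l c ds
    & forall i a b, in_chart l c i a b ->
        weak_derivative a b (fun t => s t i)
          (fun t => ds t i - christoffel i (mcoord i (c t)) (v t i) (s t i))].

End Manifold.

Section GraphFlow.
Context (R : realType) (n : nat) (M : closed_riemannian R n).
Context (b p q : nat) (G : gobj b p q).

Local Notation mu := (@lebesgue_measure R).
Local Notation tuplevec := (mindex M -> 'rV[R]_n).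

Definition edge_length (K : gobj b p q) (c : chain G K)
    (t : 'I_(chain_dim c).+1 -> R) (e : edge K) : R :=
  \sum_i t i * (survives c i e)%:R.

(* A representative of a point of the homotopy colimit S_G.  Points with some
   t_i = 0 are representatives of points of a face: all notions below only see
   the metric graph in which the edges of length 0 are collapsed, and are
   therefore compatible with the identifications of the homotopy colimit. *)
Record labelled_graph := LabelledGraph {
  top_graph : gobj b p q;
  chn : chain G top_graph;
  bary : 'I_(chain_dim chn).+1 -> R;
  label : edge top_graph -> M -> R;
  bary_ge0 : forall i, 0 <= bary i;
  bary_sum : \sum_i bary i = 1;
  label_smooth : forall e, smooth_fun (label e);
  label_distinct : forall e e', label e = label e' -> e = e' }.

Definition len (x : labelled_graph) (e : edge (top_graph x)) : R :=
  edge_length (@bary x) e.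

(* [velocity e] is the (almost everywhere determined) derivative of
   [on_edge e]. *)
Record mapping_space := MappingSpace {
  lgraph :> labelled_graph;
  on_vert : vert (top_graph lgraph) -> M;
  on_edge : edge (top_graph lgraph) -> R -> M;
  velocity : edge (top_graph lgraph) -> R -> tuplevec;
  on_edge_src : forall e, on_edge e 0 = on_vert (src e);
  on_edge_tgt : forall e, on_edge e (len e) = on_vert (tgt e);
  on_edge_W12 : forall e, W12_curve (len e) (on_edge e) (velocity e) }.

(* Sections of gamma^*TM over the metric graph, edge by edge. *)
Definition field (x : mapping_space) := edge (top_graph x) -> R -> tuplevec.

Definition L2_field (x : mapping_space) (X : field x) : Prop :=
  forall e, L2_section (len e) (on_edge e) (X e).

Definition l2sq_field (x : mapping_space) (X : field x) : \bar R :=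
  (\sum_(e : edge (top_graph x)) l2sq (len e) (on_edge e) (X e))%E.

Definition eq_field (x : mapping_space) (X Y : field x) : Prop :=
  forall e, {ae mu, forall t, 0 <= t <= len e ->
    eq_tangent (on_edge e t) (X e t) (Y e t)}.

Definition zero_field (x : mapping_space) : field x := fun _ _ _ => 0.

Definition lin_field (x : mapping_space) (a : R) (X Y : field x) : field x :=
  fun e t i => a *: X e t i + Y e t i.

(* Phi(gamma)_e = d gamma_e / dt + grad f_e (gamma_e). *)
Definition Phi (x : mapping_space) : field x := fun e t i =>
  velocity e t i + grad (label e) i (mcoord i (on_edge e t)).

(* Tangent vectors to P_G(M): variations of the simplex coordinates, of the
   labels, and of the map (by a section over the vertices and the edges,
   together with its covariant derivative over the edges). *)
Record variation (x : mapping_space) := Variation {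
  dbary : 'I_(chain_dim (chn x)).+1 -> R;
  dlabel : edge (top_graph x) -> M -> R;
  svert : vert (top_graph x) -> tuplevec;
  sedge : field x;
  dsedge : field x }.

Definition lin_variation (x : mapping_space) (a : R) (u v : variation x) :
    variation x :=
  {| dbary := fun i => a * dbary u i + dbary v i;
     dlabel := fun e y => a * dlabel u e y + dlabel v e y;
     svert := fun w i => a *: svert u w i + svert v w i;
     sedge := lin_field a (sedge u) (sedge v);
     dsedge := lin_field a (dsedge u) (dsedge v) |}.

Definition eq_variation (x : mapping_space) (u v : variation x) : Prop :=
  [/\ forall i, dbary u i = dbary v i,
      forall e y, dlabel u e y = dlabel v e y,
      forall w, eq_tangent (on_vert w) (svert u w) (svert v w)
    & forall e t, 0 <= t <= len e ->
        eq_tangent (on_edge e t) (sedge u e t) (sedge v e t)].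

Record is_variation (x : mapping_space) (v : variation x) : Prop :=
  IsVariation {
    dbary_sum : \sum_i dbary v i = 0;
    (* the variation is tangent to the open face containing the point *)
    dbary_face : forall i, bary i = 0 -> dbary v i = 0;
    dlabel_smooth : forall e, smooth_fun (dlabel v e);
    svert_tangent : forall w, is_tangent (on_vert w) (svert v w);
    sedge_src : forall e,
      eq_tangent (on_vert (src e)) (sedge v e 0) (svert v (src e));
    sedge_tgt : forall e,
      eq_tangent (on_vert (tgt e)) (sedge v e (len e)) (svert v (tgt e));
    sedge_W12 : forall e, W12_section (len e) (on_edge e) (velocity e)
                            (sedge v e) (dsedge v e) }.

Definition dlen (x : mapping_space) (v : variation x) (e : edge (top_graph x)) : R :=
  edge_length (@dbary x v) e.

(* Phi at the point obtained from x by moving a distance h along v, read in the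
   i-th chart.  An edge of the varied length is parametrized by [0, len e]
   through a linear change of variable, hence the first factor, and c is moved
   to c + h s in coordinates; the coordinate derivative of s is
   Ds - Gamma(dc/dt, s). *)
Definition local_Phi (x : mapping_space) (v : variation x) (e : edge (top_graph x))
    (i : mindex M) (h t : R) : 'rV[R]_n :=
  let y := mcoord i (on_edge e t) in
  let s := sedge v e t i in
  let s' := dsedge v e t i - christoffel i y (velocity e t i) s in
  (len e / (len e + h * dlen v e)) *: (velocity e t i + h *: s')
  + grad (fun z => label e z + h * dlabel v e z) i (y + h *: s).

(* w is the derivative of Phi along v in the local trivializations of the
   bundle given by the charts of M: the difference quotients converge to w in
   L^2 on every subinterval of an edge mapped into a chart.  At a zero of Phi
   this does not depend on the trivialization. *)
Definition vertical_derivative (x : mapping_space) (v : variation x)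
    (w : field x) : Prop :=
  forall (e : edge (top_graph x)) (i : mindex M) (a c : R),
    in_chart (len e) (on_edge e) i a c ->
    (\int[mu]_(t in `[a, c])
       (let r : 'rV[R]_n :=
          h^-1 *: (local_Phi v e i h t - local_Phi v e i 0 t) - w e t i in
        bilin 1%:M r r)%:E)%E @[h --> 0^'] --> 0%E.

Definition vertical_linearization (x : mapping_space)
    (D : variation x -> field x) : Prop :=
  [/\ forall v, is_variation v -> L2_field (D v),
      forall a u v, is_variation u -> is_variation v ->
        eq_field (D (lin_variation a u v)) (lin_field a (D u) (D v))
    & forall v, is_variation v -> vertical_derivative v (D v)].

(* A piece of S_G through x: labels in the span V of linearly independent
   smooth functions f_1, ..., f_m whose gradients span every tangent space. *)
Definition label_space (x : mapping_space) (m : nat) (f : 'I_m -> M -> R) :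
    Prop :=
  [/\ forall j, smooth_fun (f j),
      forall a : 'I_m -> R,
        (forall y, \sum_j a j * f j y = 0) -> forall j, a j = 0,
      forall (y : M) i (u : 'rV[R]_n), mdom i y ->
        exists a : 'I_m -> R, u = \sum_j a j *: grad (f j) i (mcoord i y)
    & forall e : edge (top_graph x),
        exists a : 'I_m -> R, forall y, label e y = \sum_j a j * f j y].

(* Boundedness, for the W^(1,2) norm in the direction of the maps; the label
   directions are those of one finite-dimensional piece. *)
Definition bounded_into_variations (x : mapping_space)
    (S : field x -> variation x) : Prop :=
  exists (m : nat) (f : 'I_m -> M -> R) (C : R),
    label_space x f /\
    forall w, L2_field w ->
      [/\ forall i, (((dbary (S w) i) ^+ 2)%:E <= C%:E * l2sq_field w)%E,
          forall e, exists a : 'I_m -> R,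
            (forall y, dlabel (S w) e y = \sum_j a j * f j y) /\
            forall j, (((a j) ^+ 2)%:E <= C%:E * l2sq_field w)%E
        & (l2sq_field (dsedge (S w)) + l2sq_field (sedge (S w))
            <= C%:E * l2sq_field w)%E].

Definition right_inverse (x : mapping_space) (D : variation x -> field x)
    (S : field x -> variation x) : Prop :=
  [/\ forall w, L2_field w -> is_variation (S w) /\ eq_field (D (S w)) w,
      forall a w w', L2_field w -> L2_field w' ->
        eq_variation (S (lin_field a w w')) (lin_variation a (S w) (S w'))
    & bounded_into_variations S].

Definition transverse_at (x : mapping_space) : Prop :=
  exists2 D : variation x -> field x, vertical_linearization D &
    exists S : field x -> variation x, right_inverse D S.

Definition is_zero (x : mapping_space) : Prop :=
  eq_field (@Phi x) (@zero_field x).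

End GraphFlow.

(* Main.v *)
(** On an edge of length [l], with label [f] and curve [c] such that
    [c' = - grad f], the vertical linearization of [Phi] sends a section [s]
    and a variation [delta] of the label to [Ds + (Hess f) s + grad delta], up
    to a multiple of [c'].  Keeping the vertices and the lengths fixed, one has
    to solve [Ds + (Hess f) s + grad delta = w] on each edge with [s] vanishing
    at both ends.  The solution of [Ds + (Hess f) s = w] with [s 0 = 0] exists
    and is bounded by [w], so it suffices that the values at [l] of the
    solutions for [w = - grad delta], [s 0 = 0], fill the tangent space at
    [c l].

    If [grad f] vanishes at [c l], then [c] is constant, and an energy that
    decreases along the solutions shows that [grad delta |-> s l] is injective,
    hence surjective.  Otherwise [f] decreases strictly along [c] near [l], and
    [delta = psi (r - f) g], with [psi] a flat function vanishing on the
    negative reals and [r] slightly larger than [f (c l)], only acts at times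
    close to [l].  Since [grad f] along [c] solves the homogeneous equation, the
    term of [grad delta] proportional to [grad f] only contributes a multiple of
    [grad f] to [s l]; what remains is close to a positive multiple of
    [- grad g], which is an arbitrary vector.

    The label variations needed on all the edges, together with the labels and
    with functions whose gradients span the tangent spaces, span the space of
    labels of one finite-dimensional piece. *)

Require Import Defs.
From HB Require Import structures.
From mathcomp Require Import all_boot all_order all_algebra.
From mathcomp Require Import all_classical all_reals all_analysis.
From mathcomp Require Import measurable_realfun ring lra.
Set Implicit Arguments.
Unset Strict Implicit.
Unset Printing Implicit Defensive.
Import Order.TTheory GRing.Theory Num.Theory numFieldNormedType.Exports.
Local Open Scope ring_scope.
Local Open Scope classical_set_scope.

(** * Absolutely continuous functions on an interval *)

(** At a zero the velocity, known only almost everywhere, agrees with the continuous field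
    [- grad f], and in a chart the Christoffel term of the covariant derivative cancels that of the
    Hessian. What remains is a linear equation with continuous coefficients and a right-hand side
    that is only square integrable. Fixing the vertices decouples the edges, since each edge has its
    own label; the price is [n] conditions at the end of each edge, which only label variations can
    meet. The obstacle is that such a variation is a function on [M], not of time. A cutoff
    depending on [f] alone controls time exactly, because [f] decreases along the curve, and its
    side effect points along the flow. At a rest point nothing can be localized in time: [s l] is
    minus the integral of [exp (- (l - t) H) a] over the edge. This is invertible in [a] because [H]
    is self-adjoint, hence has real spectrum, and the energy stands for the diagonalization of [H].
    A chart need not contain a whole curve, so statements are proved on short pieces and glued by an
    induction over intervals. *)

Section IntervalInduction.
Context (R : realType).

Lemma near_itv (t r1 r2 s d d' : R) : d <= d' -> t - d < r1 -> r2 < t + d ->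
  r1 <= s <= r2 -> `|s - t| < d'.
Proof. by move=> ? ? ? /andP[? ?]; rewrite ltr_norml; apply/andP; split; lra. Qed.

Lemma dist_half (x y z e : R) :
  `|x - z| < e / 2 -> `|y - z| < e / 2 -> `|x - y| <= e.
Proof.
rewrite !ltr_norml ler_norml => /andP[? ?] /andP[? ?]; apply/andP; split; lra.
Qed.

Lemma dist_halfr (x y z e : R) :
  `|z - x| < e / 2 -> `|z - y| < e / 2 -> `|x - y| <= e.
Proof. by rewrite (distrC z x) (distrC z y); exact: dist_half. Qed.

Lemma sub_itv (a b c d t : R) : a <= c -> d <= b -> c <= t <= d -> a <= t <= b.
Proof. by move=> ac db /andP[ct td]; rewrite (le_trans ac) // (le_trans td). Qed.

(** Real induction: at the supremum of the [b] with [P A b], the local hypothesis extends some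
    [P A b] with [b] close to it beyond the supremum, unless that is already [B]. This takes the
    place of subdivisions of compact intervals. *)
Lemma itv_ind (P : R -> R -> Prop) (A B : R) : A <= B ->
  (forall a b c, A <= a -> a <= b -> b <= c -> c <= B ->
     P a b -> P b c -> P a c) ->
  (forall t, A <= t <= B -> exists2 e : R, 0 < e &
     forall a b, A <= a -> a <= b -> b <= B -> t - e < a -> b < t + e ->
     P a b) ->
  P A B.
Proof.
move=> AB Pcat Ploc.
pose S := [set b | A <= b <= B /\ P A b].
have SA : S A.
  have [|e e0 He] := Ploc A; first by rewrite lexx AB.
  by split; [rewrite lexx AB|apply: He; rewrite ?lexx //; lra].
have hS : has_sup S.
  by split; [exists A|exists B => x [/andP[]]].
set s := sup S.
have sA : A <= s by apply: ub_le_sup SA; case: hS.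
have sB : s <= B by apply: ge_sup => [|x [/andP[]//]]; exists A.
have [|e e0 He] := Ploc s; first by rewrite sA sB.
have [b [/andP[Ab bB] PAb] sb] : exists2 b, S b & s - e < b.
  by apply: sup_adherent.
have bs : b <= s by apply: ub_le_sup; [case: hS|split=> //; rewrite Ab bB].
pose b' := Num.min (s + e / 2) B.
have sb' : s <= b' by rewrite le_min; apply/andP; split=> //; lra.
have b'B : b' <= B by rewrite ge_min lexx orbT.
have b'e : b' < s + e by rewrite gt_min; apply/orP; left; lra.
have PAb' : P A b'.
  apply: (Pcat A b b') => //; first exact: le_trans bs sb'.
  by apply: He => //; exact: le_trans bs sb'.
have b's : b' <= s.
  apply: ub_le_sup; first by case: hS.
  by split=> //; rewrite b'B (le_trans sA sb').
suff -> : B = b' by [].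
move: b's; rewrite /b'; case: (leP (s + e / 2) B) => //.
lra.
Qed.

(** Continuity relative to the closed interval, written with explicit radii that suit linear
    arithmetic; [cts_within] links it to the filter version. *)
Definition cts (a b : R) (x : R -> R) : Prop :=
  forall t, a <= t <= b -> forall e : R, 0 < e -> exists2 d : R, 0 < d &
    forall t', a <= t' <= b -> `|t' - t| < d -> `|x t' - x t| < e.

Lemma cts_within a b x : cts a b x <-> {within `[a, b], continuous x}.
Proof.
split=> [xc|xc].
- apply/subspace_continuousP => t /=; rewrite in_itv /= => tab.
  apply/cvgrPdist_lt => e e0; have [d d0 H] := xc t tab e e0.
  rewrite /within /=; apply/nbhs_ballP; exists d => //= u; rewrite /ball /= => ud.
  by rewrite in_itv /= => uab; rewrite distrC; apply: H => //; rewrite distrC.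
- move=> t tab e e0; move/subspace_continuousP: xc => /(_ t).
  rewrite /= in_itv /= => /(_ tab) /cvgrPdist_lt /(_ e e0).
  rewrite /within /= => /nbhs_ballP[d /= d0 H]; exists d => // u uab ud.
  by rewrite distrC; apply: H; rewrite /ball /= ?in_itv //= distrC.
Qed.

Lemma cts_sub a b a' b' x : a <= a' -> b' <= b -> cts a b x -> cts a' b' x.
Proof.
move=> aa bb xc t /andP[t1 t2] e e0.
have [|d d0 H] := xc t _ e e0; first by rewrite (le_trans aa) ?(le_trans t2).
by exists d => // u /andP[u1 u2]; apply: H; rewrite (le_trans aa) ?(le_trans u2).
Qed.

Lemma cts_ext a b x x' : (forall t, a <= t <= b -> x t = x' t) ->
  cts a b x -> cts a b x'.
Proof.
move=> xx xc t tab e e0; have [d d0 H] := xc t tab e e0.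
by exists d => // u uab ud; rewrite -!xx //; exact: H.
Qed.

Lemma cts_cst a b k : cts a b (fun=> k).
Proof. by move=> t _ e e0; exists 1 => // u _ _; rewrite subrr normr0. Qed.

Lemma ctsD a b x y : cts a b x -> cts a b y -> cts a b (fun t => x t + y t).
Proof.
move=> xc yc t tab e e0.
have e2 : 0 < e / 2 by lra.
have [d1 d10 H1] := xc t tab _ e2; have [d2 d20 H2] := yc t tab _ e2.
exists (Num.min d1 d2); first by rewrite lt_min d10 d20.
move=> u uab; rewrite lt_min => /andP[u1 u2].
have -> : x u + y u - (x t + y t) = (x u - x t) + (y u - y t) by ring.
apply: (le_lt_trans (ler_normD _ _)).
have := H1 u uab u1; have := H2 u uab u2; lra.
Qed.

Lemma ctsM a b x y : cts a b x -> cts a b y -> cts a b (fun t => x t * y t).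
Proof.
move=> xc yc t tab e e0.
pose C := `|x t| + `|y t| + 1.
have C0 : 0 < C by rewrite /C; have := normr_ge0 (x t); have := normr_ge0 (y t); lra.
pose e' := Num.min 1 (e / (2 * C)).
have e'0 : 0 < e' by rewrite lt_min ltr01 divr_gt0 // mulr_gt0.
have [d1 d10 H1] := xc t tab _ e'0; have [d2 d20 H2] := yc t tab _ e'0.
exists (Num.min d1 d2); first by rewrite lt_min d10 d20.
move=> u uab; rewrite lt_min => /andP[/(H1 u uab) u1 /(H2 u uab) u2].
have -> : x u * y u - x t * y t =
  (x u - x t) * (y u - y t) + (x t * (y u - y t) + (x u - x t) * y t) by ring.
apply: (le_lt_trans (ler_normD _ _)).
have := ler_normD (x t * (y u - y t)) ((x u - x t) * y t).
rewrite !normrM => h.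
have e'1 : e' <= 1 by rewrite ge_min lexx.
have e'2 : e' * (2 * C) <= e.
  by rewrite -ler_pdivlMr ?mulr_gt0 // ge_min lexx orbT.
have := normr_ge0 (x u - x t); have := normr_ge0 (y u - y t).
have := normr_ge0 (x t); have := normr_ge0 (y t).
move: u1 u2 h e'2; rewrite /C.
set p := `|x u - x t|; set q := `|y u - y t|; set r := `|x t|; set s := `|y t|.
move=> u1 u2 h e'2 s0 r0 q0 p0.
have : p * q <= e' * 1 by apply: ler_pM => //; [exact: ltW|exact: le_trans (ltW u2) e'1].
have : r * q <= r * e' by apply: ler_wpM2l => //; exact: ltW.
have : p * s <= e' * s by apply: ler_wpM2r => //; exact: ltW.
nra.
Qed.

Lemma ctsZ a b k x : cts a b x -> cts a b (fun t => k * x t).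
Proof. exact/ctsM/cts_cst. Qed.

Lemma ctsN a b x : cts a b x -> cts a b (fun t => - x t).
Proof.
move=> /(@ctsZ a b (-1)); apply: cts_ext => t _; ring.
Qed.

Lemma ctsB a b x y : cts a b x -> cts a b y -> cts a b (fun t => x t - y t).
Proof. by move=> xc /ctsN; exact: ctsD. Qed.

Lemma cts_sum a b (I : Type) (r : seq I) (x : I -> R -> R) :
  (forall i, cts a b (x i)) -> cts a b (fun t => \sum_(i <- r) x i t).
Proof.
move=> xc; elim: r => [|i r IH].
  by apply: cts_ext (@cts_cst a b 0) => t _; rewrite big_nil.
by apply: cts_ext (ctsD (xc i) IH) => t _; rewrite big_cons.
Qed.

Lemma cts_norm a b x : cts a b x -> cts a b (fun t => `|x t|).
Proof.
move=> xc t tab e e0; have [d d0 H] := xc t tab e e0; exists d => // u uab ud.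
by apply: le_lt_trans (ler_dist_dist _ _) (H u uab ud).
Qed.

Lemma cts_bounded a b x : cts a b x ->
  exists2 C : R, 0 < C & forall t, a <= t <= b -> `|x t| <= C.
Proof.
move=> /cts_norm xc; have [ab|ba] := leP a b; last first.
  by exists 1 => // t /andP[h1 h2]; have := le_trans h1 h2; rewrite leNgt ba.
have [c /= _ H] := EVT_max ab (iffLR (cts_within a b _) xc).
exists (`|x c| + 1); first by have := normr_ge0 (x c); lra.
by move=> t tab; have := H t; rewrite in_itv /= => /(_ tab); lra.
Qed.

Local Notation mu := (@lebesgue_measure R).

Lemma ae_imp (P Q : R -> Prop) : {ae mu, forall t, P t} ->
  (forall t, P t -> Q t) -> {ae mu, forall t, Q t}.
Proof. by move=> Pt PQ; apply: negligibleS Pt => t /= nQ /PQ. Qed.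

Lemma ae_all (P : R -> Prop) : (forall t, P t) -> {ae mu, forall t, P t}.
Proof. by move=> H; apply: negligibleS (negligible_set0 _) => t /= []. Qed.

Lemma cts_meas a b x : cts a b x -> measurable_fun (`[a, b] : set R) x.
Proof.
move=> /cts_within xc.
by apply: subspace_continuous_measurable_fun => //; exact: measurable_itv.
Qed.

Definition intg a b (v : R -> R) := mu.-integrable `[a, b] (EFin \o v).
Definition Int a b (v : R -> R) : R := \int[mu]_(u in `[a, b]) v u.

Lemma intg_meas a b v : intg a b v -> measurable_fun (`[a, b] : set R) v.
Proof. by move=> /integrableP[/measurable_EFinP]. Qed.

Lemma cts_intg a b x : cts a b x -> intg a b x.
Proof.
move=> /cts_within xc.
by apply: continuous_compact_integrable => //; exact: segment_compact.
Qed.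

Lemma intg_sub a b a' b' v : a <= a' -> b' <= b -> intg a b v -> intg a' b' v.
Proof.
move=> aa bb; apply: integrableS => //; apply: subset_itv;
  by rewrite bnd_simp.
Qed.

Lemma intgD a b u v : intg a b u -> intg a b v -> intg a b (fun t => u t + v t).
Proof.
by move=> ui vi; apply: (integrableD _ ui vi).
Qed.

Lemma intgZ a b k v : intg a b v -> intg a b (fun t => k * v t).
Proof.
by move=> vi; apply: (integrableZl _ k vi).
Qed.

Lemma intgN a b v : intg a b v -> intg a b (fun t => - v t).
Proof.
move=> /(@intgZ a b (-1)).
by rewrite (_ : (fun t => -1 * v t) = (fun t => - v t)) //; apply/funext => t; ring.
Qed.

Lemma intgB a b u v : intg a b u -> intg a b v -> intg a b (fun t => u t - v t).
Proof. by move=> ui /intgN; exact: intgD. Qed.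

Lemma intg_cst a b k : intg a b (fun=> k).
Proof. exact/cts_intg/cts_cst. Qed.

Lemma intg_sum a b (I : Type) (r : seq I) (x : I -> R -> R) :
  (forall i, intg a b (x i)) -> intg a b (fun t => \sum_(i <- r) x i t).
Proof.
move=> xc; elim: r => [|i r IH].
  rewrite (_ : (fun t => _) = (fun=> 0)); first exact: intg_cst.
  by apply/funext => t; rewrite big_nil.
rewrite (_ : (fun t => _) = (fun t => x i t + \sum_(i <- r) x i t)).
  exact: intgD.
by apply/funext => t; rewrite big_cons.
Qed.

Lemma intg_norm a b v : intg a b v -> intg a b (fun t => `|v t|).
Proof. exact: integrable_norm. Qed.

Lemma intg_le a b u v : measurable_fun (`[a, b] : set R) (u : R -> R) -> intg a b v ->
  (forall t, a <= t <= b -> `|u t| <= v t) -> intg a b u.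
Proof.
move=> um vi uv; apply: (le_integrable _ _ _ vi) => //.
  exact/measurable_EFinP.
move=> t /=; rewrite in_itv /= => tab.
by rewrite lee_fin (le_trans (uv t tab)) // ler_norm.
Qed.

Lemma intgM a b m v : cts a b m -> intg a b v -> intg a b (fun t => m t * v t).
Proof.
move=> mc vi; have [C C0 HC] := cts_bounded mc.
apply: (intg_le _ (intgZ C (intg_norm vi))).
  by apply: measurable_funM; [exact: cts_meas|exact: intg_meas].
by move=> t tab; rewrite normrM ler_wpM2r // HC.
Qed.

Lemma IntD a b u v : intg a b u -> intg a b v ->
  Int a b (fun t => u t + v t) = Int a b u + Int a b v.
Proof. by move=> ui vi; rewrite /Int RintegralD. Qed.

Lemma IntZ a b k v : intg a b v -> Int a b (fun t => k * v t) = k * Int a b v.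
Proof. by move=> vi; rewrite /Int RintegralZl. Qed.

Lemma IntB a b u v : intg a b u -> intg a b v ->
  Int a b (fun t => u t - v t) = Int a b u - Int a b v.
Proof. by move=> ui vi; rewrite /Int RintegralB. Qed.

Lemma Int_cst a b k : a <= b -> Int a b (fun=> k) = k * (b - a).
Proof.
move=> ab; rewrite /Int Rintegral_cst //; congr (_ * _).
etransitivity; first exact: (congr1 fine (lebesgue_measure_itv _)).
rewrite /= lte_fin; case: ltP => // ba; suff -> : b - a = 0 by [].
by apply/eqP; rewrite subr_eq0 eq_le ab ba.
Qed.

Lemma Int_pt a v : Int a a v = 0.
Proof. by rewrite /Int set_itv1 Rintegral_set1. Qed.

Lemma eq_Int a b u v : (forall t, a <= t <= b -> u t = v t) ->
  Int a b u = Int a b v.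
Proof.
move=> uv; apply: eq_Rintegral => t; rewrite inE /= in_itv /=; exact: uv.
Qed.

Lemma eq_intg a b u v : (forall t, a <= t <= b -> u t = v t) ->
  intg a b u -> intg a b v.
Proof.
move=> uv; apply: eq_integrable => // t; rewrite inE /= in_itv /= => tab.
by rewrite uv.
Qed.

Lemma Int_cat a b c v : a <= b -> b <= c -> intg a c v ->
  Int a c v = Int a b v + Int b c v.
Proof.
move=> ab bc vi.
have := @Rintegral_itvB R v (BLeft a) (BRight c) b vi.
rewrite !bnd_simp => /(_ ab bc).
rewrite Rintegral_itv_obnd_cbnd; first by rewrite /Int => <-; ring.
apply: integrableS vi => //; apply: subset_itv; by rewrite bnd_simp.
Qed.

Lemma intg_cat a b c v : a <= b -> b <= c -> intg a b v -> intg b c v ->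
  intg a c v.
Proof.
move=> ab bc v1 v2.
have E : (`[a, c] : set R) = `[a, b] `|` `[b, c].
  apply/seteqP; split=> t /=; rewrite !in_itv /=.
    by move=> /andP[h1 h2]; case: (leP t b) => h; [left|right];
      rewrite ?h1 ?h2 // ltW.
  by case=> /andP[h1 h2]; rewrite ?h1 ?h2 ?(le_trans ab) ?(le_trans _ bc).
rewrite /intg E.
have mU : measurable_fun (`[a, b] `|` `[b, c]) (EFin \o v).
  apply/measurable_funU => //; split.
    exact: (measurable_int _ v1).
  exact: (measurable_int _ v2).
apply/integrableP; split => //.
have /integrableP[m1 i1] := v1; have /integrableP[m2 i2] := v2.
apply: (@le_lt_trans _ _ (\int[mu]_(x in `[a, b]) `|(EFin \o v) x| + \int[mu]_(x in `[b,
  c]) `|(EFin \o v) x|)%E); last exact: lte_add_pinfty.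
(* The two intervals share [b]: the second integral is first taken over a difference, then enlarged
   to [[b, c]]. *)
rewrite -(setDUK (A := `[a, b]) (B := `[a, b] `|` `[b, c])); last exact: subsetUl.
have ms : forall D : set (measurableTypeR R), measurable D ->
    D `<=` `[a, b] `|` `[b, c] ->
    measurable_fun D (fun x => `|(EFin \o v) x|)%E.
  move=> D mD DE; apply: measurableT_comp => //.
  by apply: measurable_funS mU => //; exact: measurableU.
rewrite ge0_integral_setU //; last first.
- by apply/disj_setPS => t [? []].
- by apply: ms; [apply: measurableU => //; apply: measurableD => //;
  exact: measurableU|move=> t [ht|[]//]; left].
- by apply: measurableD => //; exact: measurableU.
apply: leeD => //; apply: ge0_subset_integral => //.
- by apply: measurableD => //; exact: measurableU.
- by apply: ms => // t ht; right.
- by move=> t [[]].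

Qed.

Lemma le_Int a b u v : intg a b u -> intg a b v ->
  (forall t, a <= t <= b -> u t <= v t) -> Int a b u <= Int a b v.
Proof.
move=> ui vi uv; apply: le_Rintegral => // t /=; rewrite in_itv /=; exact: uv.
Qed.

Lemma Int_ge0 a b u : (forall t, a <= t <= b -> 0 <= u t) -> 0 <= Int a b u.
Proof.
by move=> h; apply: Rintegral_ge0 => t /=; rewrite in_itv /=; exact: h.
Qed.

Lemma norm_Int a b u : intg a b u -> `|Int a b u| <= Int a b (fun t => `|u t|).
Proof. by move=> ui; exact: le_normr_Rintegral. Qed.

Lemma Int_sum a b (I : Type) (r : seq I) (x : I -> R -> R) :
  (forall i, intg a b (x i)) ->
  Int a b (fun t => \sum_(i <- r) x i t) = \sum_(i <- r) Int a b (x i).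
Proof.
move=> xc; elim: r => [|i r IH].
  rewrite big_nil -[RHS](mul0r (b - a)).
  rewrite (@eq_Int _ _ _ (fun=> 0)); last by move=> t _; rewrite big_nil.
  rewrite mul0r /Int Rintegral_cst //; exact: mul0r.
rewrite big_cons -IH -IntD //; last exact: intg_sum.
by apply: eq_Int => t _; rewrite big_cons.
Qed.

Lemma ae_eq_Int a b u v : intg a b u -> intg a b v ->
  {ae mu, forall t, a <= t <= b -> u t = v t} -> Int a b u = Int a b v.
Proof.
move=> ui vi uv; rewrite /Int /Rintegral; congr fine.
apply: ae_eq_integral => //.
- by apply/measurable_EFinP; exact: intg_meas.
- by apply/measurable_EFinP; exact: intg_meas.
apply: (ae_imp uv) => t H /=; rewrite in_itv /= => tab; by rewrite H.
Qed.

(** The scalar case of [weak_derivative]: absolute continuity is carried by the integral formula, so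
    the rules of calculus below are identities between integrals. *)
Definition prim a b (x v : R -> R) : Prop :=
  intg a b v /\ forall t, a <= t <= b -> x t = x a + Int a t v.

Lemma prim_le a b c d v : a <= c -> c <= d -> d <= b -> intg a b v ->
  Int a d v - Int a c v = Int c d v.
Proof.
move=> ac cd db vi; rewrite (@Int_cat a c d) //; first by ring.
exact: intg_sub vi.
Qed.

Lemma prim_diff a b x v : prim a b x v ->
  forall c d, a <= c -> c <= d -> d <= b -> x d - x c = Int c d v.
Proof.
move=> [vi H] c d ac cd db; rewrite H ?(le_trans ac) // [in X in _ - X]H.
  rewrite -(prim_le ac cd db vi); ring.
by rewrite ac (le_trans cd).
Qed.

Lemma primP a b x v : intg a b v ->
  (forall c d, a <= c -> c <= d -> d <= b -> x d - x c = Int c d v) ->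
  prim a b x v.
Proof.
move=> vi H; split=> // t /andP[ta tb]; rewrite -(H a t) //; ring.
Qed.

Lemma prim_sub a b a' b' x v : a <= a' -> b' <= b -> prim a b x v ->
  prim a' b' x v.
Proof.
move=> aa bb p; apply: primP; first by apply: intg_sub (p.1).
move=> c d ac cd db; apply: (prim_diff p) => //.
  exact: le_trans ac.
exact: le_trans bb.
Qed.

Lemma prim_cat a b c x v : a <= b -> b <= c -> prim a b x v -> prim b c x v ->
  prim a c x v.
Proof.
move=> ab bc p q; have vi := intg_cat ab bc p.1 q.1.
split=> // t /andP[at' tc]; have [tb|bt] := leP t b.
  by apply p.2; rewrite at' tb.
rewrite (q.2 t) ?(ltW bt) ?tc // (p.2 b) ?ab ?lexx // (@Int_cat a b t) ?(ltW bt) //.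
  ring.
exact: intg_sub vi.
Qed.

Lemma prim_ext a b x v x' v' : prim a b x v ->
  (forall t, a <= t <= b -> x t = x' t) -> intg a b v' ->
  {ae mu, forall t, a <= t <= b -> v t = v' t} -> prim a b x' v'.
Proof.
move=> [vi H] xx v'i vv; split=> // t /andP[ta tb].
rewrite -!xx ?ta ?lexx ?(le_trans ta tb) // H ?ta //; congr (_ + _).
apply: ae_eq_Int; [exact: intg_sub vi|exact: intg_sub v'i|].
apply: (ae_imp vv) => s h /andP[h1 h2]; apply: h; rewrite h1 /=.
exact: le_trans tb.
Qed.

Lemma prim_eq a b x v x' v' : prim a b x v ->
  (forall t, a <= t <= b -> x t = x' t) ->
  (forall t, a <= t <= b -> v t = v' t) -> prim a b x' v'.
Proof.
move=> p xx vv; apply: (prim_ext p xx); first exact: eq_intg p.1.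
by apply: ae_all.
Qed.

Lemma primD a b x v y w : prim a b x v -> prim a b y w ->
  prim a b (fun t => x t + y t) (fun t => v t + w t).
Proof.
move=> p q; apply: primP; first exact: intgD p.1 q.1.
move=> c d ac cd db.
rewrite IntD; [|exact: intg_sub p.1|exact: intg_sub q.1].
rewrite -(prim_diff p) // -(prim_diff q) //; ring.
Qed.

Lemma primZ a b k x v : prim a b x v ->
  prim a b (fun t => k * x t) (fun t => k * v t).
Proof.
move=> p; apply: primP; first exact: intgZ p.1.
move=> c d ac cd db.
rewrite IntZ; [|exact: intg_sub p.1].
rewrite -(prim_diff p) //; ring.
Qed.

Lemma prim_cst a b k : prim a b (fun=> k) (fun=> 0).
Proof.
apply: primP; first exact: intg_cst.
by move=> c d _ cd _; rewrite Int_cst // mul0r subrr.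
Qed.

Lemma prim_sum a b (I : Type) (r : seq I) (x v : I -> R -> R) :
  (forall i, prim a b (x i) (v i)) ->
  prim a b (fun t => \sum_(i <- r) x i t) (fun t => \sum_(i <- r) v i t).
Proof.
move=> H; elim: r => [|i r IH].
  by apply: (prim_eq (prim_cst a b 0)) => t _; rewrite big_nil.
by apply: (prim_eq (primD (H i) IH)) => t _; rewrite big_cons.
Qed.

Lemma prim_cts a b x v : prim a b x v -> cts a b x.
Proof.
move=> p; have [ab|ba] := leP a b; last first.
  by move=> t /andP[h1 h2]; have := le_trans h1 h2; rewrite leNgt ba.
have /cts_within := parameterized_integral_continuous ab p.1.
move=> /(ctsD (@cts_cst a b (x a))); apply: cts_ext => t tab.
by rewrite (p.2 t tab).
Qed.

Lemma prim_norm a b x v : prim a b x v ->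
  forall c d, a <= c -> c <= d -> d <= b ->
  `|x d - x c| <= Int c d (fun t => `|v t|).
Proof.
move=> p c d ac cd db; rewrite (prim_diff p) //; apply: norm_Int.
exact: intg_sub p.1.
Qed.

Lemma eq0_small (D K : R) : (forall e : R, 0 < e -> `|D| <= e * K) -> D = 0.
Proof.
move=> H; apply/eqP; rewrite -normr_le0 leNgt; apply/negP => D0.
have K0 : 0 < K by have := H 1 ltr01; rewrite mul1r; exact: lt_le_trans.
have /H : 0 < `|D| / (2 * K) by rewrite divr_gt0 // mulr_gt0.
rewrite (_ : _ * K = `|D| / 2); last by field; exact: lt0r_neq0.
set D' := `|D| in D0 *; lra.
Qed.

(** The defect of the product rule is additive over intervals. On a short interval [x] and [z]
    oscillate by at most [e], so the defect is at most [e] times the integral of [k]; [itv_ind] adds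
    up these bounds and [e] is arbitrary. *)
Lemma primM a b x u z w : prim a b x u -> prim a b z w ->
  prim a b (fun t => x t * z t) (fun t => x t * w t + z t * u t).
Proof.
move=> p q; have xc := prim_cts p; have zc := prim_cts q.
have gi : intg a b (fun t => x t * w t + z t * u t).
  by apply: intgD; apply: intgM => //; [exact: q.1|exact: p.1].
apply: primP => // c d ac cd db; apply/eqP; rewrite -subr_eq0; apply/eqP.
pose k (t : R) : R := `|u t| + `|w t|.
have ki : intg a b k by apply: intgD; apply: intg_norm; [exact: p.1|exact: q.1].
apply: (@eq0_small _ (Int c d k)) => e e0.
apply: (@itv_ind (fun c d => `|x d * z d - x c * z c -
  Int c d (fun t => x t * w t + z t * u t)| <= e * Int c d k) c d) => //.
- move=> r1 r2 r3 h1 h2 h3 h4 P Q.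
  have s1 : a <= r1 by lra.
  have s2 : r3 <= b by lra.
  rewrite (Int_cat h2 h3 (intg_sub s1 s2 gi)) (Int_cat h2 h3 (intg_sub s1 s2 ki)).
  rewrite mulrDr; apply: le_trans (lerD P Q); apply: le_trans (ler_normD _ _).
  by rewrite le_eqVlt; apply/orP; left; apply/eqP; congr `|_|; ring.
- move=> t /andP[ct td].
  have tab : a <= t <= b by apply/andP; split; lra.
  have e2 : 0 < e / 2 by lra.
  have [d1 d10 H1] := xc t tab _ e2; have [d2 d20 H2] := zc t tab _ e2.
  exists (Num.min d1 d2); first by rewrite lt_min d10 d20.
  move=> r1 r2 h1 h2 h3; set dd := Num.min d1 d2 => h4 h5.
  have s1 : a <= r1 by lra.
  have s2 : r2 <= b by lra.
  have dd1 : dd <= d1 by rewrite ge_min lexx.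
  have dd2 : dd <= d2 by rewrite ge_min lexx orbT.
  have N : forall r, r1 <= r <= r2 -> `|x r - x t| < e / 2 /\ `|z r - z t| < e / 2.
    move=> r rr; split; [apply: H1|apply: H2]; rewrite ?(sub_itv s1 s2) //.
      exact: near_itv h4 h5 rr.
    exact: near_itv h4 h5 rr.
  have Nx : forall r s, r1 <= r <= r2 -> r1 <= s <= r2 -> `|x r - x s| <= e.
    by move=> r s /N[rx _] /N[sx _]; exact: dist_half rx sx.
  have Nz : forall r s, r1 <= r <= r2 -> r1 <= s <= r2 -> `|z r - z s| <= e.
    by move=> r s /N[_ rx] /N[_ sx]; exact: dist_half rx sx.
  have wi := intg_sub s1 s2 q.1; have ui := intg_sub s1 s2 p.1.
  have gi' := intg_sub s1 s2 gi; have ki' := intg_sub s1 s2 ki.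
  (* Discrete Leibniz rule: freezing [x] at the right end and [z] at the left end makes the
     increment of the product exact. *)
  have -> : x r2 * z r2 - x r1 * z r1 - Int r1 r2 (fun t => x t * w t + z t * u t)
    = Int r1 r2 (fun t => (x r2 * w t + z r1 * u t) - (x t * w t + z t * u t)).
    rewrite IntB //; last by apply: intgD; apply: intgZ.
    rewrite [X in _ = X - _]IntD; [|exact: intgZ|exact: intgZ].
    rewrite !IntZ // -(prim_diff p) // -(prim_diff q) //; ring.
  apply: le_trans (norm_Int _) _.
    by apply: intgB => //; apply: intgD; apply: intgZ.
  rewrite -IntZ //; apply: le_Int.
  - by apply: intg_norm; apply: intgB => //; apply: intgD; apply: intgZ.
  - exact: intgZ.
  move=> s sr.
  rewrite (_ : _ - _ = (x r2 - x s) * w s + (z r1 - z s) * u s); last by ring.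
  apply: le_trans (ler_normD _ _) _; rewrite !normrM /k mulrDr addrC.
  by apply: lerD; apply: ler_wpM2r => //; [apply: Nz|apply: Nx] => //;
    rewrite ?lexx ?h2.
Qed.

Lemma Int_gt0 a b u t0 : cts a b u -> a < b ->
  (forall t, a <= t <= b -> 0 <= u t) -> a <= t0 <= b -> 0 < u t0 ->
  0 < Int a b u.
Proof.
move=> uc ab u0 t0ab ut0.
have e2 : 0 < u t0 / 2 by lra.
have [d d0 H] := uc t0 t0ab _ e2.
pose c := Num.max a (t0 - d / 2); pose c' := Num.min b (t0 + d / 2).
have [t0a t0b] : a <= t0 /\ t0 <= b by apply/andP.
have cc : c < c'.
  by rewrite /c /c' lt_min !gt_max ab /=; apply/andP; split;
    [|apply/andP; split]; lra.
have ac : a <= c by rewrite le_max lexx.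
have cb : c' <= b by rewrite ge_min lexx.
have ui := cts_intg uc.
rewrite (@Int_cat a c b) //; last by lra.
rewrite (@Int_cat c c' b) //; [|lra|by apply: intg_sub ui].
have h1 : 0 <= Int a c u.
  by apply: Int_ge0 => t /andP[h1 h2]; apply: u0; apply/andP; split; lra.
have h2 : 0 <= Int c' b u.
  by apply: Int_ge0 => t /andP[h1' h2]; apply: u0; apply/andP; split; lra.
have : Int c c' (fun=> u t0 / 2) <= Int c c' u.
  apply: le_Int; [exact: intg_cst|by apply: intg_sub ui|].
  move=> t /andP[tc tc'].
  have c1 : t0 - d / 2 <= c by rewrite le_max lexx orbT.
  have c2 : c' <= t0 + d / 2 by rewrite ge_min lexx orbT.
  have := H t ltac:(apply/andP; split; lra).
  rewrite !ltr_norml => /(_ ltac:(apply/andP; split; lra)) /andP[]; lra.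
rewrite Int_cst; last exact: ltW.
have : 0 < u t0 / 2 * (c' - c) by apply: mulr_gt0 => //; lra.
lra.
Qed.

End IntervalInduction.

(** * Smooth functions *)

Section Calculus.
Context (R : realType).

Lemma iter_derive_rcons (V W : normedModType R) (vs : seq V) v (F : V -> W) :
  iter_derive (rcons vs v) F = iter_derive vs (fun x => 'D_v F x).
Proof. by elim: vs => //= u vs ->. Qed.

Lemma smooth_derive (V W : normedModType R) (O : set V) (F : V -> W) v :
  smooth_on O F -> smooth_on O (fun x => 'D_v F x).
Proof. by move=> sF vs u x Ox; rewrite -iter_derive_rcons; exact: sF. Qed.

Lemma smooth_derivable (V W : normedModType R) (O : set V) (F : V -> W) x v :
  smooth_on O F -> O x -> derivable F x v.
Proof. by move=> sF Ox; have [] := sF [::] v x Ox. Qed.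

Lemma smooth_continuous (V W : normedModType R) (O : set V) (F : V -> W) x :
  smooth_on O F -> O x -> {for x, continuous F}.
Proof. by move=> sF Ox; have [] := sF [::] 0 x Ox. Qed.

Lemma smooth_local (V W : normedModType R) (O : set V) (F : V -> W) :
  (forall x, O x -> exists2 O', O' x & smooth_on O' F) -> smooth_on O F.
Proof. by move=> H vs v x /H [U Ux sF]; exact: sF. Qed.

Lemma smooth_ext (V W : normedModType R) (O : set V) (F G : V -> W) :
  open O -> (forall x, O x -> F x = G x) -> smooth_on O F -> smooth_on O G.
Proof.
move=> oO FG sF.
have E : forall vs x, O x -> iter_derive vs F x = iter_derive vs G x.
  elim=> [|v vs IH] x Ox /=; first exact: FG.
  have [->|v0] := eqVneq v 0; first by rewrite !derive0.
  by apply: near_eq_derive => //; near=> y; apply: IH; near: y; exact: open_nbhs_nbhs.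
have N vs x : O x -> \near x, iter_derive vs F x = iter_derive vs G x.
  by move=> Ox; near=> y; apply: E; near: y; exact: open_nbhs_nbhs.
move=> vs v x Ox; have [d c] := sF vs v x Ox; split.
  have [->|v0] := eqVneq v 0; first exact: derivable0.
  by apply: near_eq_derivable d => //; exact: N.
rewrite /prop_for /continuous_at -E //; apply: cvg_trans c; apply: near_eq_cvg.
exact: N.
Unshelve. all: by end_near. Qed.

(** Each iterated derivative of [F] coincides on the open set [O] with a member of [C]. Closure
    under a single derivative therefore suffices, without formulas for higher derivatives. *)
Lemma smooth_coind (V W : normedModType R) (O : set V) (C : (V -> W) -> Prop) :
  open O ->
  (forall F x v, C F -> O x -> derivable F x v /\ {for x, continuous F}) ->
  (forall F v, C F -> exists2 F', C F' & forall x, O x -> 'D_v F x = F' x) ->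
  forall F, C F -> smooth_on O F.
Proof.
move=> oO Cd CD F CF.
have E vs : exists2 F', C F' & forall x, O x -> iter_derive vs F x = F' x.
  elim: vs => [|v vs [F1 CF1 E1]] /=; first by exists F.
  have [F2 CF2 E2] := CD F1 v CF1; exists F2 => // x Ox; rewrite -E2 //.
  have [->|v0] := eqVneq v 0; first by rewrite !derive0.
  by apply: near_eq_derive => //; near=> y; apply: E1; near: y; exact: open_nbhs_nbhs.
move=> vs v x Ox; have [F' CF' E'] := E vs.
have N : \near x, F' x = iter_derive vs F x.
  by near=> y; rewrite E' //; near: y; exact: open_nbhs_nbhs.
have [d c] := Cd F' x v CF' Ox; split.
  have [->|v0] := eqVneq v 0; first exact: derivable0.
  exact: near_eq_derivable d.
rewrite /prop_for /continuous_at E' //; apply: cvg_trans c; apply: near_eq_cvg.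
exact: N.
Unshelve. all: by end_near. Qed.

Lemma smooth_entry (V : normedModType R) p m (O : set V) (F : V -> 'M[R]_(p, m))
  i j : open O -> smooth_on O F -> smooth_on O (fun x => F x i j).
Proof.
move=> oO sF; apply: (@smooth_coind V R O
  (fun G : V -> R => exists2 H : V -> 'M[R]_(p, m), smooth_on O H & G = fun x => H x i j))
    => //; last by exists F.
- move=> G x v [H sH ->] Ox; split.
    by have /derivable_mxP := smooth_derivable (v:=v) sH Ox; apply.
  have c := smooth_continuous sH Ox.
  apply: (@continuous_comp _ _ _ H (fun M : 'M[R]_(p, m) => M i j)) => //.
  exact: coord_continuous.
- move=> G v [H sH ->]; exists (fun x => 'D_v H x i j).
    by exists (fun x => 'D_v H x); [exact: smooth_derive|].
  by move=> x Ox; rewrite (derive_mx (smooth_derivable (v:=v) sH Ox)) mxE.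
Qed.

Lemma is_derive_line (V : normedModType R) (F : V -> R) x v s :
  derivable F (x + s *: v) v ->
  is_derive s 1 (fun s : R => F (x + s *: v)) ('D_v F (x + s *: v)).
Proof.
move=> d.
have E : (fun h : R => h^-1 *: (F (x + (h *: 1 + s) *: v) - F (x + s *: v))) =
   (fun h : R => h^-1 *: (F (h *: v + (x + s *: v)) - F (x + s *: v))).
  apply/funext => h; congr (_ *: (F _ - _)).
  have -> : h *: (1 : R) = h by rewrite /GRing.scale /= mulr1.
  by rewrite scalerDl addrCA.
apply: DeriveDef; first by rewrite /derivable /= E.
by rewrite /derive /= E.
Qed.

Lemma mvt_line (V : normedModType R) (F : V -> R) x v (h : R) :
  (forall t : R, 0 <= t <= 1 -> derivable F (x + (t * h) *: v) v) ->
  exists2 t : R, 0 <= t <= 1 &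
    F (x + h *: v) - F x = h * 'D_v F (x + (t * h) *: v).
Proof.
move=> d; pose phi (s : R) : R := F (x + s *: v).
have dh (s : R) : (0 <= s <= h) || (h <= s <= 0) -> is_derive s 1 phi ('D_v F (x + s *: v)).
  move=> sh; apply: is_derive_line.
  have [h0|h0] := eqVneq h 0.
    move: sh; rewrite h0 => sh.
    have -> : s = 0 by apply/eqP; rewrite eq_le andbC; case/orP: sh.
    by have := d 0; rewrite h0 mulr0; apply; rewrite lexx ler01.
  have := d (s / h); rewrite divfK //; apply.
  move: sh => /orP[/andP[s0 sh]|/andP[sh s0]].
    have hp : 0 < h by rewrite lt_neqAle eq_sym h0 (le_trans s0).
    by rewrite divr_ge0 // ?(ltW hp) //= ler_pdivrMr // mul1r.
  have hn : h < 0 by rewrite lt_neqAle h0 (le_trans sh).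
  by rewrite ler_ndivrMr // ler_ndivlMr // mul0r mul1r s0 sh.
have E0 : F x = phi 0 by rewrite /phi scale0r addr0.
rewrite E0 -/(phi h).
have [h0|h0|->] := ltgtP h 0.
- have [||c ch E] := @MVT_segment R phi (fun s => 'D_v F (x + s *: v)) h 0 (ltW h0).
  + move=> s; rewrite in_itv /= => /andP[s1 s2]; apply: dh.
    by rewrite (ltW s1) (ltW s2) orbT.
  + apply: derivable_within_continuous => s; rewrite in_itv /= => sh.
    by have [] := dh s; rewrite ?sh ?orbT.
  exists (c / h); last by rewrite divfK ?ltr0_neq0 //; move: E; lra.
  move: ch; rewrite in_itv /= => /andP[c1 c2].
  by rewrite ler_ndivrMr // ler_ndivlMr // mul0r mul1r c1 c2.
- have [||c ch E] := @MVT_segment R phi (fun s => 'D_v F (x + s *: v)) 0 h (ltW h0).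
  + move=> s; rewrite in_itv /= => /andP[s1 s2]; apply: dh.
    by rewrite (ltW s1) (ltW s2).
  + apply: derivable_within_continuous => s; rewrite in_itv /= => sh.
    by have [] := dh s; rewrite ?sh.
  exists (c / h); last by rewrite divfK ?gt_eqF //; move: E; lra.
  move: ch; rewrite in_itv /= => /andP[c1 c2].
  by rewrite ler_pdivrMr // ler_pdivlMr // mul0r mul1r c1 c2.
- by exists 0; rewrite ?lexx ?ler01 // subrr mul0r.
Qed.

(** * Strict differentiability and the chain rule *)

Section RowVectors.
Context (n : nat).
Local Notation V := 'rV[R]_n.
Local Notation e_ k := (delta_mx 0 k : V).

Definition box (y : V) (d : R) : set V :=
  [set z | forall k, `|z 0 k - y 0 k| < d].

Lemma nbhs_box (y : V) (A : set V) : nbhs y A <->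
  exists2 d : R, 0 < d & box y d `<=` A.
Proof.
split=> [/nbhs_ballP[d /= d0 H]|[d d0 H]].
  exists d => // z zy; apply: H; split=> // i j; rewrite ord1.
  by rewrite /ball /= distrC.
apply/nbhs_ballP; exists d => //= z [_ zy]; apply: H => k.
by have := zy 0 k; rewrite /ball /= distrC.
Qed.

Lemma box_sub (y : V) d d' : d <= d' -> box y d `<=` box y d'.
Proof. by move=> dd z zy k; exact: lt_le_trans (zy k) dd. Qed.

Lemma box_center (y : V) d : 0 < d -> box y d y.
Proof. by move=> d0 k; rewrite subrr normr0. Qed.

Lemma row_sum (v : V) : v = \sum_k v 0 k *: e_ k.
Proof. exact: row_sum_delta. Qed.

Definition pd (k : 'I_n) (F : V -> R) : V -> R := fun x => 'D_(e_ k) F x.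

(** Go from [q] to [p] one coordinate at a time, with the mean value theorem on each segment. The
    intermediate points take each coordinate from [p] or from [q], so they stay in the box, which is
    a product of intervals. *)
Lemma hybrid_est (F : V -> R) y0 d (D : 'I_n -> R) eta :
  (forall z k, box y0 d z -> derivable F z (e_ k)) ->
  (forall z k, box y0 d z -> `|pd k F z - D k| <= eta) ->
  forall p q, box y0 d p -> box y0 d q ->
  `|F p - F q - \sum_k D k * (p 0 k - q 0 k)|
     <= eta * \sum_k `|p 0 k - q 0 k|.
Proof.
move=> Fd FD p q Bp Bq.
pose z (s : seq 'I_n) : V := \row_j (if j \in s then p 0 j else q 0 j).
suff H s : uniq s -> `|F (z s) - F q - \sum_(k <- s) D k * (p 0 k - q 0 k)|
     <= eta * \sum_(k <- s) `|p 0 k - q 0 k|.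
  have := H (enum 'I_n) (enum_uniq _).
  rewrite (_ : z _ = p); first by rewrite !big_enum.
  by apply/rowP => j; rewrite mxE mem_enum.
elim: s => [|i s IH] /=.
  move=> _; rewrite !big_nil mulr0 subr0 (_ : z _ = q) ?subrr ?normr0 //.
  by apply/rowP => j; rewrite mxE.
move=> /andP[si /IH {}IH]; rewrite !big_cons.
have zE : z (i :: s) = z s + (p 0 i - q 0 i) *: e_ i.
  apply/rowP => j; rewrite !mxE eqxx /= in_cons.
  case: eqVneq => [->|ji] /=; first by rewrite (negbTE si) mulr1 addrC subrK.
  by rewrite mulr0 addr0.
have B t : 0 <= t <= 1 -> box y0 d (z s + (t * (p 0 i - q 0 i)) *: e_ i).
  move=> /andP[t0 t1] k; rewrite !mxE eqxx /=.
  have [->|ki] := eqVneq k i; last first.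
    by rewrite mulr0 addr0; case: ifP => _; [exact: Bp|exact: Bq].
  rewrite (negbTE si) mulr1.
  have -> : q 0 i + t * (p 0 i - q 0 i) - y0 0 i =
    t * (p 0 i - y0 0 i) + (1 - t) * (q 0 i - y0 0 i) by ring.
  apply: le_lt_trans (ler_normD _ _) _; rewrite !normrM (ger0_norm t0).
  rewrite (ger0_norm (_ : 0 <= 1 - t)) ?subr_ge0 //.
  have := Bp i; have := Bq i; set P := `|p 0 i - _|; set Q := `|q 0 i - _|.
  move=> hQ hP.
  have [->|tn] := eqVneq t 1; first by rewrite subrr mul0r mul1r addr0.
  have t1' : 0 < 1 - t by rewrite subr_gt0 lt_neqAle tn.
  have : t * P <= t * d by apply: ler_wpM2l => //; exact: ltW.
  have : (1 - t) * Q < (1 - t) * d by rewrite ltr_pM2l.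
  lra.
have [t t01 Et] := @mvt_line _ F (z s) (e_ i) (p 0 i - q 0 i)
  (fun t t01 => Fd _ i (B t t01)).
rewrite zE [X in _ <= X]mulrDr.
rewrite [X in `|X|](_ : _ =
   (p 0 i - q 0 i) * (pd i F (z s + (t * (p 0 i - q 0 i)) *: e_ i) - D i) +
   (F (z s) - F q - \sum_(j <- s) D j * (p 0 j - q 0 j))); last first.
  rewrite (mulrBr (p 0 i - q 0 i) (pd i F _)) /pd -Et; ring.
apply: le_trans (ler_normD _ _) _; apply: lerD => //.
by rewrite normrM mulrC; apply: ler_wpM2r => //; apply: FD; exact: B.
Qed.

(** Strict differentiability at [y0] with partial derivatives [D]. Both points move, so one estimate
    serves a whole piece of a curve near [y0]. *)
Definition strict_at (F : V -> R) (y0 : V) (D : 'I_n -> R) : Prop :=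
  forall eta : R, 0 < eta -> exists2 d : R, 0 < d & forall p q,
    box y0 d p -> box y0 d q ->
    `|F p - F q - \sum_k D k * (p 0 k - q 0 k)| <= eta * \sum_k `|p 0 k - q 0 k|.

Lemma cts_box (F : V -> R) y0 : {for y0, continuous F} ->
  forall e : R, 0 < e -> exists2 d : R, 0 < d &
    forall z, box y0 d z -> `|F z - F y0| < e.
Proof.
move=> /cvgrPdist_lt c e e0; have /nbhs_box[d d0 H] := c e e0.
by exists d => // z /H /=; rewrite distrC.
Qed.

Lemma box_all (I : finType) (P : I -> set V) y0 :
  (forall i, exists2 d : R, 0 < d & box y0 d `<=` P i) ->
  exists2 d : R, 0 < d & forall i, box y0 d `<=` P i.
Proof.
move=> H.
have /nbhs_box[d d0 Hd] : nbhs y0 [set z | forall i, P i z].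
  exact: (@filter_forall _ _ P (nbhs y0) _ (fun i => (nbhs_box y0 (P i)).2 (H i))).
by exists d => // i z /Hd; apply.
Qed.

Lemma smooth_strict (O : set V) (F : V -> R) y0 : open O -> smooth_on O F ->
  O y0 -> strict_at F y0 (fun k => pd k F y0).
Proof.
move=> oO sF Oy eta eta0.
have /nbhs_box[d1 d10 H1] : nbhs y0 O by exact: open_nbhs_nbhs.
have [d2 d20 H2] := @box_all _ (fun k z => `|pd k F z - pd k F y0| < eta) y0
  (fun k => cts_box (smooth_continuous (smooth_derive (e_ k) sF) Oy) eta0).
exists (Num.min d1 d2); first by rewrite lt_min d10 d20.
apply: hybrid_est => z k Bz.
  apply: smooth_derivable sF _; apply: H1; apply: box_sub Bz.
  by rewrite ge_min lexx.
apply/ltW/H2; apply: box_sub Bz; by rewrite ge_min lexx orbT.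
Qed.

(** Only a directional derivative of [u] is available, since smoothness is expressed by directional
    derivatives; strictness of [F] at [u x] makes up for it, as it applies to the points
    [u (h *: w + x)] whatever way they approach [u x]. *)
Lemma strict_chain (U : normedModType R) (u : U -> V) x w (F : V -> R) D :
  derivable u x w -> strict_at F (u x) D ->
  is_derive x w (F \o u) (\sum_k D k * 'D_w u x 0 k).
Proof.
move=> ud sF.
pose q (k : 'I_n) (h : R) : R := h^-1 * (u (h *: w + x) 0 k - u x 0 k).
pose q0 (k : 'I_n) : R := 'D_w u x 0 k.
have qc k : q k h @[h --> 0^'] --> q0 k.
  have /derivable_mxP /(_ 0 k) /cvg_ex[l /= hl] := ud.
  rewrite /q0 (derive_mx ud) mxE /derive /=.
  by rewrite (cvg_lim _ hl).
have main : h^-1 *: ((F \o u) (h *: w + x) - (F \o u) x) @[h --> 0^'] -->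
   \sum_k D k * q0 k.
  apply/cvgrPdist_le => e e0.
  pose S := \sum_k (`|q0 k| + 1); pose T := \sum_k `|D k|.
  have S0 : 0 <= S by apply: sumr_ge0 => k _; rewrite addr_ge0.
  have T0 : 0 <= T by exact: sumr_ge0.
  (* [S] bounds the sum of the [|q k h|], so the error in strictness costs at most [e / 2]; the
     convergence of the [q k], controlled by [e1], costs the other half. *)
  pose eta := e / (2 * (S + 1)).
  have eta0 : 0 < eta by rewrite divr_gt0 // mulr_gt0 // ltr_wpDl.
  have [d d0 Hd] := sF eta eta0.
  pose e1 := Num.min 1 (e / (2 * (T + 1))).
  have e10 : 0 < e1 by rewrite lt_min ltr01 divr_gt0 // mulr_gt0 // ltr_wpDl.
  near=> h.
  have h0 : h != 0 by near: h; exact: nbhs_dnbhs_neq.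
  have hq k : `|q0 k - q k h| < e1.
    move: k; near: h.
    by apply: filter_forall => k; have /cvgrPdist_lt := qc k; exact.
  have hS : `|h| * (S + 1) < d.
    rewrite -ltr_pdivlMr ?ltr_wpDl //; near: h; apply: dnbhs0_lt.
    by rewrite divr_gt0 // ltr_wpDl.
  have e11 : e1 <= 1 by rewrite ge_min lexx.
  have qb k : `|q k h| <= `|q0 k| + 1.
    have -> : q k h = q0 k - (q0 k - q k h) by ring.
    apply: le_trans (ler_normB _ _) _; rewrite lerD2l.
    exact/ltW/(lt_le_trans (hq k)).
  have ub k : u (h *: w + x) 0 k - u x 0 k = h * q k h by rewrite /q mulVKf.
  have Bp : box (u x) d (u (h *: w + x)).
    move=> k; rewrite ub normrM; apply: le_lt_trans hS.
    apply: ler_wpM2l => //; apply: le_trans (qb k) _.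
    rewrite /S (bigD1 k) //= -addrA lerDl addr_ge0 //.
    by apply: sumr_ge0 => j _; rewrite addr_ge0.
  have := Hd _ _ Bp (box_center _ d0).
  under eq_bigr do rewrite ub.
  under [X in _ <= _ * X]eq_bigr do rewrite ub normrM.
  rewrite -mulr_sumr.
  have -> : \sum_k D k * (h * q k h) = h * \sum_k D k * q k h.
    by rewrite mulr_sumr; apply: eq_bigr => k _; ring.
  set r := F _ - F _ => Hr.
  have -> : \sum_k D k * q0 k - h^-1 *: ((F \o u) (h *: w + x) - (F \o u) x) =
    \sum_k D k * (q0 k - q k h) - h^-1 * (r - h * \sum_k D k * q k h).
    have -> : h^-1 * (r - h * \sum_k D k * q k h) = h^-1 * r - \sum_k D k * q k h by
      rewrite mulrBr mulKf.
    rewrite /GRing.scale /= -/r.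
    under [in RHS]eq_bigr do rewrite mulrBr.
    rewrite sumrB; ring.
  apply: le_trans (ler_normB _ _) _.
  rewrite (splitr e); apply: lerD.
    apply: le_trans (ler_norm_sum _ _ _) _.
    apply: (@le_trans _ _ (T * e1)).
      rewrite /T mulr_suml; apply: ler_sum => k _; rewrite normrM.
      by apply: ler_wpM2l => //; exact: ltW.
    apply: (@le_trans _ _ ((T + 1) * e1)); first by apply: ler_wpM2r; [exact: ltW|lra].
    rewrite mulrC -ler_pdivlMr ?ltr_wpDl //.
    by rewrite -mulf_div mulrA in e1 e10 hq e11 qb * || idtac;
       rewrite ge_min; apply/orP; right; rewrite invfM mulrA.
  rewrite normrM normfV ler_pdivrMl ?normr_gt0 //.
  apply: le_trans Hr _; rewrite mulrCA; apply: ler_wpM2l => //.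
  apply: (@le_trans _ _ (eta * (S + 1))).
    apply: ler_wpM2l; first exact: ltW.
    by apply: ler_wpDr => //; apply: ler_sum.
  by rewrite /eta invfM mulrA divfK // gt_eqF // ltr_wpDl.
apply: DeriveDef; first by apply/cvg_ex; exists (\sum_k D k * q0 k).
exact: cvg_lim main.
Unshelve. all: by end_near. Qed.

End RowVectors.
End Calculus.

(** * Symmetry of second derivatives *)

Section Schwarz.
Context (R : realType) (n : nat).
Local Notation V := 'rV[R]_n.
Local Notation e_ k := (delta_mx 0 k : V).
Implicit Types (O : set V) (F : V -> R).

Lemma is_derive_shifted (U W : normedModType R) (F : U -> W) z w u :
  derivable F (z + w) u -> is_derive z u (fun z => F (z + w)) ('D_u F (z + w)).
Proof.
move=> d.
have E : (fun h : R => h^-1 *: (((fun z => F (z + w)) \o shift z) (h *: u) - F (z + w))) =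
   (fun h : R => h^-1 *: ((F \o shift (z + w)) (h *: u) - F (z + w))).
  by apply/funext => h /=; rewrite addrA.
by apply: DeriveDef; rewrite /derivable /derive /= E.
Qed.

Lemma derive_comp_strict (U : normedModType R) (u : U -> V) x w F O :
  open O -> smooth_on O F -> O (u x) -> derivable u x w ->
  is_derive x w (F \o u) (\sum_k 'D_w u x 0 k * pd k F (u x)).
Proof.
move=> oO sF Ox ud; have := strict_chain ud (smooth_strict oO sF Ox).
by under eq_bigr do rewrite mulrC.
Qed.

Lemma derive_dir F O x v : open O -> smooth_on O F -> O x ->
  'D_v F x = \sum_k v 0 k * pd k F x.
Proof.
move=> oO sF Ox; have [_ E] := @derive_comp_strict V id x v F O oO sF Ox
  (@derivable_id _ _ x v).
by rewrite derive_id in E.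
Qed.

Lemma derive_comp F O (U : normedModType R) (u : U -> V) x w :
  open O -> smooth_on O F -> O (u x) -> derivable u x w ->
  'D_w (F \o u) x = 'D_('D_w u x) F (u x).
Proof.
move=> oO sF Ox ud; have [_ ->] := derive_comp_strict oO sF Ox ud.
by rewrite (derive_dir _ oO sF Ox).
Qed.

(** The mean value theorem twice: along [u] for the difference [G] of [F] and its translate, then
    along [v] for the derivative of [F] along [u]. *)
Lemma second_diff O F x u v (h : R) : smooth_on O F ->
  (forall s t : R, 0 <= s <= 1 -> 0 <= t <= 1 ->
     O (x + (s * h) *: u + (t * h) *: v)) ->
  exists s t : R, [/\ 0 <= s <= 1, 0 <= t <= 1 &
    F (x + h *: u + h *: v) - F (x + h *: u) - (F (x + h *: v) - F x) =
    h * (h * 'D_v (fun z => 'D_u F z) (x + (s * h) *: u + (t * h) *: v))].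
Proof.
move=> sF HO.
have i0 : (0 : R) <= (0 : R) <= 1 by rewrite lexx /= ler01.
have i1 : (0 : R) <= (1 : R) <= 1 by rewrite lexx ler01.
pose G z := F (z + h *: v) - F z.
have dG t : 0 <= t <= 1 -> is_derive (x + (t * h) *: u) u G
   ('D_u F (x + (t * h) *: u + h *: v) - 'D_u F (x + (t * h) *: u)).
  move=> t01; apply: is_deriveB; last first.
    apply: derivableP; apply: smooth_derivable sF _.
    by have := HO t 0 t01 i0; rewrite mul0r scale0r addr0.
  apply: is_derive_shifted; apply: smooth_derivable sF _.
  by have := HO t 1 t01 i1; rewrite mul1r.
have [t t01 E] := @mvt_line R V G x u h (fun t t01 => ex_derive (is_derive := dG t t01)).
have [_ E2] := dG t t01.
have [|s s01 E3] := @mvt_line R V (fun z => 'D_u F z) (x + (t * h) *: u) v h.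
  by move=> s s01; apply: smooth_derivable (smooth_derive u sF) _; exact: HO.
by exists t, s; split => //; rewrite -E3 -E2 -E.
Qed.

(** The second difference is symmetric in [u] and [v], so [second_diff] in both orders equates the
    two mixed derivatives at two points near [x]; both are continuous at [x]. *)
Lemma schwarz O F x u v : open O -> smooth_on O F -> O x ->
  'D_u (fun z => 'D_v F z) x = 'D_v (fun z => 'D_u F z) x.
Proof.
move=> oO sF Ox; apply/eqP; rewrite -subr_eq0; apply/eqP.
apply: (@eq0_small _ _ 1) => e e0; rewrite mulr1.
have /nbhs_box[d1 d10 H1] : nbhs x O by exact: open_nbhs_nbhs.
have e2 : 0 < e / 2 by lra.
have c w w' : {for x, continuous (fun z => 'D_w (fun z => 'D_w' F z) z)}.
  by apply: smooth_continuous Ox; do 2 apply: smooth_derive.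
have [d2 d20 H2] := cts_box (c u v) e2.
have [d3 d30 H3] := cts_box (c v u) e2.
pose d := Num.min d1 (Num.min d2 d3).
have d0 : 0 < d by rewrite !lt_min d10 d20 d30.
pose S := \sum_k (`|u 0 k| + `|v 0 k|) + 1.
have S0 : 0 < S.
  by rewrite ltr_wpDl //; apply: sumr_ge0 => k _; rewrite addr_ge0.
(* Small enough for the whole parallelogram spanned by [h *: u] and [h *: v] at [x] to lie in the
   box of radius [d]. *)
pose h := d / (2 * S).
have h0 : 0 < h by rewrite divr_gt0 // mulr_gt0.
have B s t : 0 <= s <= 1 -> 0 <= t <= 1 ->
    box x d (x + (s * h) *: u + (t * h) *: v).
  move=> /andP[s0 s1] /andP[t0 t1] k; rewrite !mxE.
  rewrite (_ : _ - _ = h * (s * u 0 k + t * v 0 k)); last by ring.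
  rewrite normrM (gtr0_norm h0).
  apply: (@le_lt_trans _ _ (h * S)).
    apply: ler_wpM2l; first exact: ltW.
    apply: (@le_trans _ _ (`|u 0 k| + `|v 0 k|)).
      apply: le_trans (ler_normD _ _) _; rewrite !normrM (ger0_norm s0) (ger0_norm t0).
      by apply: lerD; apply: ler_piMl.
    rewrite /S (bigD1 k) //= -addrA lerDl addr_ge0 //.
    by apply: sumr_ge0 => j _; rewrite addr_ge0.
  rewrite /h invfM mulrA divfK ?gt_eqF //; lra.
have B' s t : 0 <= s <= 1 -> 0 <= t <= 1 ->
    box x d (x + (s * h) *: v + (t * h) *: u).
  by move=> s01 t01; rewrite addrAC; exact: B.
have HO s t : 0 <= s <= 1 -> 0 <= t <= 1 -> O (x + (s * h) *: u + (t * h) *: v).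
  by move=> s01 t01; apply: H1; apply: box_sub (B _ _ s01 t01); rewrite ge_min lexx.
have HO' s t : 0 <= s <= 1 -> 0 <= t <= 1 -> O (x + (s * h) *: v + (t * h) *: u).
  by move=> s01 t01; apply: H1; apply: box_sub (B' _ _ s01 t01); rewrite ge_min lexx.
have [s [t [s01 t01 E1]]] := second_diff sF HO.
have [s' [t' [s01' t01' E2]]] := second_diff sF HO'.
have E : 'D_v (fun z => 'D_u F z) (x + (s * h) *: u + (t * h) *: v) =
         'D_u (fun z => 'D_v F z) (x + (s' * h) *: v + (t' * h) *: u).
  have hn := lt0r_neq0 h0.
  have EL : F (x + h *: u + h *: v) - F (x + h *: u) - (F (x + h *: v) - F x) =
            F (x + h *: v + h *: u) - F (x + h *: v) - (F (x + h *: u) - F x).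
    by rewrite [x + h *: v + h *: u]addrAC; ring.
  by move: EL; rewrite E1 E2 => /(mulfI hn) /(mulfI hn).
have d2' : d <= d2 by rewrite !ge_min lexx orbT.
have d3' : d <= d3 by rewrite !ge_min lexx !orbT.
have A1 := H2 _ (box_sub d2' (B' _ _ s01' t01')).
have A2 := H3 _ (box_sub d3' (B _ _ s01 t01)).
rewrite E in A2.
exact: dist_halfr A1 A2.
Qed.

End Schwarz.

(** * Closure properties of smooth functions *)

Section SmoothAlgebra.
Context (R : realType).

(* This class is closed under directional derivatives, hence consists of smooth
   functions; in [salg_comp1], [g j] is the [j]-th derivative of [g 0]. *)
Inductive salg (V : normedModType R) (O : set V) : (V -> R) -> Prop :=
| salg_base u : smooth_on O u -> salg O u
| salg_add u v : salg O u -> salg O v -> salg O (fun x => u x + v x)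
| salg_mul u v : salg O u -> salg O v -> salg O (fun x => u x * v x)
| salg_inv u : salg O u -> (forall x, O x -> u x != 0) ->
    salg O (fun x => (u x)^-1)
| salg_comp1 (g : nat -> R -> R) k u :
    (forall j (x : R), is_derive x (1 : R) (g j) (g j.+1 x)) -> salg O u ->
    salg O (fun x => g k (u x))
| salg_comp m (O' : set 'rV[R]_m) (g : 'rV[R]_m -> R) (F : V -> 'rV[R]_m) :
    open O' -> smooth_on O' g -> (forall k, salg O (fun x => F x 0 k)) ->
    (forall x, O x -> O' (F x)) -> salg O (fun x => g (F x)).

Lemma smooth_cst (V W : normedModType R) (O : set V) (k : W) : smooth_on O (fun=> k).
Proof.
suff H vs : exists k' : W, iter_derive vs (fun _ : V => k) = fun=> k'.
  move=> vs v x _; have [k' ->] := H vs.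
  by split; [exact: derivable_cst|exact: cst_continuous].
elim: vs => [|v vs [k' /= ->]]; first by exists k.
by exists 0; apply/funext => x; rewrite derive_cst.
Qed.

Lemma salg_cst (V : normedModType R) (O : set V) k : salg O (fun=> k).
Proof. exact/salg_base/smooth_cst. Qed.

Lemma salg_sum (V : normedModType R) (O : set V) (I : Type) (r : seq I)
  (u : I -> V -> R) : (forall i, salg O (u i)) ->
  salg O (fun x => \sum_(i <- r) u i x).
Proof.
move=> H; elim: r => [|i r IH].
  rewrite (_ : (fun x => _) = (fun=> 0)); first exact: salg_cst.
  by apply/funext => x; rewrite big_nil.
rewrite (_ : (fun x => _) = (fun x => u i x + \sum_(j <- r) u j x)).
  exact: salg_add.
by apply/funext => x; rewrite big_cons.
Qed.

Lemma salg_prod (V : normedModType R) (O : set V) (I : Type) (r : seq I)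
  (u : I -> V -> R) : (forall i, salg O (u i)) ->
  salg O (fun x => \prod_(i <- r) u i x).
Proof.
move=> H; elim: r => [|i r IH].
  rewrite (_ : (fun x => _) = (fun=> 1)); first exact: salg_cst.
  by apply/funext => x; rewrite big_nil.
rewrite (_ : (fun x => _) = (fun x => u i x * \prod_(j <- r) u j x)).
  exact: salg_mul.
by apply/funext => x; rewrite big_cons.
Qed.

Lemma continuous_row (V : topologicalType) m (F : V -> 'rV[R]_m) x :
  (forall k, {for x, continuous (fun y => F y 0 k)}) -> {for x, continuous F}.
Proof.
move=> H A /= /nbhs_box[d d0 HA].
have : \forall y \near x, forall k, `|F y 0 k - F x 0 k| < d.
  apply: (@filter_forall _ _ (fun k y => `|F y 0 k - F x 0 k| < d) (nbhs x) _).
  move=> k; have /cvgrPdist_lt /(_ d d0) := H k.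
  by apply: filterS => y; rewrite distrC.
by apply: filterS => y Hy; exact: HA.
Qed.

Lemma derive_line0 (V : normedModType R) (F : V -> R) x v :
  'D_v F x = derive1 (fun h : R => F (h *: v + x)) 0.
Proof.
have E : (fun h : R => h^-1 *: ((F \o shift x) (h *: v) - F x)) =
  (fun h : R => h^-1 *: (((fun h : R => F (h *: v + x)) \o shift 0) (h *: (1 : R))
    - F ((0 : R) *: v + x))).
  by apply/funext => h /=; rewrite scale0r add0r addr0 /GRing.scale /= mulr1.
by rewrite derive1E /derive E.
Qed.

Lemma is_derive_comp1 (V : normedModType R) (g : R -> R) (g' : R) (u : V -> R) x v :
  derivable u x v -> is_derive (u x) (1 : R) g g' ->
  is_derive x v (fun x => g (u x)) ('D_v u x * g').
Proof.
move=> du [dg0 Eg].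
have dg : differentiable g (u x) by exact/derivable1_diffP.
pose L (h : R) : R := u (h *: v + x).
have dL : derivable L 0 1 by have /derivable1P := du.
have L0 : L 0 = u x by rewrite /L scale0r add0r.
have dc : derivable (g \o L) 0 1.
  apply/derivable1_diffP; apply: differentiable_comp; first exact/derivable1_diffP.
  by rewrite L0.
apply: DeriveDef; first by apply/derivable1P.
have dgL : derivable g (L 0) 1 by rewrite L0; exact: dg0.
have E1 := derive_line0 (fun x => g (u x)) x v.
have E2 : derive1 (g \o L) 0 = derive1 g (L 0) * derive1 L 0 := derive1_comp dL dgL.
have E3 : derive1 g (L 0) = g' by rewrite derive1E L0.
have E4 : derive1 L 0 = 'D_v u x by rewrite (derive_line0 u).
by rewrite mulrC -E3 -E4 -E2; exact: E1.
Qed.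

Lemma salg_closed (V : normedModType R) (O : set V) u : salg O u ->
  [/\ forall x v, O x -> derivable u x v,
      forall x, O x -> {for x, continuous u} &
      forall v, exists2 u', salg O u' & forall x, O x -> 'D_v u x = u' x].
Proof.
elim=> {u}.
- move=> u su; split.
  + by move=> x v Ox; exact: smooth_derivable su Ox.
  + by move=> x Ox; exact: smooth_continuous su Ox.
  + by move=> v; exists (fun x => 'D_v u x); [exact/salg_base/smooth_derive|].
- move=> u v su [du cu Du] sv [dv cv Dv]; split.
  + by move=> x w Ox; apply: (@derivableD _ _ _ u v); [exact: du|exact: dv].
  + by move=> x Ox; apply: (@cvgD _ _ _ _ _ u v); [exact: cu|exact: cv].
  + move=> w; have [u' su' Eu] := Du w; have [v' sv' Ev] := Dv w.
    exists (fun x => u' x + v' x); first exact: salg_add.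
    move=> x Ox; rewrite (@deriveD _ _ _ u v) ?Eu ?Ev //; [exact: du|exact: dv].
- move=> u v su [du cu Du] sv [dv cv Dv]; split.
  + by move=> x w Ox; apply: (@derivableM _ _ u v); [exact: du|exact: dv].
  + by move=> x Ox; apply: (@cvgM _ _ _ _ u v); [exact: cu|exact: cv].
  + move=> w; have [u' su' Eu] := Du w; have [v' sv' Ev] := Dv w.
    exists (fun x => u x * v' x + v x * u' x).
      by apply: salg_add; apply: salg_mul.
    move=> x Ox; rewrite (@deriveM _ _ u v) ?Eu ?Ev //; [exact: du|exact: dv].
- move=> u su [du cu Du] u0; split.
  + by move=> x w Ox; apply: (@derivableV _ _ u); [exact: u0|exact: du].
  + by move=> x Ox; apply: (@cvgV _ _ _ _ u) => //; [exact: u0|exact: cu].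
  + move=> w; have [u' su' Eu] := Du w.
    exists (fun x => - 1 * ((u x)^-1 * (u x)^-1) * u' x).
      apply: salg_mul => //; apply: salg_mul; first exact: salg_cst.
      by apply: salg_mul; apply: salg_inv.
    move=> x Ox; rewrite (@deriveV _ _ u) ?Eu ?u0 //; last exact: du.
    by rewrite /GRing.scale /= expr2 invfM; ring.
- move=> g k u Hg su [du cu Du].
  have ch x v : O x -> is_derive x v (fun x => g k (u x)) ('D_v u x * g k.+1 (u x)).
    by move=> Ox; exact: (is_derive_comp1 (du x v Ox) (Hg k (u x))).
  split.
  + by move=> x v Ox; have [] := ch x v Ox.
  + move=> x Ox; apply: (@continuous_comp _ _ _ u (g k)); first exact: cu.
    apply: differentiable_continuous; apply/derivable1_diffP.
    by have [] := Hg k (u x).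
  + move=> v; have [u' su' Eu] := Du v; exists (fun x => u' x * g k.+1 (u x)).
      by apply: salg_mul => //; exact: salg_comp1.
    by move=> x Ox; rewrite -Eu //; have [] := ch x v Ox.
- move=> m O' g F oO' sg sF IH FO.
  have dF x v : O x -> derivable F x v.
    by move=> Ox; apply/derivable_mxP => i k; rewrite ord1; have [] := IH k => /(_ x v Ox).
  have ch x v : O x -> is_derive x v (g \o F) (\sum_k 'D_v F x 0 k * pd k g (F x)).
    by move=> Ox; apply: derive_comp_strict oO' sg _ _; [exact: FO|exact: dF].
  split.
  + by move=> x v Ox; have [] := ch x v Ox.
  + move=> x Ox; apply: (@continuous_comp _ _ _ F g).
      by apply: continuous_row => k; have [_] := IH k => /(_ x Ox).
    by apply: smooth_continuous sg _; exact: FO.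
  + move=> v.
    have /choice[u' Hu'] : forall k, exists u' : V -> R, salg O u' /\
        forall x, O x -> 'D_v (fun x => F x 0 k) x = u' x.
      by move=> k; have [_ _ /(_ v)[u' ? ?]] := IH k; exists u'.
    exists (fun x => \sum_k u' k x * pd k g (F x)).
      apply: salg_sum => k; apply: salg_mul; first exact: (Hu' k).1.
      by apply: (@salg_comp _ _ _ O') => //; exact: smooth_derive.
    move=> x Ox; have [_ E] := ch x v Ox; rewrite E.
    apply: eq_bigr => k _; rewrite -(Hu' k).2 //.
    by rewrite (derive_mx (dF x v Ox)) mxE.
Qed.

Lemma salg_smooth (V : normedModType R) (O : set V) u : open O -> salg O u ->
  smooth_on O u.
Proof.
move=> oO; apply: smooth_coind => //.
- by move=> F x v /salg_closed[H1 H2 _] Ox; split; [exact: H1|exact: H2].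
- by move=> F v /salg_closed[_ _ /(_ v)].
Qed.

End SmoothAlgebra.

(** * Linear algebra *)

Section LinearAlgebra.
Context (R : realType) (n : nat).
Local Notation V := 'rV[R]_n.
Local Notation e_ k := (delta_mx 0 k : V).

(** Images of the basis vectors assemble into a matrix [B] with [P u (u *m B)]; its kernel is
    trivial by the last hypothesis, so it is invertible. A relation is used instead of a map because
    several label variations share one gradient and the solutions belonging to them are only known
    to exist. *)
Lemma linear_rel_surj (P : V -> V -> Prop) : P 0 0 ->
  (forall (r : R) u w u' w', P u w -> P u' w' -> P (r *: u + u') (r *: w + w')) ->
  (forall u, exists w, P u w) -> (forall u, P u 0 -> u = 0) ->
  forall w, exists u, P u w.
Proof.
move=> P0 Pl Pt Pi w.
have /choice[g Hg] : forall k, exists w, P (e_ k) w by move=> k; exact: Pt.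
pose B : 'M[R]_n := \matrix_k g k.
have PB u : P u (u *m B).
  rewrite {1}(row_sum u) mulmx_sum_row.
  elim/big_rec2: _ => [//|k a b _ IH]; rewrite /B rowK; exact: Pl.
have uB : B \in unitmx.
  rewrite -row_free_unit -kermx_eq0; apply/rowV0P => u /sub_kermxP E.
  by apply: Pi; rewrite -E.
by exists (w *m invmx B); have := PB (w *m invmx B); rewrite mulmxKV.
Qed.

(** A subspace given by a predicate is first spanned by rows: independent ones are added as long as
    some vector of [T] is missing. If the resulting matrix is not of full rank, a nonzero vector in
    the kernel of its transpose is [lam]. *)
Lemma annihilator (T : V -> Prop) : T 0 ->
  (forall (r : R) u u', T u -> T u' -> T (r *: u + u')) ->
  (forall u, T u) \/ exists2 lam : V, lam != 0 &
    forall u, T u -> \sum_k lam 0 k * u 0 k = 0.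
Proof.
move=> T0 Tl.
have Trow d (A : 'M[R]_(d, n)) u : (forall k, T (row k A)) -> (u <= A)%MS -> T u.
  move=> TA /submxP[D ->]; rewrite mulmx_sum_row.
  by elim/big_ind: _ => // [a b Ta Tb|k _]; [have := Tl 1 a b Ta Tb;
    rewrite scale1r|have := Tl (D 0 k) _ _ (TA k) T0; rewrite addr0].
(* The first alternative is impossible for [d = n.+1], so the second one holds. *)
have step d : (exists2 A : 'M[R]_(d, n), row_free A & forall k, T (row k A)) \/
    exists d' (A : 'M[R]_(d', n)), (forall k, T (row k A)) /\ forall u, T u -> (u <= A)%MS.
  elim: d => [|d [[A fA TA]|]]; [|have [H|/existsNP[u /not_implyP[Tu nu]]] := pselect
    (forall u, T u -> (u <= A)%MS)|by right].
  - left; exists (const_mx 0 : 'M[R]_(0%N, n)); last by case.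
    by rewrite /row_free -leqn0 rank_leq_row.
  - by right; exists d, A.
  - have TB (k : 'I_(1 + d)) : T (row k (col_mx u A)).
      case: (fintype.splitP k) => k' kE.
        rewrite (_ : k = lshift d k'); last exact: val_inj.
        by rewrite rowKu ord1 (_ : row 0 u = u) //; apply/rowP => q; rewrite mxE.
      by rewrite (_ : k = rshift 1 k') ?rowKd //; exact: val_inj.
    left; exists (col_mx u A : 'M[R]_(1 + d, n)).
      rewrite /row_free; apply/eqP/anti_leq; rewrite rank_leq_row /=.
      have E : \rank (u + A)%MS = \rank (col_mx u A) by rewrite addsmxE.
      rewrite -E; have := mxrank_sum_cap u A.
      have u0 : \rank (u :&: A)%MS = 0%N.
        apply/eqP; rewrite mxrank_eq0; apply/rowV0P => x.
        rewrite sub_capmx => /andP[/sub_rVP[r ->] rA].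
        have [->|r0] := eqVneq r 0; first by rewrite scale0r.
        by case: nu; move: rA; rewrite (eqmx_scale _ r0).
      have u1 : \rank u = 1%N.
        rewrite rank_rV; case: eqVneq => // u00; case: nu.
        by rewrite u00 sub0mx.
      by rewrite u0 addn0 u1 (eqP fA) => ->.
    exact: TB.
have [[A fA _]|[d [A [TA HA]]]] := step n.+1.
  by have := rank_leq_col A; rewrite (eqP fA) ltnn.
have [fA|nfA] := boolP (row_full A).
  by left=> u; apply: Trow TA _; exact: submx_full.
right; have : kermx A^T != 0.
  by rewrite kermx_eq0 /row_free mxrank_tr.
move=> /rowV0Pn[lam /sub_kermxP E lam0]; exists lam => // u /HA /submxP[D ->].
have : lam *m (D *m A)^T = 0 by rewrite trmx_mul mulmxA E mul0mx.
move: (D *m A) => u' E'; have -> : \sum_k lam 0 k * u' 0 k = (lam *m u'^T) 0 0.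
  by rewrite mxE; apply: eq_bigr => k _; rewrite mxE.
by rewrite E' mxE.
Qed.

End LinearAlgebra.

(** * Charts, metric and Levi-Civita connection *)

Section Geometry.
Context (R : realType) (n : nat) (M : closed_riemannian R n).
Local Notation V := 'rV[R]_n.
Local Notation e_ k := (delta_mx 0 k : V).
Implicit Types (i j : mindex M) (x : M) (y u v w s : V).

Definition cod i : set V := mcoord i @` mdom i.
Definition overlap i j : set V := mcoord i @` (mdom i `&` mdom j).
Definition trans i j : V -> V := mcoord j \o @mparam R n M i.
Definition jac i j y u : V := 'D_u (trans i j) y.

Lemma cod_open i : open (cod i). Proof. exact: mcod_open. Qed.
Arguments cod_open : clear implicits.

Lemma near_open (T : topologicalType) (O : set T) (y : T) : open O -> O y ->
  \forall z \near y, O z.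
Proof. by move=> oO Oy; exact: open_nbhs_nbhs. Qed.

Lemma mparamK i y : cod i y -> mcoord i (mparam i y) = y.
Proof. by move=> [x xi <-]; rewrite mcoordK. Qed.

Lemma mparam_dom i y : cod i y -> mdom i (mparam i y).
Proof. by move=> [x xi <-]; rewrite mcoordK. Qed.

Lemma mcoord_cod i x : mdom i x -> cod i (mcoord i x).
Proof. by move=> xi; exists x. Qed.

Lemma overlapP i j y : overlap i j y <-> cod i y /\ mdom j (mparam i y).
Proof.
split=> [[x [xi xj] <-]|[yi yj]]; first by rewrite mcoordK //; split => //; exists x.
by exists (mparam i y); [split=> //; exact: mparam_dom|exact: mparamK].
Qed.

Lemma mparam_near i y : cod i y -> mparam i z @[z --> y] --> mparam i y.
Proof.
move=> yi; have := @mparam_cts R n M i.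
by rewrite continuous_open_subspace; [apply; rewrite inE|exact: mcod_open].
Qed.

Lemma mcoord_near i x : mdom i x -> mcoord i z @[z --> x] --> mcoord i x.
Proof.
move=> xi; have := @mcoord_cts R n M i.
by rewrite continuous_open_subspace; [apply; rewrite inE|exact: mdom_open].
Qed.

Lemma overlap_open i j : open (overlap i j).
Proof.
rewrite openE => y /overlapP[yi yj]; rewrite /interior.
have h1 : \forall z \near y, cod i z by exact: near_open (cod_open i) yi.
have h2 : \forall z \near y, mdom j (mparam i z).
  apply: (mparam_near yi); apply: open_nbhs_nbhs; split => //; exact: mdom_open.
by apply: filterS2 h1 h2 => z z1 z2; apply/overlapP.
Qed.

Arguments overlap_open : clear implicits.

Lemma overlap_cod i j : overlap i j `<=` cod i.
Proof. by move=> y /overlapP[]. Qed.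

Lemma overlap_trans i j y : overlap i j y -> overlap j i (trans i j y).
Proof.
move=> /overlapP[yi yj]; apply/overlapP; split; first exact: mcoord_cod.
by rewrite /trans /= mcoordK //; exact: mparam_dom.
Qed.

Lemma overlap_coord i j x : mdom i x -> mdom j x -> overlap i j (mcoord i x).
Proof. by move=> xi xj; exists x. Qed.

Lemma trans_coord i j x : mdom i x -> trans i j (mcoord i x) = mcoord j x.
Proof. by move=> xi; rewrite /trans /= mcoordK. Qed.

Lemma transK i j y : overlap i j y -> trans j i (trans i j y) = y.
Proof. by move=> /overlapP[yi yj]; rewrite /trans /= mcoordK // mparamK. Qed.

Lemma trans_smooth i j : smooth_on (overlap i j) (trans i j).
Proof. exact: mtrans_smooth. Qed.

Lemma transk_smooth i j (k : 'I_n) : smooth_on (overlap i j) (fun y => trans i j y 0 k).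
Proof. by apply: smooth_entry; [exact: overlap_open|exact: trans_smooth]. Qed.
Arguments transk_smooth : clear implicits.

Lemma trans_derivable i j y u : overlap i j y -> derivable (trans i j) y u.
Proof. exact/smooth_derivable/trans_smooth. Qed.
Arguments trans_derivable : clear implicits.

Lemma jacE i j y u (k : 'I_n) : overlap i j y ->
  jac i j y u 0 k = 'D_u (fun z => trans i j z 0 k) y.
Proof. by move=> yo; rewrite /jac (derive_mx (trans_derivable i j y u yo)) mxE. Qed.

Lemma jac_sum i j y u (k : 'I_n) : overlap i j y ->
  jac i j y u 0 k = \sum_l u 0 l * pd l (fun z => trans i j z 0 k) y.
Proof.
by move=> yo; rewrite jacE // (derive_dir _ (overlap_open i j) (transk_smooth i j k)).
Qed.

Lemma jac_lin i j y (a : R) u v : overlap i j y ->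
  jac i j y (a *: u + v) = a *: jac i j y u + jac i j y v.
Proof.
move=> yo; apply/rowP => k; rewrite !mxE !jac_sum // mulr_sumr -big_split /=.
by apply: eq_bigr => l _; rewrite !mxE; ring.
Qed.

Lemma jac0 i j y : jac i j y 0 = 0.
Proof. exact: derive0. Qed.

Lemma derive_trans i j y (F : V -> R) (O : set V) u : open O -> smooth_on O F ->
  overlap i j y -> O (trans i j y) ->
  'D_u (F \o trans i j) y = 'D_(jac i j y u) F (trans i j y).
Proof.
by move=> oO sF yo Oy; rewrite (derive_comp oO sF Oy (trans_derivable i j y u yo)).
Qed.

(** Chain rule for [trans j k \o trans i j], which agrees with [trans i k] near [y], as long as the
    point stays in chart [j]. *)
Lemma jac_cocycle i j (k : mindex M) y u : overlap i j y -> overlap i k y ->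
  jac j k (trans i j y) (jac i j y u) = jac i k y u.
Proof.
move=> yj yk; apply/rowP => l.
have o : overlap j k (trans i j y).
  move: yj yk => /overlapP[yi yj] /overlapP[_ yk].
  by apply/overlapP; rewrite /trans /= mcoordK //; split => //; exact: mcoord_cod.
rewrite jacE // -(derive_trans _ (overlap_open j k) (transk_smooth j k l) yj o).
rewrite jacE //; apply: near_eq_derive.
have := near_open (overlap_open i j) yj.
apply: filterS => z /overlapP[zi zj] /=.
by rewrite /trans /= mcoordK.
Qed.

Lemma jac_id i y u : cod i y -> jac i i y u = u.
Proof.
move=> yi; rewrite /jac -[RHS](derive_id y u); apply: near_eq_derive.
have := near_open (cod_open i) yi.
by apply: filterS => z zi; rewrite /trans /= mparamK.
Qed.

Lemma jacK i j y u : overlap i j y -> jac j i (trans i j y) (jac i j y u) = u.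
Proof.
move=> yo; have yi := overlap_cod yo.
by rewrite jac_cocycle ?jac_id //; apply/overlapP; split=> //; exact: mparam_dom.
Qed.

Lemma jacVK i j y u : overlap i j y -> jac i j y (jac j i (trans i j y) u) = u.
Proof.
move=> yo; have := @jacK j i (trans i j y) u (overlap_trans yo).
by rewrite transK.
Qed.

(* The tangent vector at [x] with components [u] in the chart [i]. *)
Definition push i x u : mindex M -> V := fun j => jac i j (mcoord i x) u.

Lemma push_tangent i x u : mdom i x -> is_tangent x (push i x u).
Proof.
move=> xi j k xj xk; rewrite /push -(trans_coord j xi).
by rewrite -(@jac_cocycle i j k) //; exact: overlap_coord.
Qed.

Lemma push_id i x u : mdom i x -> push i x u i = u.
Proof. by move=> xi; rewrite /push jac_id //; exact: mcoord_cod. Qed.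

Lemma tangent_push i j x (t : mindex M -> V) : is_tangent x t -> mdom i x ->
  mdom j x -> t j = jac i j (mcoord i x) (t i).
Proof. by move=> tx xi xj; exact: (tx i j xi xj). Qed.

Lemma tangent_eq i x (t t' : mindex M -> V) : is_tangent x t -> is_tangent x t' ->
  mdom i x -> t i = t' i -> eq_tangent x t t'.
Proof.
move=> tx tx' xi E j xj.
by rewrite (tangent_push tx xi xj) (tangent_push tx' xi xj) E.
Qed.

Lemma tangent_lin x (a : R) (t t' : mindex M -> V) : is_tangent x t ->
  is_tangent x t' -> is_tangent x (fun i => a *: t i + t' i).
Proof.
move=> tx tx' i j xi xj; rewrite (tangent_push tx xi xj) (tangent_push tx' xi xj).
by rewrite -jac_lin //; exact: overlap_coord.
Qed.

Lemma tangent0 x : is_tangent x (fun=> 0 : V).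
Proof. by move=> i j xi xj; rewrite derive0. Qed.

Local Opaque derive.

Definition met i y u w : R := bilin (mmet i y) u w.

Lemma metE i y u w : met i y u w = \sum_k \sum_l u 0 k * w 0 l * mmet i y k l.
Proof.
rewrite /met /bilin !mxE exchange_big /=; apply: eq_bigr => l _.
by rewrite !mxE mulr_suml; apply: eq_bigr => k _; ring.
Qed.

Lemma met_linl i y (a : R) u u' w :
  met i y (a *: u + u') w = a * met i y u w + met i y u' w.
Proof. by rewrite /met /bilin !mulmxDl -!scalemxAl !mxE. Qed.

Lemma met_sym i y u w : cod i y -> met i y u w = met i y w u.
Proof.
move=> yi; rewrite !metE exchange_big /=; apply: eq_bigr => k _.
apply: eq_bigr => l _; rewrite -[in RHS](mmet_sym yi) mxE; ring.
Qed.

Lemma met_linr i y (a : R) u w w' : cod i y ->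
  met i y u (a *: w + w') = a * met i y u w + met i y u w'.
Proof. by move=> yi; rewrite ![met i y u _]met_sym // met_linl. Qed.

Lemma met_pos i y u : cod i y -> u != 0 -> 0 < met i y u u.
Proof. by move=> yi u0; exact: mmet_pos. Qed.

Lemma met_ge0 i y u : cod i y -> 0 <= met i y u u.
Proof.
move=> yi; have [->|u0] := eqVneq u 0; last exact/ltW/met_pos.
by rewrite /met /bilin !mul0mx mxE.
Qed.

Lemma met_unit i y : cod i y -> mmet i y \in unitmx.
Proof.
move=> yi; rewrite -row_free_unit -kermx_eq0; apply/eqP/row_matrixP => k.
set u := row k _; rewrite row0; apply/eqP; apply: contraT => /(met_pos yi).
have -> : met i y u u = 0; last by rewrite ltxx.
have uG : u *m mmet i y = 0 by rewrite /u -row_mul mulmx_ker row0.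
by rewrite /met /bilin uG mul0mx mxE.
Qed.

Lemma met_nondeg i y u u' : cod i y ->
  (forall w, met i y u w = met i y u' w) -> u = u'.
Proof.
move=> yi H; apply/eqP; rewrite -subr_eq0; apply: contraT => /(met_pos yi).
rewrite (_ : u - u' = (-1) *: u' + u); last by rewrite scaleN1r addrC.
by rewrite met_linl H mulN1r addNr ltxx.
Qed.

Lemma met_jac i j y u w : overlap i j y ->
  met j (trans i j y) (jac i j y u) (jac i j y w) = met i y u w.
Proof.
move=> /overlapP[yi yj]; have := @mmet_trans R n M i j (mparam i y) u w
  (mparam_dom yi) yj.
by rewrite mparamK.
Qed.

Lemma mmet_entry_smooth i a b : smooth_on (cod i) (fun y => mmet i y a b).
Proof. by apply: smooth_entry; [exact: cod_open|exact: mmet_smooth]. Qed.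
Arguments mmet_entry_smooth : clear implicits.

Lemma met_smooth i u w : smooth_on (cod i) (fun y => met i y u w).
Proof.
apply: (smooth_ext (F := fun y => \sum_k \sum_l u 0 k * w 0 l * mmet i y k l)).
- exact: cod_open.
- by move=> y _; rewrite metE.
apply: salg_smooth; first exact: cod_open.
do 2 apply: salg_sum => ?; apply: salg_mul; first exact: salg_cst.
exact/salg_base/mmet_entry_smooth.
Qed.

Arguments met_smooth : clear implicits.

Definition dmet i y a u w : R := 'D_a (fun z => met i z u w) y.

Lemma dmetE i y a u w : cod i y ->
  dmet i y a u w = \sum_k \sum_l u 0 k * w 0 l * 'D_a (fun z => mmet i z k l) y.
Proof.
move=> yi; rewrite /dmet (_ : (fun z => _) =
   \sum_k \sum_l (fun z => u 0 k * w 0 l * mmet i z k l)); last first.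
  apply/funext => z; rewrite metE fct_sumE; apply: eq_bigr => k _.
  by rewrite fct_sumE.
have d k l : derivable (fun z => u 0 k * w 0 l * mmet i z k l) y a.
  by apply: derivableM => //; exact: smooth_derivable (mmet_entry_smooth i k l) yi.
rewrite derive_sum; last first.
  by move=> k; apply: derivable_sum => l; exact: d.
apply: eq_bigr => k _; rewrite derive_sum; last by move=> l; exact: d.
apply: eq_bigr => l _; have dm : derivable (fun z => mmet i z k l) y a.
  exact: smooth_derivable (mmet_entry_smooth i k l) yi.
exact: (deriveMl (f := fun z => mmet i z k l) (u 0 k * w 0 l) dm).
Qed.

Lemma dmet_sym i y a u w : cod i y -> dmet i y a u w = dmet i y a w u.
Proof.
move=> yi; apply: near_eq_derive.
have := near_open (cod_open i) yi.
by apply: filterS => z zi; rewrite met_sym.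
Qed.

Lemma dmet_lin2 i y a (c : R) u u' w : cod i y ->
  dmet i y a (c *: u + u') w = c * dmet i y a u w + dmet i y a u' w.
Proof.
move=> yi; rewrite !dmetE // mulr_sumr -big_split /=; apply: eq_bigr => k _.
by rewrite mulr_sumr -big_split /=; apply: eq_bigr => l _; rewrite !mxE; ring.
Qed.

Lemma dmet_lin3 i y a (c : R) u w w' : cod i y ->
  dmet i y a u (c *: w + w') = c * dmet i y a u w + dmet i y a u w'.
Proof. by move=> yi; rewrite ![dmet i y a u _]dmet_sym // dmet_lin2. Qed.

Lemma dmet_lin1 i y (c : R) a a' u w : cod i y ->
  dmet i y (c *: a + a') u w = c * dmet i y a u w + dmet i y a' u w.
Proof.
move=> yi; rewrite /dmet !(derive_dir _ (cod_open i) (met_smooth i u w) yi).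
by rewrite mulr_sumr -big_split /=; apply: eq_bigr => k _; rewrite !mxE; ring.
Qed.

Lemma lin_sum (F : V -> R) w : (forall (c : R) a b, F (c *: a + b) = c * F a + F b) ->
  F w = \sum_l w 0 l * F (e_ l).
Proof.
move=> HF; have F0 : F 0 = 0.
  have := HF (-1) 0 0; rewrite scaler0 add0r; lra.
rewrite {1}(row_sum w); elim/big_rec2: _ => [//|l a b _ <-].
by rewrite HF.
Qed.

Lemma met_invmx i y (r : V) w : cod i y ->
  met i y (r *m invmx (mmet i y)) w = \sum_l r 0 l * w 0 l.
Proof.
move=> yi; rewrite /met /bilin mulmxKV ?met_unit // !mxE.
by apply: eq_bigr => l _; rewrite !mxE.
Qed.

(** Pairing with the metric removes the inverse Gram matrix, and Koszul's expression is linear in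
    [w], so that its values on the basis vectors determine it. *)
Lemma met_christoffel i y u v w : cod i y ->
  met i y (christoffel i y u v) w =
  2^-1 * (dmet i y u v w + dmet i y v u w - dmet i y w u v).
Proof.
move=> yi; rewrite /christoffel met_invmx //.
rewrite (@lin_sum (fun w => 2^-1 * (dmet i y u v w + dmet i y v u w - dmet i y w u v))).
  by apply: eq_bigr => l _; rewrite !mxE mulrC.
move=> c a b; rewrite !dmet_lin3 // dmet_lin1 //.
move: (dmet i y u v a) (dmet i y u v b) (dmet i y v u a) (dmet i y v u b)
  (dmet i y a u v) (dmet i y b u v) => *; ring.
Qed.

Lemma christoffel_linr i y (c : R) u v v' : cod i y ->
  christoffel i y u (c *: v + v') = c *: christoffel i y u v + christoffel i y u v'.
Proof.
move=> yi; apply: (met_nondeg yi) => w.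
rewrite met_linl !met_christoffel // dmet_lin2 // dmet_lin1 // dmet_lin3 //.
move: (dmet i y u v w) (dmet i y u v' w) (dmet i y v u w) (dmet i y v' u w)
  (dmet i y w u v) (dmet i y w u v') => *; ring.
Qed.

Lemma christoffel_linl i y (c : R) u u' v : cod i y ->
  christoffel i y (c *: u + u') v = c *: christoffel i y u v + christoffel i y u' v.
Proof.
move=> yi; apply: (met_nondeg yi) => w.
rewrite met_linl !met_christoffel // dmet_lin1 // !dmet_lin2 //.
move: (dmet i y u v w) (dmet i y u' v w) (dmet i y v u w) (dmet i y v u' w)
  (dmet i y w u v) (dmet i y w u' v) => *; ring.
Qed.

Local Opaque met dmet jac.

(** The second derivative of the change of charts: the inhomogeneous term in all the transformation
    laws below. *)
Definition hess i j y u w : V := \row_k 'D_u (fun z => 'D_w (fun z => trans i j z 0 k) z) y.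

Lemma hessE i j y u w (k : 'I_n) :
  hess i j y u w 0 k = 'D_u (fun z => 'D_w (fun z => trans i j z 0 k) z) y.
Proof. by rewrite mxE. Qed.

Arguments hessE : clear implicits.
Local Opaque hess.

Lemma hess_sym i j y u w : overlap i j y -> hess i j y u w = hess i j y w u.
Proof.
move=> yo; apply/rowP => k; have E := @schwarz _ _ _ _ y u w (overlap_open i j)
  (transk_smooth i j k) yo.
exact: (etrans (hessE i j y u w k) (etrans E (esym (hessE i j y w u k)))).
Qed.

(** Differentiate [met_jac] along [a]: the metric contributes its derivative by the chain rule, and
    each of the two Jacobians contributes a second derivative. *)
Lemma dmet_jac i j y a u w : overlap i j y ->
  dmet i y a u w =
    dmet j (trans i j y) (jac i j y a) (jac i j y u) (jac i j y w)
    + met j (trans i j y) (hess i j y a u) (jac i j y w)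
    + met j (trans i j y) (jac i j y u) (hess i j y a w).
Proof.
move=> yo; have zo := overlap_cod (overlap_trans yo).
pose T u k := (fun z => 'D_u (fun z => trans i j z 0 k) z).
pose Gkl k l := (fun z => mmet j z k l) \o trans i j.
have -> : dmet i y a u w = 'D_a (\sum_k \sum_l (T u k * T w l * Gkl k l)) y.
  apply: near_eq_derive.
  have := near_open (overlap_open i j) yo.
  apply: filterS => z zo'; rewrite -(met_jac u w zo') metE fct_sumE.
  apply: eq_bigr => k _; rewrite fct_sumE; apply: eq_bigr => l _.
  by rewrite !jacE.
have dT v k : derivable (T v k) y a.
  exact: smooth_derivable (smooth_derive v (transk_smooth i j k)) yo.
have dG k l : derivable (Gkl k l) y a.
  have [] // := derive_comp_strict (cod_open j) (mmet_entry_smooth j k l) zo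
    (trans_derivable i j y a yo).
have dTT k l : derivable (T u k * T w l) y a by apply: derivableM.
have d k l : derivable (T u k * T w l * Gkl k l) y a by apply: derivableM.
rewrite derive_sum; last by move=> k; apply: derivable_sum => l; exact: d.
rewrite dmetE // !metE -!big_split /=; apply: eq_bigr => k _.
rewrite derive_sum; last by move=> l; exact: d.
rewrite -!big_split /=; apply: eq_bigr => l _.
have E1 : 'D_a (T u k * T w l * Gkl k l) y =
    T u k y * T w l y * 'D_a (Gkl k l) y + Gkl k l y * 'D_a (T u k * T w l) y
  := deriveM (dTT k l) (dG k l).
have E2 : 'D_a (T u k * T w l) y =
    T u k y * 'D_a (T w l) y + T w l y * 'D_a (T u k) y
  := deriveM (dT u k) (dT w l).
have HD v m : 'D_a (T v m) y = hess i j y a v 0 m := esym (hessE i j y a v m).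
have TE v m : T v m y = jac i j y v 0 m := esym (jacE v m yo).
have GE : 'D_a (Gkl k l) y = 'D_(jac i j y a) (fun z => mmet j z k l) (trans i j y)
  := derive_trans a (cod_open j) (mmet_entry_smooth j k l) yo zo.
rewrite E1 E2 GE !HD !TE /Gkl /=.
have aux (Ju Jw DG Gz Hw Hu : R) : Ju * Jw * DG + Gz * (Ju * Hw + Jw * Hu) =
    Ju * Jw * DG + Hu * Jw * Gz + Ju * Hw * Gz by ring.
exact: aux.
Qed.

(** The transformation law of a connection. Koszul's formula reduces it to [dmet_jac] for three
    arrangements of the arguments; by the symmetry of [hess], four of the six second-derivative
    terms cancel and the other two are equal, which absorbs the factor [2^-1]. *)
Lemma christoffel_jac i j y u v : overlap i j y ->
  christoffel j (trans i j y) (jac i j y u) (jac i j y v) =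
  jac i j y (christoffel i y u v) - hess i j y u v.
Proof.
move=> yo; have zo := overlap_cod (overlap_trans yo); have yi := overlap_cod yo.
apply: (met_nondeg zo) => w; rewrite -(jacVK w yo); set w' := jac j i _ w.
rewrite [RHS](_ : _ = (-1) * met j (trans i j y) (hess i j y u v) (jac i j y w') +
   met j (trans i j y) (jac i j y (christoffel i y u v)) (jac i j y w')); last first.
  by rewrite -met_linl scaleN1r addrC.
rewrite met_jac //; clearbody w'.
pose J := jac i j y; pose m := met j (trans i j y).
have aux (mj mi d1 d2 d3 e1 e2 e3 p p2 q q2 r r2 : R) :
    mi = 2^-1 * (d1 + d2 - d3) -> mj = 2^-1 * (e1 + e2 - e3) ->
    d1 = e1 + p + q -> d2 = e2 + p2 + r -> d3 = e3 + q2 + r2 ->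
    p2 = p -> q2 = q -> r2 = r -> mj = - 1 * p + mi by lra.
apply: (aux _ _ _ _ _ _ _ _ _ _ _ _ _ _ (met_christoffel u v w' yi)
  (met_christoffel (J u) (J v) (J w') zo) (dmet_jac u v w' yo)
  (dmet_jac v u w' yo) (dmet_jac w' u v yo)).
- exact: (f_equal (fun h => met j (trans i j y) h (jac i j y w')) (hess_sym v u yo)).
- exact: (etrans (f_equal (fun h => met j (trans i j y) h (jac i j y v)) (hess_sym w' u yo))
    (met_sym (hess i j y u w') (jac i j y v) zo)).
- exact: (f_equal (fun h => met j (trans i j y) (jac i j y u) h) (hess_sym w' v yo)).
Qed.

End Geometry.

Arguments cod_open {R n M} i.
Arguments overlap_open {R n M} i j.
Arguments transk_smooth {R n M} i j k.
Arguments trans_derivable {R n M} i j y u.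
Arguments mmet_entry_smooth {R n M} i a b.
Arguments met_smooth {R n M} i u w.
Arguments hessE {R n M} i j y u w k.

Local Opaque derive met jac hess christoffel.

(** * Gradients and Hessians of functions *)

Section Gradient.
Context (R : realType) (n : nat) (M : closed_riemannian R n).
Local Notation V := 'rV[R]_n.
Local Notation e_ k := (delta_mx 0 k : V).
Implicit Types (i j : mindex M) (x : M) (y u v w s : V) (f g : M -> R).

Lemma salg_det (W : normedModType R) (O : set W) m (A : W -> 'M[R]_m) :
  (forall a b, salg O (fun z => A z a b)) -> salg O (fun z => \det (A z)).
Proof.
move=> H; rewrite /determinant; apply: salg_sum => p.
by apply: salg_mul; [exact: salg_cst|apply: salg_prod].
Qed.

(** Cramer's formula: a cofactor divided by a determinant that does not vanish, since the metric is
    positive definite. *)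
Lemma invmx_smooth i a b : smooth_on (cod i) (fun y => invmx (mmet i y) a b).
Proof.
apply: (smooth_ext (F := fun y => (\det (mmet i y))^-1 * \adj (mmet i y) a b)).
- exact: cod_open.
- by move=> y yi; rewrite /invmx met_unit // !mxE.
have sm c d : salg (cod i) (fun y => mmet i y c d).
  exact/salg_base/mmet_entry_smooth.
apply: salg_smooth; first exact: cod_open.
apply: salg_mul.
  apply: salg_inv; first exact: salg_det.
  by move=> y /met_unit; rewrite unitmxE unitfE.
rewrite (_ : (fun y => _) = fun y => (-1) ^+ (b + a) * \det (row' b (col' a (mmet i y)))).
  apply: salg_mul; first exact: salg_cst.
  apply: salg_det => c d.
  rewrite (_ : (fun y => _) = fun y => mmet i y (lift b c) (lift a d)) //.
  by apply/funext => y; rewrite !mxE.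
by apply/funext => y; rewrite mxE.
Qed.

Lemma gradE f i y (k : 'I_n) : grad f i y 0 k =
  \sum_l pd l (f \o mparam i) y * invmx (mmet i y) l k.
Proof. by rewrite mxE; apply: eq_bigr => l _; rewrite mxE. Qed.

Lemma grad_smooth f i (k : 'I_n) : smooth_fun f ->
  smooth_on (cod i) (fun y => grad f i y 0 k).
Proof.
move=> sf; apply: (smooth_ext (F := fun y => \sum_l pd l (f \o mparam i) y * invmx (mmet i
  y) l k)).
- exact: cod_open.
- by move=> y _; rewrite gradE.
apply: salg_smooth; first exact: cod_open.
apply: salg_sum => l; apply: salg_mul; apply: salg_base; last exact: invmx_smooth.
exact: smooth_derive (sf i).
Qed.

Lemma gradM f i y : grad f i y = (\row_l pd l (f \o mparam i) y) *m invmx (mmet i y).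
Proof. by []. Qed.

Arguments gradE : clear implicits.
Local Opaque grad.

Lemma met_grad f i y w : smooth_fun f -> cod i y ->
  met i y (grad f i y) w = 'D_w (f \o mparam i) y.
Proof.
move=> sf yi; rewrite gradM met_invmx // (derive_dir _ (cod_open i) (sf i) yi).
by apply: eq_bigr => l _; rewrite mxE mulrC.
Qed.

Lemma near_fun_trans f i j y : overlap i j y ->
  \forall z \near y, (f \o mparam i) z = ((f \o mparam j) \o trans i j) z.
Proof.
move=> yo; have := near_open (overlap_open i j) yo.
by apply: filterS => z /overlapP[zi zj] /=; rewrite /trans /= mcoordK.
Qed.

Lemma derive_fun_jac f i j y w : smooth_fun f -> overlap i j y ->
  'D_w (f \o mparam i) y = 'D_(jac i j y w) (f \o mparam j) (trans i j y).
Proof.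
move=> sf yo.
have zo := overlap_cod (overlap_trans yo).
by rewrite -(derive_trans _ (cod_open j) (sf j) yo zo);
  exact: near_eq_derive (near_fun_trans f yo).
Qed.

Lemma grad_jac f i j y : smooth_fun f -> overlap i j y ->
  grad f j (trans i j y) = jac i j y (grad f i y).
Proof.
move=> sf yo; have zo := overlap_cod (overlap_trans yo).
apply: (met_nondeg zo) => w.
suff H w' : met j (trans i j y) (grad f j (trans i j y)) (jac i j y w') =
    met j (trans i j y) (jac i j y (grad f i y)) (jac i j y w').
  by have := H (jac j i (trans i j y) w); rewrite jacVK.
apply: etrans (met_grad (jac i j y w') sf zo) _.
apply: etrans (esym (derive_fun_jac w' sf yo)) _.
apply: etrans (esym (met_grad w' sf (overlap_cod yo))) _.
exact: esym (met_jac (grad f i y) w' yo).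
Qed.

Lemma grad_tangent f x : smooth_fun f ->
  is_tangent x (fun i => grad f i (mcoord i x)).
Proof.
move=> sf i j xi xj; rewrite -(trans_coord j xi) grad_jac //.
exact: overlap_coord.
Qed.

Lemma smooth_lin f g (a : R) : smooth_fun f -> smooth_fun g ->
  smooth_fun (fun z => a * f z + g z).
Proof.
move=> sf sg i; apply: salg_smooth; first exact: cod_open.
rewrite (_ : _ \o _ = fun y => a * (f \o mparam i) y + (g \o mparam i) y) //.
apply: salg_add; last exact: salg_base (sg i).
by apply: salg_mul; [exact: salg_cst|exact: salg_base (sf i)].
Qed.

Lemma smooth_fcst (a : R) : smooth_fun (fun _ : M => a).
Proof. by move=> i; exact: smooth_cst. Qed.

Lemma smooth_sum (I : Type) (r : seq I) (F : I -> M -> R) :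
  (forall k, smooth_fun (F k)) -> smooth_fun (fun z => \sum_(k <- r) F k z).
Proof.
move=> sF i; apply: salg_smooth; first exact: cod_open.
apply: (@salg_sum _ _ _ _ r (fun k y => F k (mparam i y))) => k.
exact: salg_base (sF k i).
Qed.

Lemma grad_lin f g (a : R) i y : smooth_fun f -> smooth_fun g -> cod i y ->
  grad (fun z => a * f z + g z) i y = a *: grad f i y + grad g i y.
Proof.
move=> sf sg yi; apply/rowP => k.
rewrite [RHS]mxE [X in _ = X + _]mxE !gradE mulr_sumr -big_split /=.
apply: eq_bigr => l _.
have df := smooth_derivable (v := e_ l) (sf i) yi.
have dg := smooth_derivable (v := e_ l) (sg i) yi.
have daf : derivable (a \*o (f \o mparam i)) y (e_ l)
  := derivableM (f := cst a) (derivable_cst a y (e_ l)) df.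
have E : pd l ((fun z => a * f z + g z) \o mparam i) y =
   pd l (a \*o (f \o mparam i)) y + pd l (g \o mparam i) y := deriveD daf dg.
have E2 : pd l (a \*o (f \o mparam i)) y = a * pd l (f \o mparam i) y
  := deriveMl a df.
rewrite E E2; ring.
Qed.

Lemma grad_cst (a : R) i y : grad (fun _ : M => a) i y = 0.
Proof.
apply/rowP => k; rewrite gradE mxE big1 // => l _.
rewrite (_ : pd l _ y = 0) ?mul0r //.
exact: (derive_cst a y (e_ l)).
Qed.

Lemma grad_sum (I : Type) (r : seq I) (a : I -> R) (F : I -> M -> R) i y :
  (forall k, smooth_fun (F k)) -> cod i y ->
  grad (fun z => \sum_(k <- r) a k * F k z) i y =
  \sum_(k <- r) a k *: grad (F k) i y.
Proof.
move=> sF yi; elim: r => [|k r IH].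
  rewrite big_nil (_ : (fun z => _) = fun=> 0); first exact: grad_cst.
  by apply/funext => z; rewrite big_nil.
rewrite big_cons -IH -grad_lin //.
  by congr (grad _ i y); apply/funext => z; rewrite big_cons.
apply: smooth_sum => k'.
rewrite (_ : (fun z => _) = fun z => a k' * F k' z + 0).
  by apply: smooth_lin => //; exact: smooth_fcst.
by apply/funext => z; rewrite addr0.
Qed.

(** The plain coordinate derivative of the gradient. It is not a tangent vector by itself, but it is
    the coefficient of the linearized equation in a chart. *)
Definition dgrad f i y s : V := \row_k 'D_s (fun z => grad f i z 0 k) y.

Lemma dgradE f i y s (k : 'I_n) : dgrad f i y s 0 k = 'D_s (fun z => grad f i z 0 k) y.
Proof. by rewrite mxE. Qed.
Arguments dgradE : clear implicits.
Local Opaque dgrad.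

Lemma dgrad_sum f i y s (k : 'I_n) : smooth_fun f -> cod i y ->
  dgrad f i y s 0 k = \sum_l s 0 l * pd l (fun z => grad f i z 0 k) y.
Proof.
move=> sf yi; rewrite dgradE; exact: derive_dir (cod_open i) (grad_smooth k sf) yi.
Qed.

Lemma dgrad_lin f i y (a : R) s s' : smooth_fun f -> cod i y ->
  dgrad f i y (a *: s + s') = a *: dgrad f i y s + dgrad f i y s'.
Proof.
move=> sf yi; apply/rowP => k; rewrite [RHS]mxE [X in _ = X + _]mxE.
rewrite !(dgrad_sum _ _ sf yi) mulr_sumr -big_split /=.
by apply: eq_bigr => l _; rewrite mxE [X in X + _]mxE mulrDl mulrA.
Qed.

(** Differentiate [grad_jac] along [s]: the product rule puts one derivative on the gradient and one
    on the Jacobian, where it becomes [hess]. *)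
Lemma dgrad_jac f i j y s : smooth_fun f -> overlap i j y ->
  dgrad f j (trans i j y) (jac i j y s) =
  jac i j y (dgrad f i y s) + hess i j y s (grad f i y).
Proof.
move=> sf yo; have zo := overlap_cod (overlap_trans yo); have yi := overlap_cod yo.
apply/rowP => k; rewrite [RHS]mxE.
pose g l := fun z => grad f i z 0 l.
pose T l := fun z => pd l (fun z => trans i j z 0 k) z.
have dg l : derivable (g l) y s by exact: smooth_derivable (grad_smooth l sf) yi.
have dT l : derivable (T l) y s.
  exact: smooth_derivable (smooth_derive (e_ l) (transk_smooth i j k)) yo.
have E1 : dgrad f j (trans i j y) (jac i j y s) 0 k = 'D_s (\sum_l (g l * T l)) y.
  rewrite dgradE -(derive_trans _ (cod_open j) (grad_smooth k sf) yo zo).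
  apply: near_eq_derive; have := near_open (overlap_open i j) yo.
  apply: filterS => z zo'.
  transitivity (jac i j z (grad f i z) 0 k); first by rewrite -grad_jac.
  by rewrite jac_sum // fct_sumE.
have dgT l : derivable (g l * T l) y s by exact: derivableM.
have E2 : 'D_s (\sum_l (g l * T l)) y = \sum_l 'D_s (g l * T l) y.
  exact: derive_sum.
have E3 l : 'D_s (g l * T l) y = g l y * 'D_s (T l) y + T l y * 'D_s (g l) y
  := deriveM (dg l) (dT l).
have E4 : jac i j y (dgrad f i y s) 0 k = \sum_l T l y * 'D_s (g l) y.
  rewrite jac_sum //; apply: eq_bigr => l _; rewrite mulrC; congr (_ * _).
  exact: dgradE.
have E5 : hess i j y s (grad f i y) 0 k = \sum_l g l y * 'D_s (T l) y.
  rewrite hess_sym //; rewrite hessE.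
  have sd : smooth_on (overlap i j) (fun z => 'D_s (fun z => trans i j z 0 k) z).
    exact: smooth_derive (transk_smooth i j k).
  rewrite (derive_dir (grad f i y) (overlap_open i j) sd yo).
  apply: eq_bigr => l _.
  have E : 'D_(e_ l) (fun z => 'D_s (fun z => trans i j z 0 k) z) y = 'D_s (T l) y
    := schwarz (e_ l) s (overlap_open i j) (transk_smooth i j k) yo.
  exact: (f_equal (fun z => grad f i y 0 l * z) E).
rewrite E1 E2 E4 E5 -big_split /=; apply: eq_bigr => l _.
by rewrite E3 addrC.
Qed.

(* The covariant derivative of [grad f] in the direction [s]. *)
Definition cohess f i y s : V := dgrad f i y s + christoffel i y (grad f i y) s.

(** The [hess] terms of [dgrad_jac] and [christoffel_jac] have opposite signs and cancel, by the
    symmetry of [hess]. *)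
Lemma cohess_jac f i j y s : smooth_fun f -> overlap i j y ->
  cohess f j (trans i j y) (jac i j y s) = jac i j y (cohess f i y s).
Proof.
move=> sf yo; rewrite /cohess dgrad_jac // grad_jac // christoffel_jac //.
rewrite -[X in jac i j y (X + _)]scale1r jac_lin // scale1r.
rewrite (hess_sym (grad f i y) s yo).
have aux (a h c : V) : a + h + (c - h) = a + c by rewrite addrACA subrr addr0.
exact: aux.
Qed.

Lemma cohess_lin f i y (a : R) s s' : smooth_fun f -> cod i y ->
  cohess f i y (a *: s + s') = a *: cohess f i y s + cohess f i y s'.
Proof.
by move=> sf yi; rewrite /cohess dgrad_lin // christoffel_linr // scalerDr addrACA.
Qed.

Lemma cohess_tangent f x (t : mindex M -> V) : smooth_fun f -> is_tangent x t ->
  is_tangent x (fun i => cohess f i (mcoord i x) (t i)).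
Proof.
move=> sf tx i j xi xj; rewrite (tangent_push tx xi xj) -(trans_coord j xi).
by rewrite cohess_jac //; exact: overlap_coord.
Qed.

End Gradient.

Arguments dgradE {R n M} f i y s k.
Arguments gradE {R n M} f i y k.

(** * Linear differential equations *)

Local Opaque derive.

Section AnalyticTools.
Context (R : realType).

(** The integral of the square of [|x t| - th] is nonnegative for every [th]; the claim is its value
    at the minimum [th = I / (b - a)]. *)
Lemma cauchy_schwarz_Int (a b : R) (x : R -> R) : a <= b -> intg a b x ->
  intg a b (fun t => x t ^+ 2) ->
  Int a b (fun t => `|x t|) ^+ 2 <= (b - a) * Int a b (fun t => x t ^+ 2).
Proof.
move=> ab xi x2i; set I := Int a b _; set J := Int a b _.
have [abE|ab'] := eqVneq a b; first by rewrite /I abE Int_pt subrr expr0n /= mul0r.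
have d0 : 0 < b - a by rewrite subr_gt0 lt_neqAle ab'.
have key (th : R) : 0 <= J - 2 * th * I + th ^+ 2 * (b - a).
  have ni := intg_norm xi.
  have -> : J - 2 * th * I + th ^+ 2 * (b - a) =
      Int a b (fun t => x t ^+ 2 - 2 * th * `|x t| + th ^+ 2).
    rewrite IntD; [|by apply: intgB => //; exact: intgZ|exact: intg_cst].
    rewrite IntB //; last exact: intgZ.
    by rewrite IntZ // Int_cst.
  apply: Int_ge0 => t _; rewrite -real_normK ?num_real //.
  have -> : `|x t| ^+ 2 - 2 * th * `|x t| + th ^+ 2 = (`|x t| - th) ^+ 2 by ring.
  exact: sqr_ge0.
have := key (I / (b - a)).
have -> : J - 2 * (I / (b - a)) * I + (I / (b - a)) ^+ 2 * (b - a) =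
    J - I ^+ 2 / (b - a) by field; exact: lt0r_neq0.
by rewrite subr_ge0 ler_pdivrMr // mulrC.
Qed.

Lemma cts_comp n (a b : R) (y : R -> 'rV[R]_n) (F : 'rV[R]_n -> R) :
  (forall k, cts a b (fun t => y t 0 k)) ->
  (forall t, a <= t <= b -> {for y t, continuous F}) ->
  cts a b (fun t => F (y t)).
Proof.
move=> yc Fc t tab e e0; have [d d0 Hd] := cts_box (Fc t tab) e0.
have /choice[dk Hdk] : forall k : 'I_n, exists d' : R, 0 < d' /\
    forall t', a <= t' <= b -> `|t' - t| < d' -> `|y t' 0 k - y t 0 k| < d.
  by move=> k; have [d' ? ?] := yc k t tab d d0; exists d'.
(* The default value [1] keeps the radius positive when [n = 0]. *)
exists (\big[Num.min/1]_k dk k).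
  by elim/big_ind: _ => // [u w u0 w0|k _]; [rewrite lt_min u0|exact: (Hdk k).1].
move=> t' t'ab tt'; apply: Hd => k; apply: (Hdk k).2 => //.
apply: lt_le_trans tt' _; exact: bigmin_le_cond.
Qed.

(** As for [primM], the defect of the chain rule is additive over intervals. Near [t] it is at most
    [e] times the integral of [N]: half of it comes from strict differentiability of [g] at [y t],
    half from freezing the partial derivatives at [y t]. *)
Lemma prim_comp n (a b : R) (y v : R -> 'rV[R]_n) (O : set 'rV[R]_n)
  (g : 'rV[R]_n -> R) :
  (forall k, prim a b (fun t => y t 0 k) (fun t => v t 0 k)) ->
  open O -> smooth_on O g -> (forall t, a <= t <= b -> O (y t)) ->
  prim a b (fun t => g (y t)) (fun t => \sum_k pd k g (y t) * v t 0 k).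
Proof.
move=> yp oO sg yO.
have yc k := prim_cts (yp k).
have Dc k : cts a b (fun t => pd k g (y t)).
  apply: (cts_comp yc) => t tab.
  exact: smooth_continuous (smooth_derive _ sg) (yO t tab).
have Gi : intg a b (fun t => \sum_k pd k g (y t) * v t 0 k).
  by apply: intg_sum => k; apply: intgM => //; exact: (yp k).1.
pose N (t : R) : R := \sum_k `|v t 0 k|.
have Ni : intg a b N by apply: intg_sum => k; apply: intg_norm; exact: (yp k).1.
apply: primP => // c d ac cd db; apply/eqP; rewrite -subr_eq0; apply/eqP.
apply: (@eq0_small _ _ (Int c d N)) => e e0.
apply: (@itv_ind _ (fun c d => `|g (y d) - g (y c) -
  Int c d (fun t => \sum_k pd k g (y t) * v t 0 k)| <= e * Int c d N) c d) => //.
- move=> r1 r2 r3 h1 h2 h3 h4 P Q.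
  have s1 : a <= r1 by exact: le_trans h1.
  have s2 : r3 <= b by exact: le_trans db.
  rewrite (Int_cat h2 h3 (intg_sub s1 s2 Gi)) (Int_cat h2 h3 (intg_sub s1 s2 Ni)).
  rewrite mulrDr; apply: le_trans (lerD P Q); apply: le_trans (ler_normD _ _).
  by rewrite le_eqVlt; apply/orP; left; apply/eqP; congr `|_|; ring.
- move=> t tcd.
  have tab : a <= t <= b by exact: sub_itv tcd.
  have e2 : 0 < e / 2 by lra.
  have [d1 d10 H1] := smooth_strict oO sg (yO t tab) e2.
  have /choice[dk Hdk] : forall k : 'I_n, exists d' : R, 0 < d' /\
    forall t', a <= t' <= b -> `|t' - t| < d' ->
      `|y t' 0 k - y t 0 k| < d1 /\ `|pd k g (y t') - pd k g (y t)| < e / 2.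
    move=> k; have [d2 d20 H2] := yc k t tab d1 d10.
    have [d3 d30 H3] := Dc k t tab _ e2.
    exists (Num.min d2 d3); split; first by rewrite lt_min d20.
    move=> t' t'ab; rewrite lt_min => /andP[u1 u2]; split; [exact: H2|exact: H3].
  exists (\big[Num.min/1]_k dk k).
    by elim/big_ind: _ => // [u w u0 w0|k _]; [rewrite lt_min u0|exact: (Hdk k).1].
  move=> r1 r2 h1 h2 h3; set dd := \big[_/_]_k _ => h4 h5.
  have s1 : a <= r1 by exact: le_trans h1.
  have s2 : r2 <= b by exact: le_trans db.
  have near r k : r1 <= r <= r2 ->
      `|y r 0 k - y t 0 k| < d1 /\ `|pd k g (y r) - pd k g (y t)| < e / 2.
    move=> rr; apply: (Hdk k).2; first exact: sub_itv rr.
    apply: near_itv h4 h5 rr; exact: bigmin_le_cond.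
  have B r : r1 <= r <= r2 -> box (y t) d1 (y r) by move=> rr k; have [] := near r k rr.
  have i1 : r1 <= r1 <= r2 by rewrite lexx h2.
  have i2 : r1 <= r2 <= r2 by rewrite lexx h2.
  have vi k := intg_sub s1 s2 (yp k).1.
  have Gi' := intg_sub s1 s2 Gi; have Ni' := intg_sub s1 s2 Ni.
  have dy k : y r2 0 k - y r1 0 k = Int r1 r2 (fun t => v t 0 k).
    by rewrite (prim_diff (yp k)).
  have := H1 _ _ (B _ i2) (B _ i1).
  set Q := \sum_k _; set Q' := \sum_k _ => HQ.
  have QE : Q = Int r1 r2 (fun s => \sum_k pd k g (y t) * v s 0 k).
    rewrite Int_sum; last by move=> k; exact: intgZ.
    by apply: eq_bigr => k _; rewrite IntZ // dy.
  have Q'le : Q' <= Int r1 r2 N.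
    rewrite /N Int_sum; last by move=> k; exact: intg_norm.
    by apply: ler_sum => k _; rewrite dy; exact: norm_Int.
  set X := Int r1 r2 (fun s => \sum_k pd k g (y s) * v s 0 k).
  have QX : `|Q - X| <= e / 2 * Int r1 r2 N.
    rewrite QE /X -IntB //; last by apply: intg_sum => k; exact: intgZ.
    have ii : intg r1 r2 (fun s => \sum_k pd k g (y t) * v s 0 k -
        \sum_k pd k g (y s) * v s 0 k).
      by apply: intgB => //; apply: intg_sum => k; exact: intgZ.
    apply: le_trans (norm_Int ii) _.
    rewrite -IntZ //; apply: le_Int; [exact: intg_norm|exact: intgZ|].
    move=> s sr; rewrite -sumrB; apply: le_trans (ler_norm_sum _ _ _) _.
    rewrite /N mulr_sumr; apply: ler_sum => k _.
    rewrite -mulrBl normrM; apply: ler_wpM2r => //.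
    by rewrite distrC; apply/ltW; have [] := near s k sr.
  have -> : g (y r2) - g (y r1) - X = (g (y r2) - g (y r1) - Q) + (Q - X) by ring.
  apply: le_trans (ler_normD _ _) _.
  have -> : e * Int r1 r2 N = e / 2 * Int r1 r2 N + e / 2 * Int r1 r2 N by field.
  apply: lerD => //; apply: le_trans HQ _; apply: ler_wpM2l => //; exact: ltW.
Qed.

(** * Picard iteration for linear integral equations *)

Section Volterra.
Context (n : nat) (a b L : R) (A : 'I_n -> 'I_n -> R -> R) (om : 'I_n -> R -> R).
Context (ab : a <= b) (Ac : forall k l, cts a b (A k l))
  (omc : forall k, cts a b (om k))
  (AL : forall t, a <= t <= b -> \sum_k \sum_l `|A k l t| <= L)
  (Lab : L * (b - a) <= 1 / 2).

Let next (x : 'I_n -> R -> R) (k : 'I_n) (t : R) : R :=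
  om k t - Int a t (fun u => \sum_l A k l u * x l u).
Let it m := iter m next om.

Let Ax_intg (x : 'I_n -> R -> R) k t : t <= b -> (forall k, cts a b (x k)) ->
  intg a t (fun u => \sum_l A k l u * x l u).
Proof.
move=> tb xc; apply: (intg_sub (lexx a) tb).
by apply: cts_intg; apply: cts_sum => l; exact: ctsM.
Qed.

Let next_cts x : (forall k, cts a b (x k)) -> forall k, cts a b (next x k).
Proof.
move=> xc k; apply: ctsB => //.
apply: (@prim_cts _ _ _ _ (fun u => \sum_l A k l u * x l u)).
split; first exact: Ax_intg.
by move=> t tab; rewrite Int_pt add0r.
Qed.

Let it_cts m : forall k, cts a b (it m k).
Proof. by elim: m => [//|m IH]; exact: next_cts. Qed.

Let next_contr x z (D : R) : (forall k, cts a b (x k)) -> (forall k, cts a b (z k)) ->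
  (forall k t, a <= t <= b -> `|x k t - z k t| <= D) ->
  forall k t, a <= t <= b -> `|next x k t - next z k t| <= D / 2.
Proof.
move=> xc zc H k t /andP[ta tb].
have D0 : 0 <= D by have := H k a; rewrite lexx ab => /(_ isT); exact: le_trans.
have xi := Ax_intg k tb xc; have zi := Ax_intg k tb zc.
rewrite /next (_ : _ - _ = Int a t (fun u => \sum_l A k l u * z l u) -
  Int a t (fun u => \sum_l A k l u * x l u)); last by ring.
rewrite -IntB //; apply: le_trans (norm_Int (intgB zi xi)) _.
have L0 : 0 <= L.
  have := AL (t := a); rewrite lexx ab => /(_ isT); apply: le_trans.
  by do 2 apply: sumr_ge0 => ? _.
apply: (@le_trans _ _ (Int a t (fun=> L * D))).
  apply: le_Int; [exact/intg_norm/intgB|exact: intg_cst|].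
  move=> u /andP[au ut]; have uab : a <= u <= b by rewrite au (le_trans ut).
  rewrite -sumrB; apply: le_trans (ler_norm_sum _ _ _) _.
  apply: (@le_trans _ _ (\sum_l `|A k l u| * D)).
    apply: ler_sum => l _; rewrite -mulrBr normrM; apply: ler_wpM2l => //.
    by rewrite distrC; exact: H.
  rewrite -mulr_suml; apply: ler_wpM2r => //; apply: le_trans (AL uab).
  rewrite [X in _ <= X](bigD1 k) //= lerDl; apply: sumr_ge0 => j _; exact: sumr_ge0.
rewrite Int_cst //.
have : L * (t - a) <= L * (b - a) by apply: ler_wpM2l => //; rewrite lerD2r.
move=> h; have {h}: L * (t - a) <= 1 / 2 by exact: le_trans Lab.
move=> /(ler_wpM2r D0); lra.
Qed.

(** By [Lab] the map [next] halves uniform distances, so the iterates converge uniformly to a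
    continuous fixed point. The equation is in integral form with [om] continuous, so that a merely
    integrable inhomogeneity can enter through its primitive. *)
Lemma volterra : exists2 x : 'I_n -> R -> R, (forall k, cts a b (x k)) &
  forall k t, a <= t <= b -> x k t = om k t - Int a t (fun u => \sum_l A k l u * x l u).
Proof.
have [D D0 HD] : exists2 D : R, 0 < D & forall k t, a <= t <= b ->
    `|it 1 k t - it 0 k t| <= D.
  have /choice[C HC] : forall k : 'I_n, exists C : R, 0 < C /\
      forall t, a <= t <= b -> `|it 1 k t - it 0 k t| <= C.
    move=> k; have [C ? ?] := cts_bounded (ctsB (it_cts 1 k) (it_cts 0 k)).
    by exists C.
  exists (1 + \sum_k C k).
    by rewrite ltr_wpDr // sumr_ge0 // => k _; exact/ltW/(HC k).1.
  move=> k t tab; apply: le_trans ((HC k).2 t tab) _.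
  rewrite (bigD1 k) //= addrCA lerDl addr_ge0 // sumr_ge0 // => j _.
  exact/ltW/(HC j).1.
have step m k t : a <= t <= b -> `|it m.+1 k t - it m k t| <= D / 2 ^+ m.
  elim: m k t => [|m IH] k t tab; first by rewrite expr0 divr1; exact: HD.
  rewrite exprS invfM mulrCA mulrC.
  exact: (@next_contr (it m.+1) (it m) (D / 2 ^+ m)).
(* The exact partial sum of the geometric series; its subtracted remainder is what makes the
   induction on [p] close. *)
have far m p k t : a <= t <= b ->
    `|it (m + p) k t - it m k t| <= 2 * D / 2 ^+ m - D / 2 ^+ m / 2 ^+ p * 2.
  move=> tab; elim: p => [|p IH].
    by rewrite addn0 subrr normr0 expr0 divr1; lra.
  rewrite addnS (_ : _ - _ = (it (m + p).+1 k t - it (m + p) k t) +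
    (it (m + p) k t - it m k t)); last by ring.
  apply: le_trans (ler_normD _ _) _.
  have := step (m + p)%N k t tab; rewrite exprD invfM mulrA => h.
  rewrite [in X in _ <= X]exprS (invfM 2 (2 ^+ p)).
  move: IH h; set q := D / 2 ^+ m / 2 ^+ p; set q' := D / 2 ^+ m.
  have -> : q' * (2^-1 * (2 ^+ p)^-1) = q / 2 by rewrite /q -/q' mulrA [LHS]mulrAC.
  lra.
have far' m p k t : a <= t <= b -> `|it (m + p) k t - it m k t| <= 2 * D / 2 ^+ m.
  move=> tab; apply: le_trans (far m p k t tab) _.
  rewrite lerBlDr lerDl mulr_ge0 // ?divr_ge0 // ?exprn_ge0 //; exact: ltW.
have geo : (2 * D / 2 ^+ m) @[m --> \oo] --> (0 : R).
  rewrite (_ : (fun m => _) = (fun m => geometric (2 * D) (2^-1) m)).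
    by apply: cvg_geometric; rewrite ger0_norm ?invr_ge0 // invf_lt1 ?ltr1n.
  by apply/funext => m; rewrite /= exprVn.
have small (e : R) : 0 < e -> exists m, 2 * D / 2 ^+ m < e.
  move=> e0; have /cvgrPdist_lt /(_ e e0) [m _ Hm] := geo.
  exists m; have := Hm m (leqnn m); rewrite /= sub0r normrN ger0_norm //.
  by rewrite divr_ge0 // ?exprn_ge0 // mulr_ge0 // ltW.
have cv k t : a <= t <= b -> cvgn (fun m => it m k t).
  move=> tab; apply: cauchy_cvg; apply: cauchy_exP => e e0.
  have [m Hm] := small e e0; exists (it m k t); exists m => // p /= mp.
  rewrite /ball /= distrC -(subnKC mp); exact: le_lt_trans (far' _ _ _ _ tab) Hm.
pose x (k : 'I_n) (t : R) : R := limn (fun m => it m k t).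
have close m k t : a <= t <= b -> `|x k t - it m k t| <= 2 * D / 2 ^+ m.
  move=> tab; apply/ler_addgt0Pr => e e0.
  have /cvgrPdist_lt /(_ e e0) [p _ Hp] : (it m k t @[m --> \oo]) --> x k t := cv k t tab.
  have := Hp (m + p)%N (leq_addl _ _); rewrite /= -/(x k t) => h.
  rewrite -(subrKA (it (m + p) k t)) addrC; apply: le_trans (ler_normD _ _) _.
  apply: lerD; [exact: far'|exact: ltW].
have xc k : cts a b (x k).
  move=> t tab e e0; have e4 : 0 < e / 4 by lra.
  have [m Hm] := small _ e4; have e2 : 0 < e / 2 by lra.
  have ic : cts a b (it m k) by exact: it_cts.
  have [d d0 Hd] := ic t tab _ e2; exists d => // u uab ut.
  have h1 := le_lt_trans (close m k t tab) Hm.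
  have h2 := le_lt_trans (close m k u uab) Hm.
  have h3 := Hd u uab ut.
  have -> : x k u - x k t = (x k u - it m k u) + (it m k u - it m k t) - (x k t - it m k t)
    by ring.
  apply: le_lt_trans (ler_normB _ _) _.
  have := ler_normD (x k u - it m k u) (it m k u - it m k t); lra.
exists x => // k t tab; apply/eqP; rewrite -subr_eq0; apply/eqP.
apply: (@eq0_small _ _ 1) => e e0; rewrite mulr1.
have e2 : 0 < e / 2 by lra.
have [m Hm] := small _ e2.
have h1 := close m.+1 k t tab.
have h2 := next_contr (it_cts m) xc (fun k t tab => (eq_ind_r (fun z => z <= _) (close m k
  t tab) (distrC _ _))) k tab.
rewrite -/(next x k t) -(subrKA (it m.+1 k t)); apply: le_trans (ler_normD _ _) _.
have h3 : 2 * D / 2 ^+ m.+1 <= 2 * D / 2 ^+ m.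
  apply: ler_wpM2l; first by rewrite mulr_ge0 // ltW.
  by rewrite lef_pV2 ?posrE ?exprn_gt0 // ler_eXn2l ?ltr1n.
have h4 : 2 * D / 2 ^+ m / 2 <= e / 2.
  by apply: ler_wpM2r => //; apply: le_trans (ltW Hm) _; lra.
have h5 : `|it m.+1 k t - next x k t| <= 2 * D / 2 ^+ m / 2 := h2.
by rewrite (splitr e); apply: lerD; [apply: le_trans h1 _;
  apply: le_trans h3 (ltW Hm)|exact: le_trans h5 h4].
Qed.

End Volterra.
End AnalyticTools.

(** * Bump functions *)

Local Opaque derive.

Section FlatFunction.
Context (R : realType).

(* [flat j] is the [j]-th derivative of [exp (- 1 / x)] extended by 0. *)
Fixpoint flat_poly (j : nat) : {poly R} :=
  if j is j'.+1 then 'X^2 * (flat_poly j' - (flat_poly j')^`()%R) else 1.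

Definition flat (j : nat) (x : R) : R :=
  if 0 < x then (flat_poly j).[x^-1] * expR (- x^-1) else 0.

Lemma flat_le0 j x : x <= 0 -> flat j x = 0.
Proof. by rewrite /flat leNgt => /negbTE ->. Qed.

Lemma flat_gt0 x : 0 < x -> 0 < flat 0 x.
Proof. by move=> x0; rewrite /flat x0 hornerE mul1r expR_gt0. Qed.

Lemma flat1_gt0 x : 0 < x -> 0 < flat 1 x.
Proof.
move=> x0; rewrite /flat x0 /= derivC subr0 mulr1 hornerXn mulr_gt0 ?expR_gt0 //.
by rewrite exprn_gt0 // invr_gt0.
Qed.

Lemma flat1_ge0 x : 0 <= flat 1 x.
Proof.
have [x0|x0] := leP x 0; first by rewrite flat_le0.
exact/ltW/flat1_gt0.
Qed.

Lemma flat_ge0 x : 0 <= flat 0 x.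
Proof.
have [x0|x0] := leP x 0; first by rewrite flat_le0.
exact/ltW/flat_gt0.
Qed.

Lemma poly_bound (p : {poly R}) : exists2 K : R, 0 <= K &
  exists d : nat, forall u, 1 <= u -> `|p.[u]| <= K * u ^+ d.
Proof.
elim/poly_ind: p => [|p c [K K0 [d H]]].
  by exists 0 => //; exists 0%N => u _; rewrite horner0 normr0 mul0r.
exists (K + `|c|); first by rewrite addr_ge0.
exists d.+1 => u u1; rewrite hornerMXaddC.
have u0 : 0 <= u by exact: le_trans u1.
apply: le_trans (ler_normD _ _) _; rewrite mulrDl; apply: lerD.
  rewrite normrM (ger0_norm u0) exprSr mulrA; apply: ler_wpM2r => //; exact: H.
by rewrite ler_peMr // exprn_ege1.
Qed.

(** The inequality [v <= expR v] at [v = u / d.+1%:R], raised to the power [d.+1]. *)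
Lemma exp_decay (d : nat) (u : R) : 0 < u -> u ^+ d * expR (- u) <= (d.+1)%:R ^+ d.+1 / u.
Proof.
move=> u0; rewrite ler_pdivlMr // mulrAC -exprSr expRN ler_pdivrMr ?expR_gt0 //.
have -> : expR u = expR (u / d.+1%:R) ^+ d.+1.
  by rewrite -expRM_natl mulrC divfK // pnatr_eq0.
rewrite -exprMn; apply: lerXn2r; rewrite ?nnegrE ?mulr_ge0 ?expR_ge0 ?(ltW u0) //.
rewrite mulrC -ler_pdivrMr ?ltr0n //.
by apply: le_trans (expR_ge1Dx _); rewrite lerDr.
Qed.

(** Quadratic decay makes the derivative of each [flat j] at [0] exist and vanish. *)
Lemma flat_small j : exists2 K : R, 0 <= K & forall x, `|x| <= 1 ->
  `|flat j x| <= K * x ^+ 2.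
Proof.
have [K K0 [d H]] := poly_bound (flat_poly j).
exists (K * (d.+2)%:R ^+ d.+2); first by rewrite mulr_ge0 // exprn_ge0.
move=> x x1; rewrite /flat; case: ifP => x0; last first.
  by rewrite normr0 mulr_ge0 ?sqr_ge0 // mulr_ge0 // exprn_ge0.
rewrite (gtr0_norm x0) in x1.
have u1 : 1 <= x^-1 by rewrite invf_ge1.
have u0 : 0 < x^-1 by rewrite invr_gt0.
rewrite normrM (ger0_norm (expR_ge0 _)).
apply: (@le_trans _ _ (K * (x^-1 ^+ d * expR (- x^-1)))).
  by rewrite mulrA; apply: ler_wpM2r; [exact: expR_ge0|exact: H].
rewrite -mulrA; apply: ler_wpM2l => //.
(* One power more than the degree of the bound, to gain the second factor [x]. *)
have := exp_decay d.+1 u0; rewrite exprS -mulrA -ler_pdivlMl // invrK => h.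
by apply: le_trans h _; rewrite expr2 mulrCA.
Qed.

Lemma flat_derive j x : is_derive x (1 : R) (flat j) (flat j.+1 x).
Proof.
have [x0|x0|->] := ltgtP x 0.
- rewrite flat_le0 ?ltW //.
  have dc : is_derive x (1 : R) (cst (0 : R)) (0 : R) by exact: is_derive_cst.
  apply: near_eq_is_derive dc.
  have := near_open (T := R) (O := [set z | z < 0]) (@open_lt _ 0) x0.
  by apply: filterS => z /= z0; rewrite flat_le0 // ltW.
- have xn : x != 0 by exact: lt0r_neq0.
  have dV : is_derive x (1 : R) (fun z : R => z^-1) (- x ^- 2).
    have := is_deriveV (f := @idfun R) xn (is_derive_id x 1).
    by rewrite /GRing.scale /= mulr1.
  have dP : is_derive x (1 : R) (fun z : R => (flat_poly j).[z^-1])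
     ((flat_poly j)^`()%R.[x^-1] * (- x ^- 2)).
    exact: (is_derive1_comp (is_derive_poly (flat_poly j) x^-1) dV).
  have dE : is_derive x (1 : R) (fun z : R => expR (- z^-1)) (expR (- x^-1) * x ^- 2).
    have dN : is_derive x (1 : R) (fun z : R => - z^-1) (x ^- 2).
      by rewrite -[x ^- 2]opprK; exact: (is_deriveN dV).
    exact: (@is_derive1_comp _ (@expR R) (fun z : R => - z^-1) x _ _ (is_derive_expR (-
      x^-1)) dN).
  have E : (flat_poly j).[x^-1] *: (expR (- x^-1) * x ^- 2) +
      expR (- x^-1) *: ((flat_poly j)^`()%R.[x^-1] * (- x ^- 2)) = flat j.+1 x.
    rewrite /GRing.scale /flat x0 /= hornerM hornerXn hornerD hornerN exprVn.
    move: _.[_] _.[_] (expR _) (x ^- 2) => p q r s; ring.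
  have dM := is_derive_eq (is_deriveM dP dE) E.
  apply: near_eq_is_derive dM.
  have := near_open (T := R) (O := [set z | 0 < z]) (@open_gt _ 0) x0.
  by apply: filterS => z /= z0; rewrite /flat z0.
- rewrite [X in is_derive _ _ _ X]flat_le0 //.
  have [K K0 HK] := flat_small j.
  have main : h^-1 *: ((flat j \o shift (0 : R)) (h *: (1 : R)) - flat j 0) @[h --> (0 :
    R)^'] --> (0 : R).
    apply/cvgrPdist_lt => e e0.
    near=> h.
    have h0 : h != 0 by near: h; exact: nbhs_dnbhs_neq.
    have h1 : `|h| < 1 by near: h; exact: dnbhs0_lt.
    have h2 : `|h| < e / (K + 1) by near: h; apply: dnbhs0_lt; rewrite divr_gt0 // ltr_wpDl.
    rewrite sub0r normrN /= /GRing.scale /= mulr1 addr0 (flat_le0 j (lexx 0)) subr0.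
    rewrite normrM normfV ltr_pdivrMl ?normr_gt0 //.
    apply: le_lt_trans (HK h (ltW h1)) _.
    rewrite -real_normK ?num_real // expr2 mulrA mulrC ltr_pM2l ?normr_gt0 //.
    rewrite ltr_pdivlMr ?ltr_wpDl // in h2.
    apply: le_lt_trans h2; rewrite mulrC; apply: ler_wpM2l => //; lra.
  apply: DeriveDef; first by apply/cvg_ex; exists 0.
  exact: cvg_lim main.
Unshelve. all: by end_near. Qed.

End FlatFunction.

(** The sets with [Q] form an ideal. If the whole space were not among them, their complements would
    form a proper filter; it would cluster at some [p], against the neighbourhood of [p] with
    [Q]. *)
Lemma compact_ind (T : topologicalType) (Q : set T -> Prop) :
  compact [set: T] -> Q set0 -> (forall A B, A `<=` B -> Q B -> Q A) ->
  (forall A B, Q A -> Q B -> Q (A `|` B)) ->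
  (forall p : T, exists2 U : set T, nbhs p U & Q U) -> Q setT.
Proof.
move=> cT Q0 QS QU Qloc; apply: contrapT => nQ.
pose F : set_system T := [set A | Q (~` A)].
have FF : ProperFilter F.
  split; first by rewrite /F /= setC0.
  split; first by rewrite /F /= setCT.
    by move=> A B FA FB; rewrite /F /= setCI; exact: QU.
  by move=> A B AB; apply: QS => x nB /AB.
have [p [_ clp]] := cT F FF (filterT : F setT).
have [U Up QU'] := Qloc p.
have [x [nUx Ux]] : (~` U) `&` U !=set0.
  by apply: clp => //; rewrite /F /= setCK.
exact: nUx.
Qed.

(** * Functions with prescribed differentials, and label spaces *)

Section Bumps.
Context (R : realType) (n : nat) (M : closed_riemannian R n).
Local Notation V := 'rV[R]_n.
Local Notation e_ k := (delta_mx 0 k : V).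
Implicit Types (i j : mindex M) (x : M) (y u v w s : V) (f g : M -> R).
Local Opaque derive met jac hess dmet christoffel grad dgrad.

Definition cbox (y : V) (r : R) : set V := [set z | forall k, `|z 0 k - y 0 k| <= r].

Lemma cbox_compact y r : compact (cbox y r).
Proof.
rewrite (_ : cbox y r = [set z | forall k, `[y 0 k - r, y 0 k + r]%classic (z ord0 k)]).
  by apply: (@rV_compact _ _ (fun k => `[y 0 k - r, y 0 k + r]%classic)) => k;
    exact: segment_compact.
apply/seteqP; split=> z /= H k; have := H k; rewrite in_itv /= ler_norml;
  move=> /andP[h1 h2]; apply/andP; split; lra.
Qed.

Definition extend i (F : V -> R) : M -> R :=
  fun x => if `[< mdom i x >] then F (mcoord i x) else 0.

Lemma extend_in i F x : mdom i x -> extend i F x = F (mcoord i x).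
Proof. by move=> xi; rewrite /extend asboolT. Qed.

(** The image [K] of the closed box is compact, hence closed because [M] is Hausdorff. Every point
    lies either in chart [i], where [F] is composed with a change of charts, or in the open
    complement of [K], where the extension is zero. *)
Lemma extend_smooth i F y r : cbox y r `<=` cod i -> smooth_on (cod i) F ->
  (forall z, cod i z -> ~ cbox y r z -> F z = 0) -> smooth_fun (extend i F).
Proof.
move=> Bi sF F0 j.
pose K := mparam i @` cbox y r.
have Kc : closed K.
  apply: compact_closed; first exact: mhausdorff.
  apply: continuous_compact; last exact: cbox_compact.
  by apply: continuous_subspaceW Bi _; exact: mparam_cts.
have out x : ~ K x -> extend i F x = 0.
  move=> nK; rewrite /extend; case: asboolP => // xi; apply: F0.
    exact: mcoord_cod.
  by move=> B; apply: nK; exists (mcoord i x) => //; exact: mcoordK.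
apply: smooth_local => z zj.
have [zi|nzi] := pselect (mdom i (mparam j z)).
  exists (overlap j i); first by apply/overlapP.
  apply: (smooth_ext (F := fun z => F (trans j i z))).
  - exact: overlap_open.
  - by move=> u /overlapP[uj ui]; rewrite /= extend_in.
  - apply: salg_smooth; first exact: overlap_open.
    apply: (salg_comp (O' := cod i)) => //; first exact: cod_open.
      by move=> k; apply: salg_base; exact: transk_smooth.
    by move=> u /overlap_trans; exact: overlap_cod.
have nKz : ~ K (mparam j z).
  by move=> [u uB E]; apply: nzi; rewrite -E; apply: mparam_dom; exact: Bi.
exists [set u | cod j u /\ ~ K (mparam j u)] => //.
apply: (smooth_ext (F := fun=> 0)); last exact: smooth_cst.
  rewrite openE => u [uj uK]; rewrite /interior.
  have h1 := near_open (cod_open j) uj.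
  have h2 : \forall z \near u, (~` K) (mparam j z).
    by apply: (mparam_near uj); apply: near_open uK; exact: closed_openC.
  by apply: filterS2 h1 h2 => w w1 w2.
by move=> u [uj uK]; rewrite /= out.
Qed.

Definition hump (y : V) (r : R) (z : V) : R :=
  flat 0 (r ^+ 2 - \sum_k (z 0 k - y 0 k) ^+ 2).

Lemma coord_smooth (O : set V) (k : 'I_n) : smooth_on O (fun z => z 0 k).
Proof.
move=> vs v x _.
suff [[a ->]|->] : (exists a, iter_derive vs (fun z : V => z 0 k) = fun=> a) \/
   iter_derive vs (fun z : V => z 0 k) = fun z => z 0 k.
- by split; [exact: derivable_cst|exact: cst_continuous].
- split; last exact: coord_continuous.
  by have /derivable_mxP := @derivable_id R V x v; apply.
elim: vs => [|w vs [[a IH]|IH]] /=; first by right.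
  by left; exists 0; rewrite IH; apply/funext => z; exact: (derive_cst a z w).
left; exists (w 0 k); rewrite IH; apply/funext => z.
by have /matrixP /(_ 0 k) := derive_mx (@derivable_id R V z w); rewrite derive_id => ->;
  rewrite mxE.
Qed.

Lemma pd_coord (k q : 'I_n) y : pd q (fun z : V => z 0 k) y = (q == k)%:R.
Proof.
have := derive_mx (@derivable_id R V y (e_ q)); rewrite derive_id => /matrixP /(_ 0 k).
by rewrite !mxE eqxx eq_sym /= => ->.
Qed.

Lemma salg_affine (O : set V) (a : 'I_n -> R) y :
  salg O (fun z => \sum_k a k * (z 0 k - y 0 k)).
Proof.
apply: salg_sum => k; apply: salg_mul; first exact: salg_cst.
by apply: (salg_add (v := fun=> - y 0 k)); [apply/salg_base/coord_smooth|exact: salg_cst].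
Qed.

Lemma hump_smooth (O : set V) y r : salg O (hump y r).
Proof.
apply: (@salg_comp1 R _ _ (@flat R) 0%N); first exact: flat_derive.
apply: (salg_add (u := fun=> r ^+ 2)); first exact: salg_cst.
rewrite (_ : (fun x : V => - _) = (fun x : V => (-1) * \sum_k (x 0 k - y 0 k) * (x 0 k - y
  0 k))).
  apply: salg_mul; first exact: salg_cst.
  apply: salg_sum => k.
  by apply: salg_mul; (apply: (salg_add (v := fun=> - y 0 k));
    [apply/salg_base/coord_smooth|exact: salg_cst]).
by apply/funext => z; rewrite mulN1r.
Qed.

Lemma hump_out y r z : 0 <= r -> ~ cbox y r z -> hump y r z = 0.
Proof.
move=> r0 /existsNP[k /negP]; rewrite -ltNge => rk; apply: flat_le0.
rewrite subr_le0 (bigD1 k) //= -[X in _ <= X + _]real_normK ?num_real //.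
have h : r ^+ 2 <= `|z 0 k - y 0 k| ^+ 2 by rewrite ler_sqr ?nnegrE // ltW.
by apply: le_trans h _; rewrite lerDl sumr_ge0 // => q _; exact: sqr_ge0.
Qed.

Lemma hump_center y r : 0 < r -> 0 < hump y r y.
Proof.
move=> r0; apply: flat_gt0; rewrite big1 ?subr0 ?exprn_gt0 // => k _.
by rewrite subrr expr0n.
Qed.

(** A linear function of the coordinates centred at [x], times a bump normalized to [1] there. As
    the linear factor vanishes at [x], the derivative of the bump does not contribute to the
    differential. *)
Lemma fun_with_differential i x (a : 'I_n -> R) : mdom i x ->
  exists g, [/\ smooth_fun g, g x = 0 &
    forall k, pd k (g \o mparam i) (mcoord i x) = a k].
Proof.
move=> xi; set y := mcoord i x.
have yi : cod i y by exact: mcoord_cod.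
have /nbhs_box[d d0 Hd] := near_open (cod_open i) yi.
pose r := d / 2; have r0 : 0 < r by rewrite /r; lra.
have Br : cbox y r `<=` cod i.
  by move=> z zB; apply: Hd => k; apply: le_lt_trans (zB k) _; rewrite /r; lra.
pose A (z : V) : R := \sum_k a k * (z 0 k - y 0 k).
have b0 := hump_center y r0.
pose F (z : V) : R := (hump y r y)^-1 * hump y r z * A z.
have sF : smooth_on (cod i) F.
  apply: salg_smooth; first exact: cod_open.
  apply: salg_mul; last exact: salg_affine.
  by apply: salg_mul; [exact: salg_cst|exact: hump_smooth].
have Ay : A y = 0 by rewrite /A big1 // => k _; rewrite subrr mulr0.
exists (extend i F); split.
- apply: (extend_smooth Br sF) => z _ nz.
  by rewrite /F (hump_out (ltW r0) nz) mulr0 mul0r.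
- by rewrite extend_in // /F Ay mulr0.
- move=> k.
  have E : pd k (extend i F \o mparam i) y = pd k F y.
    apply: near_eq_derive; have := near_open (cod_open i) yi.
    by apply: filterS => z zi /=; rewrite extend_in ?mparamK //; exact: mparam_dom.
  rewrite E.
  pose B (z : V) : R := (hump y r y)^-1 * hump y r z.
  have sB : smooth_on (cod i) B.
    apply: salg_smooth; first exact: cod_open.
    by apply: salg_mul; [exact: salg_cst|exact: hump_smooth].
  have sA : smooth_on (cod i) A.
    by apply: salg_smooth; [exact: cod_open|exact: salg_affine].
  have dB := smooth_derivable (v := e_ k) sB yi.
  have dA := smooth_derivable (v := e_ k) sA yi.
  have E1 : pd k F y = B y * pd k A y + A y * pd k B y := deriveM dB dA.
  have By : B y = 1 by rewrite /B mulVf // gt_eqF.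
  rewrite E1 By Ay mul0r addr0 mul1r.
  have -> : pd k A y = 'D_(e_ k) (\sum_q (fun z : V => a q * (z 0 q - y 0 q))) y.
    by congr ('D_ _ _ _); apply/funext => z; rewrite fct_sumE.
  have dq q : is_derive y (e_ k) (fun z : V => a q * (z 0 q - y 0 q)) (a q * (k == q)%:R).
    have dc : derivable (fun z : V => z 0 q) y (e_ k) by have /derivable_mxP :=
      @derivable_id R V y (e_ k); apply.
    have d1 : is_derive y (e_ k) (fun z : V => z 0 q - y 0 q) ((k == q)%:R).
      have := is_deriveB (derivableP dc) (is_derive_cst (y 0 q) y (e_ k)).
      by rewrite subr0 -/(pd k _ y) pd_coord.
    exact: (is_deriveZ (a q) d1).
  rewrite derive_sum; last by move=> q; have [] := dq q.
  rewrite (bigD1 k) //= big1 ?addr0; last first.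
    by move=> q qk; have [_ ->] := dq q; rewrite eq_sym (negbTE qk) mulr0.
  by have [_ ->] := dq k; rewrite eqxx mulr1.
Qed.

Definition spans (I : finType) (g : I -> M -> R) x : Prop := forall i, mdom i x ->
  forall u : V, exists a : I -> R, u = \sum_k a k *: grad (g k) i (mcoord i x).

Lemma spans_chart (I : finType) (g : I -> M -> R) i x : (forall k, smooth_fun (g k)) ->
  mdom i x -> (forall u : V, exists a : I -> R, u = \sum_k a k *: grad (g k) i (mcoord i x)) ->
  spans g x.
Proof.
move=> sg xi H j xj u; have o := overlap_coord xi xj.
have [a Ha] := H (jac j i (trans i j (mcoord i x)) u); exists a.
rewrite -(jacVK u o) Ha -(trans_coord j xi).
elim/big_rec2: _ => [|k z z' _ IH]; first exact: jac0.
by rewrite (jac_lin _ _ _ o) IH grad_jac.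
Qed.

(** Choose differentials equal to the standard basis at [x0]: the determinant [\det (D y)] is [1]
    there, and stays nonzero nearby by continuity. *)
Lemma spans_near x0 : exists2 g : 'I_n -> M -> R, (forall k, smooth_fun (g k)) &
  \forall x \near x0, spans g x.
Proof.
set i := mchart x0; have xi := mchartP x0; rewrite -/i in xi.
have /choice[g Hg] : forall k : 'I_n, exists g, [/\ smooth_fun g, g x0 = 0 &
    forall q, pd q (g \o mparam i) (mcoord i x0) = (k == q)%:R].
  by move=> k; exact: (fun_with_differential (fun q => (k == q)%:R) xi).
exists g; first by move=> k; have [] := Hg k.
have sg k : smooth_fun (g k) by have [] := Hg k.
pose D y : 'M[R]_n := \matrix_(k, q) pd q (g k \o mparam i) y.
have cD : salg (cod i) (fun y => \det (D y)).
  apply: salg_det => k q; rewrite (_ : (fun z => _) = (fun z => pd q (g k \o mparam i) z)).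
    by apply: salg_base; exact: smooth_derive (sg k i).
  by apply/funext => z; rewrite mxE.
have yi := mcoord_cod xi.
have D0 : \det (D (mcoord i x0)) = 1.
  rewrite (_ : D _ = 1%:M) ?det1 //; apply/matrixP => k q; rewrite !mxE.
  by have [_ _ ->] := Hg k.
have /cvgrPdist_lt /(_ 1 ltr01) near1 := smooth_continuous (salg_smooth (cod_open i) cD) yi.
have n2 : \forall x \near x0, `|\det (D (mcoord i x0)) - \det (D (mcoord i x))| < 1.
  exact: (mcoord_near xi (near1 : nbhs _ [set z | `|\det (D (mcoord i x0)) - \det (D z)| <
    1])).
have n1 := near_open (@mdom_open _ _ M i) xi.
apply: filterS2 n1 n2 => x xxi Hx; apply: (spans_chart sg xxi) => u.
have Du : D (mcoord i x) \in unitmx.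
  rewrite unitmxE unitfE; apply/eqP => E; move: Hx; rewrite D0 E subr0 normr1 ltxx //.
have yxi := mcoord_cod xxi.
(* The combination of the gradients with coefficients [b] is [b *m D *m invmx (mmet i _)], by the
   equation [E]; solve for [b]. *)
pose b : V := u *m mmet i (mcoord i x) *m invmx (D (mcoord i x)).
exists (fun k => b 0 k).
have E : \sum_k b 0 k *: grad (g k) i (mcoord i x) =
    b *m D (mcoord i x) *m invmx (mmet i (mcoord i x)).
  apply/rowP => q; rewrite summxE -mulmxA mxE; apply: eq_bigr => k _.
  rewrite mxE gradE !mxE; congr (_ * _).
  by apply: eq_bigr => p _; rewrite mxE.
by rewrite E /b mulmxKV // mulmxK // met_unit.
Qed.

(** Going through the list from its end, a function is kept, at the last index, only if it is not a
    combination of those already kept. Independence is needed in [label_space]. *)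
Lemma independent_basis (s : seq (M -> R)) :
  (forall h, List.In h s -> smooth_fun h) -> exists m (f : 'I_m -> M -> R),
  [/\ forall j : 'I_m, smooth_fun (f j),
    forall a : 'I_m -> R, (forall x, \sum_(j < m) a j * f j x = 0) -> forall j : 'I_m, a j
      = 0 &
    forall h, List.In h s -> exists a : 'I_m -> R, forall x, h x = \sum_(j < m) a j * f j x].
Proof.
elim: s => [|h s IH] hs.
  exists 0%N, (fun (j : 'I_0) => fun=> 0); split=> //; first by case.
  by move=> a _ [].
have [m [f [sf fI fs]]] := IH (fun g gs => hs g (or_intror gs)).
have [[a Ha]|nh] := pselect (exists a : 'I_m -> R, forall x, h x = \sum_(j < m) a j * f j x).
  by exists m, f; split=> // g [<-|gs]; [exists a|exact: fs].
pose f' (j : 'I_m.+1) : M -> R := if unlift ord_max j is Some j' then f j' else h.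
have f'l (j : 'I_m) : f' (widen_ord (leqnSn m) j) = f j.
  rewrite /f' (_ : widen_ord _ j = lift ord_max j) ?liftK //.
  by apply/val_inj; rewrite /= /fintype.bump leqNgt ltn_ord add0n.
have f'm : f' ord_max = h by rewrite /f' unlift_none.
exists m.+1, f'; split.
- move=> j; rewrite /f'; case: unliftP => [j' _|_]; first exact: sf.
  by apply: hs; left.
- move=> a Ha.
  have Ha' x : \sum_(j < m) a (widen_ord (leqnSn m) j) * f j x + a ord_max * h x = 0.
    rewrite -[RHS](Ha x) big_ord_recr /= f'm; congr (_ + _).
    by apply: eq_bigr => j _; rewrite f'l.
  have am : a ord_max = 0.
    apply: contrapT => /eqP am; apply: nh.
    exists (fun j : 'I_m => - (a ord_max)^-1 * a (widen_ord (leqnSn m) j)) => x.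
    apply: (mulfI am); rewrite mulr_sumr.
    have := Ha' x => /eqP; rewrite addrC addr_eq0 => /eqP ->; rewrite -sumrN.
    by apply: eq_bigr => j _; field.
  have aj (j : 'I_m) : a (widen_ord (leqnSn m) j) = 0.
    apply: (fI (fun j : 'I_m => a (widen_ord (leqnSn m) j))) => x.
    by have := Ha' x; rewrite am mul0r addr0.
  move=> j; have [->//|jm] := eqVneq j ord_max.
  have jl : (j < m)%N by have := ltn_ord j; rewrite ltnS leq_eqVlt => /orP[/eqP E|//];
    case/eqP: jm; apply/val_inj.
  by rewrite (_ : j = widen_ord (leqnSn m) (Ordinal jl)) ?aj //; exact/val_inj.
- have ext (g : M -> R) (a : 'I_m -> R) (b : R) : (forall x, g x = \sum_(j < m) a j * f j x
  + b * h x) ->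
      exists a' : 'I_m.+1 -> R, forall x, g x = \sum_(j < m.+1) a' j * f' j x.
    move=> Hg; exists (fun j : 'I_m.+1 => if unlift ord_max j is Some j' then a j' else b)
      => x.
    rewrite Hg big_ord_recr /= f'm unlift_none; congr (_ + _).
    apply: eq_bigr => j _; rewrite f'l (_ : widen_ord _ j = lift ord_max j) ?liftK //.
    by apply/val_inj; rewrite /= /fintype.bump leqNgt ltn_ord add0n.
  move=> g [<-|gs].
    apply: (ext h (fun=> 0) 1) => x; rewrite mul1r big1 ?add0r // => j _.
    by rewrite mul0r.
  have [a Ha] := fs g gs.
  by apply: (ext g a 0) => x; rewrite mul0r addr0.
Qed.

(** Compactness collects finitely many of the local families of [spans_near]; they are joined to
    [s], and extracting a basis loses neither the functions of [s] nor the span of the gradients. *)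
Lemma label_space_exists (s : seq (M -> R)) :
  (forall h, List.In h s -> smooth_fun h) -> exists m (f : 'I_m -> M -> R),
  [/\ forall j : 'I_m, smooth_fun (f j),
    forall a : 'I_m -> R, (forall x, \sum_(j < m) a j * f j x = 0) -> forall j : 'I_m, a j = 0,
    forall x i (u : V), mdom i x ->
      exists a : 'I_m -> R, u = \sum_(j < m) a j *: grad (f j) i (mcoord i x) &
    forall h, List.In h s -> exists a : 'I_m -> R, forall x, h x = \sum_(j < m) a j * f j x].
Proof.
move=> hs.
pose Q (A : set M) := exists2 r : seq (M -> R), (forall h, List.In h r -> smooth_fun h) &
  forall x, A x -> exists g : 'I_n -> M -> R, (forall k, List.In (g k) r) /\ spans g x.
have [r hr Hr] : Q setT.
  apply: compact_ind; first exact: mcompact.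
  - by exists [::].
  - by move=> A B AB [r hr Hr]; exists r => // x /AB; exact: Hr.
  - move=> A B [r1 h1 H1] [r2 h2 H2]; exists (r1 ++ r2).
      by move=> h /(@List.in_app_or _ r1 r2)[]; [exact: h1|exact: h2].
    move=> x [/H1|/H2] [g [gr gx]]; exists g; split=> // k;
      apply: (@List.in_or_app _ r1 r2); [left|right]; exact: gr.
  - move=> p; have [g sg Hg] := spans_near p.
    exists [set x | spans g x] => //.
    exists [seq g k | k <- enum 'I_n].
      by move=> h; elim: (enum _) => [|k e IH] //= [<-|].
    move=> x gx; exists g; split=> // k.
    have : k \in enum 'I_n by rewrite mem_enum.
    elim: (enum _) => [//|q e IH] /=; rewrite in_cons => /orP[/eqP ->|/IH]; by [left|right].
have [m [f [sf fI fs]]] := independent_basis (s := r ++ s)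
  (fun h hin => match List.in_app_or r s h hin with or_introl a => hr h a | or_intror b =>
    hs h b end).
exists m, f; split=> //; last first.
  by move=> h hin; apply: fs; apply: (@List.in_or_app _ r s); right.
move=> x i u xi; have [g [gr gx]] := Hr x I.
have [a ->] := gx i xi u.
have /choice[b Hb] : forall k, exists b : 'I_m -> R, forall x, g k x = \sum_(j < m) b j * f
  j x.
  by move=> k; apply: fs; apply: (@List.in_or_app _ r s); left.
exists (fun j : 'I_m => \sum_k a k * b k j).
have yi := mcoord_cod xi.
transitivity (\sum_k \sum_(j < m) (a k * b k j) *: grad (f j) i (mcoord i x)).
  apply: eq_bigr => k _.
  rewrite (_ : g k = fun z => \sum_j b k j * f j z); last by apply/funext => z; exact: Hb.
  by rewrite grad_sum // scaler_sumr; apply: eq_bigr => j _; rewrite scalerA.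
by rewrite exchange_big /=; apply: eq_bigr => j _; rewrite scaler_suml.
Qed.

End Bumps.

(** * Uniform estimates *)

Local Opaque derive.

Section UniformVariation.
Context (R : realType) (n : nat).
Local Notation V := 'rV[R]_n.

Lemma cvg0_le (F : R -> \bar R) (C : R) : 0 <= C -> (forall h, (0 <= F h)%E) ->
  (forall e : R, 0 < e -> exists2 d : R, 0 < d &
    forall h, h != 0 -> `|h| < d -> (F h <= (e * C)%:E)%E) ->
  F h @[h --> 0^'] --> 0%E.
Proof.
move=> C0 F0 H.
have fin h (e : R) : (F h <= e%:E)%E -> F h \is a fin_num.
  by move=> he; rewrite ge0_fin_numE //; exact: le_lt_trans he (ltry _).
apply/fine_cvgP; split.
  have [d d0 Hd] := H 1 ltr01.
  near=> h; apply: (fin _ (1 * C)); apply: Hd.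
    by near: h; exact: nbhs_dnbhs_neq.
  by near: h; exact: dnbhs0_lt.
apply/cvgrPdist_le => e e0.
have C1 : 0 < C + 1 by lra.
have e1 : 0 < e / (C + 1) by rewrite divr_gt0.
have [d d0 Hd] := H _ e1.
near=> h.
have hd : (F h <= (e / (C + 1) * C)%:E)%E.
  apply: Hd; first by near: h; exact: nbhs_dnbhs_neq.
  by near: h; exact: dnbhs0_lt.
have Fh := fin _ _ hd.
rewrite sub0r normrN /= ger0_norm ?fine_ge0 //.
rewrite -lee_fin fineK //; apply: le_trans hd _; rewrite lee_fin.
rewrite mulrAC ler_pdivrMr //; apply: ler_wpM2l; lra.
Unshelve. all: by end_near. Qed.

Lemma fin_min (I : finType) (d : I -> R) : (forall i, 0 < d i) ->
  exists2 e : R, 0 < e & forall i, e <= d i.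
Proof.
move=> d0; pose N := 1 + \sum_i (d i)^-1.
have N0 : 0 < N by rewrite ltr_pwDl // sumr_ge0 // => i _; rewrite invr_ge0 ltW.
exists N^-1 => [|i]; first by rewrite invr_gt0.
rewrite -[leRHS]invrK lef_pV2 ?posrE ?invr_gt0 //.
rewrite /N (bigD1 i) //= addrCA lerDl addr_ge0 // sumr_ge0 // => j _.
by rewrite invr_ge0 ltW.
Qed.

Lemma cts_norm1 a b (x : R -> V) : (forall k, cts a b (fun t => x t 0 k)) ->
  exists2 B : R, 0 < B & forall t, a <= t <= b -> forall k, `|x t 0 k| <= B.
Proof.
move=> xc; have [B B0 HB] := cts_bounded (cts_sum (index_enum _) (fun k => cts_norm (xc k))).
exists B => // t tab k; apply: le_trans (le_trans (ler_norm _) (HB t tab)).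
by rewrite (bigD1 k) //= lerDl; exact: sumr_ge0.
Qed.

Lemma cts_near a b (x : R -> V) t0 (d : R) : (forall k, cts a b (fun t => x t 0 k)) ->
  a <= t0 <= b -> 0 < d -> exists2 e : R, 0 < e &
  forall t, a <= t <= b -> `|t - t0| < e -> box (x t0) d (x t).
Proof.
move=> xc t0ab d0.
have Nc : cts a b (fun t => \sum_k `|x t 0 k - x t0 0 k|).
  by apply: cts_sum => k; apply: cts_norm; apply: ctsB => //; exact: cts_cst.
have [e e0 He] := Nc t0 t0ab d d0; exists e => // t tab te k.
have := He t tab te.
rewrite (_ : \sum_k `|x t0 0 k - x t0 0 k| = 0) ?subr0; last first.
  by rewrite big1 // => q _; rewrite subrr normr0.
apply: le_lt_trans; apply: le_trans (ler_norm _).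
by rewrite (bigD1 k) //= lerDl; exact: sumr_ge0.
Qed.

(** Near a time [t0] this is strict differentiability of [G] at [y t0], applied to [y t] and
    [y t + h *: s t]; [itv_ind] makes the admissible size of [h] uniform in [t]. *)
Lemma uniform_variation (O : set V) (G : V -> R) a b (y s : R -> V) : a <= b ->
  open O -> smooth_on O G -> (forall k, cts a b (fun t => y t 0 k)) ->
  (forall k, cts a b (fun t => s t 0 k)) -> (forall t, a <= t <= b -> O (y t)) ->
  forall e : R, 0 < e -> exists2 d : R, 0 < d & forall h, `|h| < d ->
  forall t, a <= t <= b -> [/\ O (y t + h *: s t),
    `|G (y t + h *: s t) - G (y t)| <= e &
    `|G (y t + h *: s t) - G (y t) - h * 'D_(s t) G (y t)| <= e * `|h|].
Proof.
move=> ab oO sG yc sc yO e e0.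
pose P a' b' := exists2 d : R, 0 < d & forall h, `|h| < d ->
  forall t, a' <= t <= b' -> [/\ O (y t + h *: s t),
    `|G (y t + h *: s t) - G (y t)| <= e &
    `|G (y t + h *: s t) - G (y t) - h * 'D_(s t) G (y t)| <= e * `|h|].
change (P a b); apply: itv_ind => //.
  move=> a1 b1 c1 _ ab1 bc1 _ [d1 d10 H1] [d2 d20 H2].
  exists (Num.min d1 d2); first by rewrite lt_min d10.
  move=> h; rewrite lt_min => /andP[h1 h2] t /andP[at' tc].
  have [tb|bt] := leP t b1; first by apply: H1; rewrite ?at'.
  by apply: H2; rewrite ?tc ?ltW.
move=> t0 t0ab; have y0 := yO t0 t0ab.
have [B B0 HB] := cts_norm1 sc.
(* The displacement has total size at most [|h| * (n%:R * B)]. It is charged twice: for strictness,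
   and for moving the partial derivatives from [y t0] to [y t]. *)
pose eta := e / (2 * (n%:R * B + 1)).
have nB : 0 < n%:R * B + 1 by rewrite ltr_wpDl // mulr_ge0 // ltW.
have eta0 : 0 < eta by rewrite divr_gt0 // mulr_gt0.
have /nbhs_box[r1 r10 H1] : nbhs (y t0) O by exact: open_nbhs_nbhs.
have [r2 r20 H2] := smooth_strict oO sG y0 eta0.
have e2 : 0 < e / 2 by lra.
have [r3 r30 H3] := cts_box (smooth_continuous sG y0) e2.
have [r4 r40 H4] := box_all (P := fun k => [set z | `|pd k G z - pd k G (y t0)| < eta])
  (fun k => cts_box (smooth_continuous (smooth_derive _ sG) y0) eta0).
pose r := Num.min (Num.min r1 r2) (Num.min r3 r4).
have r0 : 0 < r by rewrite !lt_min r10 r20 r30.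
have rr1 : r <= r1 by rewrite !ge_min lexx.
have rr2 : r <= r2 by rewrite !ge_min lexx !orbT.
have rr3 : r <= r3 by rewrite !ge_min lexx !orbT.
have rr4 : r <= r4 by rewrite !ge_min lexx !orbT.
have rh : 0 < r / 2 by lra.
have [d d0 Hd] := cts_near yc t0ab rh.
exists d => // a' b' aa ab' bb ta tb.
exists (r / (2 * B)); first by rewrite divr_gt0 // mulr_gt0.
move=> h hr t tab.
have tab0 : a <= t <= b by exact: sub_itv tab.
have yt := Hd t tab0 (near_itv (lexx d) ta tb tab).
have hs k : `|h * s t 0 k| < r / 2.
  rewrite normrM; apply: (@le_lt_trans _ _ (`|h| * B)); first by apply: ler_wpM2l => //;
    exact: HB.
  by move: hr; rewrite ltr_pdivlMr ?mulr_gt0 // => hr; lra.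
have b1 : box (y t0) r (y t).
  by apply: box_sub yt; lra.
have b2 : box (y t0) r (y t + h *: s t).
  move=> k; rewrite !mxE addrAC; apply: le_lt_trans (ler_normD _ _) _.
  have := yt k; have := hs k; lra.
have O2 := H1 _ (box_sub rr1 b2).
have Ot := yO t tab0.
split=> //.
  have := H3 _ (box_sub rr3 b2); have := H3 _ (box_sub rr3 b1).
  rewrite -[`|G (y t) - _|]normrN => g1 g2.
  have -> : G (y t + h *: s t) - G (y t) = (G (y t + h *: s t) - G (y t0)) + - (G (y t) - G
    (y t0)) by ring.
  by apply: le_trans (ler_normD _ _) _; lra.
have K1 := H2 _ _ (box_sub rr2 b2) (box_sub rr2 b1).
rewrite (derive_dir _ oO sG Ot).
have dE k : (y t + h *: s t) 0 k - y t 0 k = h * s t 0 k by rewrite !mxE; ring.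
have E1 : \sum_k `|(y t + h *: s t) 0 k - y t 0 k| <= `|h| * (n%:R * B).
  apply: (@le_trans _ _ (\sum_(k < n) `|h| * B)).
    apply: ler_sum => k _; rewrite dE normrM; apply: ler_wpM2l => //; exact: HB.
  by rewrite sumr_const card_ord -[leLHS]mulr_natl [leLHS]mulrCA.
have E2 : `|\sum_k pd k G (y t0) * ((y t + h *: s t) 0 k - y t 0 k) - h * \sum_k s t 0 k *
  pd k G (y t)| <=
    eta * (`|h| * (n%:R * B)).
  rewrite mulr_sumr -sumrB; apply: le_trans (ler_norm_sum _ _ _) _.
  apply: (@le_trans _ _ (\sum_(k < n) eta * (`|h| * B))).
    apply: ler_sum => k _; rewrite dE.
    have -> : pd k G (y t0) * (h * s t 0 k) - h * (s t 0 k * pd k G (y t)) =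
      - (pd k G (y t) - pd k G (y t0)) * (h * s t 0 k) by ring.
    rewrite normrM normrN; apply: ler_pM => //.
      exact: ltW (H4 k _ (box_sub rr4 b1)).
    by rewrite normrM; apply: ler_wpM2l => //; exact: HB.
  by rewrite sumr_const card_ord -mulr_natl; set T := eta; rewrite le_eqVlt; apply/orP;
    left; apply/eqP; ring.
set X := \sum_k pd k G (y t0) * _ in K1 E2.
set Y := h * \sum_k _ in E2 *.
set Z := G _ - G _ in K1 *.
have -> : Z - Y = (Z - X) + (X - Y) by ring.
apply: le_trans (ler_normD _ _) _.
apply: (@le_trans _ _ (eta * (`|h| * (n%:R * B)) + eta * (`|h| * (n%:R * B)))).
  by apply: lerD => //; apply: le_trans K1 _; apply: ler_wpM2l => //; exact: ltW.
have -> : eta * (`|h| * (n%:R * B)) + eta * (`|h| * (n%:R * B)) = eta * (2 * (n%:R * B)) *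
  `|h| by ring.
apply: ler_wpM2r => //.
rewrite /eta mulrAC ler_pdivrMr ?mulr_gt0 //; apply: ler_wpM2l; [exact: ltW|lra].
Qed.

End UniformVariation.

(** * The linearized flow along an edge *)

Local Opaque derive.

Lemma negE (R : realType) n (A : 'rV[R]_n) k : (- A) 0 k = - A 0 k.
Proof. by rewrite mxE. Qed.

Lemma linE (R : realType) n (a : R) (A B : 'rV[R]_n) k :
  (a *: A + B) 0 k = a * A 0 k + B 0 k.
Proof. by rewrite !mxE. Qed.

Lemma addE (R : realType) n (A B : 'rV[R]_n) k : (A + B) 0 k = A 0 k + B 0 k.
Proof. by rewrite mxE. Qed.

Section MoreGeometry.
Context (R : realType) (n : nat) (M : closed_riemannian R n).
Local Notation V := 'rV[R]_n.
Local Notation e_ k := (delta_mx 0 k : V).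
Implicit Types (i j : mindex M) (x : M) (y u v w s : V).

Lemma christoffelE i y u w (k : 'I_n) : christoffel i y u w 0 k =
  \sum_l 2^-1 * (dmet i y u w (e_ l) + dmet i y w u (e_ l) - dmet i y (e_ l) u w)
    * invmx (mmet i y) l k.
Proof. by rewrite mxE; apply: eq_bigr => l _; rewrite mxE. Qed.

Local Opaque met jac hess dmet christoffel.

Lemma dmet_smooth i a u w : smooth_on (cod i) (fun y => dmet i y a u w).
Proof. exact: smooth_derive (met_smooth i u w). Qed.

Lemma christoffel_smooth i u w (k : 'I_n) :
  smooth_on (cod i) (fun y => christoffel i y u w 0 k).
Proof.
apply: (smooth_ext (F := fun y => \sum_l 2^-1 *
  (dmet i y u w (e_ l) + dmet i y w u (e_ l) + (-1) * dmet i y (e_ l) u w)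
    * invmx (mmet i y) l k)); first exact: cod_open.
  by move=> y _; rewrite christoffelE; apply: eq_bigr => l _; rewrite mulN1r.
apply: salg_smooth; first exact: cod_open.
apply: salg_sum => l; apply: salg_mul; last exact/salg_base/invmx_smooth.
apply: salg_mul; first exact: salg_cst.
apply: salg_add; first by apply: salg_add; apply/salg_base/dmet_smooth.
apply: salg_mul; [exact: salg_cst|exact/salg_base/dmet_smooth].
Qed.

Lemma vlin_sum (F : V -> V) w : (forall (a : R) u w, F (a *: u + w) = a *: F u + F w) ->
  F w = \sum_l w 0 l *: F (e_ l).
Proof.
move=> HF; have F0 : F 0 = 0.
  by have := HF (-1) 0 0; rewrite scaler0 add0r scaleN1r addNr.
rewrite {1}(row_sum w); elim/big_rec2: _ => [//|l a b _ <-].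
by rewrite HF.
Qed.

Lemma christoffel_sum i y u w (k : 'I_n) : cod i y -> christoffel i y u w 0 k =
  \sum_p \sum_q u 0 p * w 0 q * christoffel i y (e_ p) (e_ q) 0 k.
Proof.
move=> yi.
rewrite (@vlin_sum (fun u => christoffel i y u w)); last first.
  by move=> a u' u''; exact: christoffel_linl.
rewrite summxE; apply: eq_bigr => p _; rewrite mxE.
rewrite (@vlin_sum (fun w => christoffel i y (e_ p) w) w); last first.
  by move=> a u' u''; exact: christoffel_linr.
rewrite summxE mulr_sumr; apply: eq_bigr => q _.
by rewrite mxE mulrA.
Qed.

Lemma metZ i y (a : R) u w : met i y (a *: u) w = a * met i y u w.
Proof.
have := met_linl i y a u 0 w; rewrite addr0 => ->.
have := met_linl i y (-1) 0 0 w; rewrite scaler0 addr0 => h.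
by rewrite (_ : met i y 0 w = 0) ?addr0 //; lra.
Qed.

Lemma met_parallelogram i y (a : R) u w : cod i y ->
  met i y (a *: u + w) (a *: u + w) <= 2 * a ^+ 2 * met i y u u + 2 * met i y w w.
Proof.
move=> yi; have h := met_ge0 ((-1) *: w + a *: u) yi.
have E1 : met i y (a *: u + w) (a *: u + w) =
  a * (a * met i y u u + met i y u w) + (a * met i y u w + met i y w w).
  by rewrite met_linl !(met_linr _ _ _ _ yi) (met_sym w u yi).
have E2 : met i y ((-1) *: w + a *: u) ((-1) *: w + a *: u) =
  -1 * (-1 * met i y w w + a * met i y u w) + (-1 * (a * met i y u w) + a * (a * met i y u u)).
  rewrite met_linl !(met_linr _ _ _ _ yi) !metZ (met_sym w (a *: u) yi) metZ.
  by rewrite (met_sym u (a *: u) yi) metZ.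
move: h E1 E2 => + -> E2; rewrite E2 expr2; nra.
Qed.

Lemma met_cauchy i y u w : cod i y ->
  met i y u w ^+ 2 <= met i y u u * met i y w w.
Proof.
move=> yi; have [->|w0] := eqVneq w 0.
  by rewrite met_sym // -(scale0r u) !metZ !mul0r expr0n /= mulr0.
have wp := met_pos yi w0.
pose a := - met i y u w / met i y w w.
have := met_ge0 (a *: w + u) yi.
rewrite met_linl !(met_linr _ _ _ _ yi) (met_sym w u yi).
rewrite (_ : a * _ + _ = met i y u u - met i y u w ^+ 2 / met i y w w); last first.
  by rewrite /a; field; exact: lt0r_neq0.
by rewrite subr_ge0 ler_pdivrMr.
Qed.

(** The [k]-th coordinate is the inner product with [e_ k *m invmx (mmet i y)], whose squared norm
    is the diagonal entry on the right; then apply Cauchy-Schwarz. *)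
Lemma met_coord i y u (k : 'I_n) : cod i y ->
  u 0 k ^+ 2 <= invmx (mmet i y) k k * met i y u u.
Proof.
move=> yi; pose w := e_ k *m invmx (mmet i y).
have E (z : V) : met i y w z = z 0 k.
  rewrite /w met_invmx // (bigD1 k) //= mxE !eqxx mul1r big1 ?addr0 // => l lk.
  by rewrite mxE eqxx /= (negbTE lk) mul0r.
have := met_cauchy u w yi; rewrite (met_sym u w yi) !E mulrC.
by rewrite /w -rowE mxE.
Qed.

Lemma met_upper i y u : met i y u u <=
  (\sum_k \sum_l `|mmet i y k l|) * (\sum_k `|u 0 k|) ^+ 2.
Proof.
rewrite metE mulr_suml; apply: ler_sum => k _; rewrite mulr_suml.
apply: ler_sum => l _; apply: le_trans (ler_norm _) _; rewrite !normrM mulrC.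
apply: ler_wpM2l => //; rewrite expr2; apply: ler_pM => //.
  by rewrite (bigD1 k) //= lerDl sumr_ge0.
by rewrite (bigD1 l) //= lerDl sumr_ge0.
Qed.

End MoreGeometry.

Section CtsCat.
Context (R : realType).

Lemma cts_cat (a b c : R) x : a <= b -> b <= c -> cts a b x -> cts b c x ->
  cts a c x.
Proof.
move=> ab bc xc1 xc2 t /andP[at' tc] e e0.
have [tb|bt|tb] := ltgtP t b.
- have [d d0 H] := xc1 t ltac:(by rewrite at' ltW) e e0.
  exists (Num.min d (b - t)); first by rewrite lt_min d0 subr_gt0.
  move=> u /andP[au uc]; rewrite lt_min => /andP[ud ub]; apply: H => //.
  rewrite au; have := ler_norm (u - t); lra.
- have [d d0 H] := xc2 t ltac:(by rewrite tc ltW) e e0.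
  exists (Num.min d (t - b)); first by rewrite lt_min d0 subr_gt0.
  move=> u /andP[au uc]; rewrite lt_min => /andP[ud ub]; apply: H => //.
  rewrite uc andbT; have := ler_norm (- (u - t)); rewrite normrN; lra.
- have [d d0 H] := xc1 t ltac:(by rewrite at' tb lexx) e e0.
  have [d' d'0 H'] := xc2 t ltac:(by rewrite tc tb lexx) e e0.
  exists (Num.min d d'); first by rewrite lt_min d0.
  move=> u /andP[au uc]; rewrite lt_min => /andP[ud ud'].
  have [ub|bu] := leP u b; first by apply: H; rewrite ?au.
  by apply: H'; rewrite ?uc ?ltW.
Qed.

End CtsCat.

(** * Sections along a gradient curve *)

Section Curve.
Context (R : realType) (n : nat) (M : closed_riemannian R n).
Local Notation V := 'rV[R]_n.
Local Notation e_ k := (delta_mx 0 k : V).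
Local Notation mu := (@lebesgue_measure R).
Local Notation tuplevec := (mindex M -> V).
Context (l : R) (c : R -> M) (v : R -> tuplevec) (f : M -> R).
Context (l0 : 0 <= l) (cW : W12_curve l c v) (sf : smooth_fun f).
Context (cZ : {ae mu, forall t, 0 <= t <= l -> eq_tangent (c t)
  (fun i => v t i + grad f i (mcoord i (c t))) (fun=> 0)}).
Local Notation y i t := (mcoord i (c t)).
Implicit Types (i j : mindex M) (X : R -> tuplevec) (k : 'I_n) (a b t : R).

Local Opaque met jac hess dmet christoffel grad dgrad.

Lemma chart_near t i : 0 <= t <= l -> mdom i (c t) ->
  exists2 e : R, 0 < e & forall t', 0 <= t' <= l -> `|t' - t| < e -> mdom i (c t').
Proof.
move=> tl ti; have [cc _ _] := cW.
have {}cc : c @ within `[0, l] (nbhs t) --> c t.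
  by move/subspace_continuousP: cc; apply; rewrite /= in_itv.
have /cc : nbhs (c t) (mdom i).
  by apply: near_open ti; exact: mdom_open.
rewrite /= /within /= => /nbhs_ballP[e /= e0 H]; exists e => // t' t'l tt'.
by apply: H; rewrite /ball /= ?in_itv //= distrC.
Qed.

Lemma chart_itv t i : 0 <= t <= l -> mdom i (c t) ->
  exists2 e : R, 0 < e & forall a b, 0 <= a -> a <= b -> b <= l ->
    t - e < a -> b < t + e -> in_chart l c i a b.
Proof.
move=> tl ti; have [e e0 H] := chart_near tl ti; exists e => // a b a0 ab bl ta bt.
split=> // s sab; apply: H; first exact: sub_itv sab.
exact: near_itv ta bt sab.
Qed.

Lemma curve_ind (P : R -> R -> Prop) A B : 0 <= A -> A <= B -> B <= l ->
  (forall a b d, A <= a -> a <= b -> b <= d -> d <= B -> P a b -> P b d -> P a d) ->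
  (forall t i, A <= t <= B -> mdom i (c t) -> exists2 e : R, 0 < e &
     forall a b, A <= a -> a <= b -> b <= B -> t - e < a -> b < t + e ->
     in_chart l c i a b -> P a b) ->
  P A B.
Proof.
move=> A0 AB Bl Pcat Ploc; apply: itv_ind => // t tAB.
have tl : 0 <= t <= l by exact: sub_itv tAB.
have ti := mchartP (c t).
have [e e0 H] := Ploc t _ tAB ti; have [e' e'0 H'] := chart_itv tl ti.
exists (Num.min e e'); first by rewrite lt_min e0.
move=> a b Aa ab bB ta bt.
have m1 : Num.min e e' <= e by rewrite ge_min lexx.
have m2 : Num.min e e' <= e' by rewrite ge_min lexx orbT.
by apply: H => //; [lra|lra|apply: H' => //; [exact: le_trans Aa|exact: le_trans Bl|lra|lra]].
Qed.

Lemma in_chart_sub i a b a' b' : in_chart l c i a b -> a <= a' -> a' <= b' ->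
  b' <= b -> in_chart l c i a' b'.
Proof.
move=> [a0 ab bl H] aa ab' bb; split=> //; [exact: le_trans aa|exact: le_trans bl|].
by move=> t tt; apply: H; exact: sub_itv tt.
Qed.

Lemma in_chart_cod i a b t : in_chart l c i a b -> a <= t <= b -> cod i (y i t).
Proof. by move=> [_ _ _ H] tab; apply: mcoord_cod; exact: H. Qed.

Lemma in_chart_l i a b t : in_chart l c i a b -> a <= t <= b -> 0 <= t <= l.
Proof. by move=> [a0 _ bl _] tab; exact: sub_itv tab. Qed.

Lemma y_prim0 i a b k : in_chart l c i a b ->
  prim a b (fun t => y i t 0 k) (fun t => v t i 0 k).
Proof. by move=> ab; have [_ _ /(_ i a b ab k)] := cW. Qed.

Lemma y_cts i a b k : in_chart l c i a b -> cts a b (fun t => y i t 0 k).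
Proof. by move=> /(y_prim0 k)/prim_cts. Qed.

Lemma smooth_cts i a b (F : V -> R) : in_chart l c i a b -> smooth_on (cod i) F ->
  cts a b (fun t => F (y i t)).
Proof.
move=> ab sF; apply: cts_comp => [k|t tab]; first exact: y_cts ab.
exact: smooth_continuous sF (in_chart_cod ab tab).
Qed.

Lemma grad_cts g i a b k : smooth_fun g -> in_chart l c i a b ->
  cts a b (fun t => grad g i (y i t) 0 k).
Proof. by move=> sg ab; exact: smooth_cts ab (grad_smooth k sg). Qed.

Lemma velocity_ae : {ae mu, forall t, 0 <= t <= l -> forall i, mdom i (c t) ->
  v t i = - grad f i (y i t)}.
Proof.
apply: (ae_imp cZ) => t H tl i ti; have /(_ i ti) := H tl.
by move/eqP; rewrite addr_eq0 => /eqP.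
Qed.

(** At a zero of [Phi] the square integrable velocity can be replaced by a continuous
    representative; the pointwise arguments along [c] rest on this. *)
Lemma y_prim i a b k : in_chart l c i a b ->
  prim a b (fun t => y i t 0 k) (fun t => - grad f i (y i t) 0 k).
Proof.
move=> ab; apply: (prim_ext (y_prim0 k ab)) => //.
  by apply/cts_intg/ctsN; exact: grad_cts.
apply: (ae_imp velocity_ae) => t H tab.
have [_ _ _ Hd] := ab.
by rewrite (H (in_chart_l ab tab) i (Hd t tab)) negE.
Qed.

Lemma fun_prim i a b (O : set V) (g : V -> R) : in_chart l c i a b -> open O ->
  smooth_on O g -> (forall t, a <= t <= b -> O (y i t)) ->
  prim a b (fun t => g (y i t)) (fun t => - 'D_(grad f i (y i t)) g (y i t)).
Proof.
move=> ab oO sg yO.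
have p : forall k, prim a b (fun t => (y i t) 0 k) (fun t => (- grad f i (y i t)) 0 k).
  by move=> k; apply: (prim_eq (y_prim k ab)) => // t _; rewrite negE.
apply: (prim_eq (prim_comp p oO sg yO)) => // t tab.
rewrite (derive_dir _ oO sg (yO t tab)) -sumrN; apply: eq_bigr => k _.
by rewrite negE mulrN mulrC.
Qed.

Definition inn X t : R := inner (c t) (X t) (X t).

Lemma inn_chart X t i : is_tangent (c t) (X t) -> mdom i (c t) ->
  inn X t = met i (y i t) (X t i) (X t i).
Proof.
move=> tX ti; rewrite /inn /inner; have tm := mchartP (c t).
have o := overlap_coord tm ti.
rewrite (tangent_push tX tm ti) -(trans_coord i tm).
exact: esym (met_jac _ _ o).
Qed.

Lemma inn_ge0 X t : 0 <= inn X t.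
Proof. exact: met_ge0 (mcoord_cod (mchartP (c t))). Qed.

Definition dom_times i : set R := [set t | 0 <= t <= l /\ mdom i (c t)].

(** The times spent in a chart form the trace on [[0, l]] of the open set [U]. *)
Lemma dom_times_meas i : measurable (dom_times i).
Proof.
pose U := [set t | exists2 e : R, 0 < e & forall t', 0 <= t' <= l -> `|t' - t| < e ->
  mdom i (c t')].
have oU : open U.
  rewrite openE => t [e e0 H]; apply/nbhs_ballP; exists (e / 2) => /=; first by lra.
  move=> s; rewrite /ball /= => st; exists (e / 2); first by lra.
  move=> t' t'l t's; apply: H => //.
  rewrite (_ : t' - t = (t' - s) - (t - s)); last by ring.
  apply: le_lt_trans (ler_normB _ _) _; lra.
have -> : dom_times i = `[0, l] `&` U.
  apply/seteqP; split=> [t [tl ti]|t []] /=; rewrite in_itv /=.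
    by split=> //; exact: chart_near.
  by move=> tl [e e0 H]; split => //; apply: H; rewrite ?subrr ?normr0.
by apply: measurableI => //; exact: open_measurable.
Qed.

Definition L2pre X : Prop :=
  (forall t, 0 <= t <= l -> is_tangent (c t) (X t)) /\
  (forall i k, measurable_fun (dom_times i) (fun t => X t i 0 k)).

Lemma comp_meas X i a b k : L2pre X -> in_chart l c i a b ->
  measurable_fun (`[a, b] : set R) (fun t => X t i 0 k).
Proof.
move=> [_ mX] ab; apply: measurable_funS (mX i k); first exact: dom_times_meas.
move=> t /=; rewrite in_itv /= => tab; split; first exact: in_chart_l ab tab.
by have [_ _ _ H] := ab; exact: H.
Qed.

Lemma meas_cat a b d (x : R -> R) : a <= b -> b <= d ->
  measurable_fun (`[a, b] : set R) x -> measurable_fun (`[b, d] : set R) x ->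
  measurable_fun (`[a, d] : set R) x.
Proof.
move=> ab bd m1 m2.
have -> : (`[a, d] : set R) = `[a, b] `|` `[b, d].
  apply/seteqP; split=> t /=; rewrite !in_itv /=.
    by move=> /andP[h1 h2]; case: (leP t b) => h; [left|right];
      rewrite ?h1 ?h2 // ltW.
  by case=> /andP[h1 h2]; rewrite ?h1 ?h2 ?(le_trans ab) ?(le_trans _ bd).
by apply/measurable_funU => //; split.
Qed.

Lemma meas_ext a b (x x' : R -> R) : (forall t, a <= t <= b -> x t = x' t) ->
  measurable_fun (`[a, b] : set R) x -> measurable_fun (`[a, b] : set R) x'.
Proof.
by move=> xx; apply: eq_measurable_fun => t; rewrite inE /= in_itv /=; exact: xx.
Qed.

Lemma inn_meas X : L2pre X -> measurable_fun (`[0, l] : set R) (inn X).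
Proof.
move=> pX; apply: (curve_ind (P := fun a b => measurable_fun (`[a, b] : set R) (inn X))) => //.
  by move=> a b d _ ab bd _; exact: meas_cat.
move=> t i tl ti; exists 1 => // a b a0 ab bl _ _ ich.
apply: (@meas_ext _ _ (fun t => \sum_k \sum_p X t i 0 k * X t i 0 p * mmet i (y i t) k p)).
  move=> s sab; rewrite -metE -(inn_chart (i := i)) //.
    by apply: pX.1; exact: in_chart_l ich sab.
  by have [_ _ _ H] := ich; exact: H.
have mX k := comp_meas k pX ich.
apply: measurable_sum => k; apply: measurable_sum => p.
apply: measurable_funM; first exact: measurable_funM.
by apply: cts_meas; exact: smooth_cts ich (mmet_entry_smooth i k p).
Qed.

Lemma L2P X : L2_section l c X <-> L2pre X /\ intg 0 l (inn X).
Proof.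
split=> [[tX mX lX]|[[tX mX] iX]].
  have pX : L2pre X by [].
  split=> //; apply/integrableP; split.
    by apply/measurable_EFinP; exact: inn_meas pX.
  rewrite (_ : (\int[_]_(_ in _) _)%E = l2sq l c X) //.
  by apply: eq_integral => t _ /=; rewrite ger0_norm // inn_ge0.
split=> //; have /integrableP[_] := iX.
rewrite (_ : (\int[_]_(_ in _) _)%E = l2sq l c X) //.
by apply: eq_integral => t _ /=; rewrite ger0_norm // inn_ge0.
Qed.

Lemma l2sq_Int X : L2_section l c X -> l2sq l c X = (Int 0 l (inn X))%:E.
Proof.
move=> /L2P[pX iX]; rewrite /Int /Rintegral fineK //.
exact: integrable_fin_num.
Qed.

Lemma L2pre_lin (r : R) X Y : L2pre X -> L2pre Y ->
  L2pre (fun t i => r *: X t i + Y t i).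
Proof.
move=> [tX mX] [tY mY]; split=> [t tl|i k].
  by apply: tangent_lin; [exact: tX|exact: tY].
rewrite (_ : (fun t => _) = (fun t => r * X t i 0 k + Y t i 0 k)).
  apply: measurable_funD => //; apply: measurable_funM => //; exact: measurable_cst.
by apply/funext => t; rewrite linE.
Qed.

Lemma inn_lin (r : R) X Y t : 0 <= t <= l -> L2pre X -> L2pre Y ->
  inn (fun t i => r *: X t i + Y t i) t <= 2 * r ^+ 2 * inn X t + 2 * inn Y t.
Proof. by move=> tl _ _; apply: met_parallelogram; exact: mcoord_cod (mchartP _). Qed.

Lemma L2_lin (r : R) X Y : L2_section l c X -> L2_section l c Y ->
  L2_section l c (fun t i => r *: X t i + Y t i).
Proof.
move=> /L2P[pX iX] /L2P[pY iY]; apply/L2P; split; first exact: L2pre_lin.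
apply: (@intg_le _ _ _ _ (fun t => 2 * r ^+ 2 * inn X t + 2 * inn Y t)).
- by apply: inn_meas; exact: L2pre_lin.
- by apply: intgD; exact: intgZ.
- by move=> t tl; rewrite ger0_norm ?inn_ge0 //; exact: inn_lin.
Qed.

Definition ctsec X : Prop :=
  (forall t, 0 <= t <= l -> is_tangent (c t) (X t)) /\
  (forall i a b k, in_chart l c i a b -> cts a b (fun t => X t i 0 k)).

Lemma ctsec_inn X : ctsec X -> cts 0 l (inn X).
Proof.
move=> [tX cX]; apply: (curve_ind (P := fun a b => cts a b (inn X))) => //.
  by move=> a b d _ ab bd _; exact: cts_cat.
move=> t i tl ti; exists 1 => // a b a0 ab bl _ _ ich.
apply: (@cts_ext _ _ _ (fun t => \sum_k \sum_p X t i 0 k * X t i 0 p * mmet i (y i t) k p)).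
  move=> s sab; rewrite -metE -(inn_chart (i := i)) //.
    by apply: tX; exact: in_chart_l ich sab.
  by have [_ _ _ H] := ich; exact: H.
apply: cts_sum => k; apply: cts_sum => p; apply: ctsM; first by apply: ctsM; exact: cX ich.
exact: smooth_cts ich (mmet_entry_smooth i k p).
Qed.

Lemma ctsec_L2 X : ctsec X -> L2_section l c X.
Proof.
move=> cX; apply/L2P; split; last exact/cts_intg/ctsec_inn.
split; first exact: cX.1.
move=> i k mD; apply: subspace_continuous_measurable_fun => //.
apply/subspace_continuousP => t [tl ti]; apply/cvgrPdist_lt => e e0.
have [d d0 H] := chart_near tl ti.
pose a := Num.max 0 (t - d / 2); pose b := Num.min l (t + d / 2).
have [t0 tl'] : 0 <= t /\ t <= l by apply/andP.
have ab : in_chart l c i a b.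
  have h1 : a <= t by rewrite ge_max t0 /=; lra.
  have h2 : t <= b by rewrite le_min tl' /=; lra.
  have h3 : t - d / 2 <= a by rewrite le_max lexx orbT.
  have h4 : b <= t + d / 2 by rewrite ge_min lexx orbT.
  split; [by rewrite le_max lexx|exact: le_trans h2|by rewrite ge_min lexx|].
  move=> s /andP[s1 s2]; apply: H.
    by rewrite (le_trans _ s1) ?le_max ?lexx //= (le_trans s2) // ge_min lexx.
  rewrite ltr_norml; apply/andP; split; lra.
have tab : a <= t <= b.
  by rewrite ge_max t0 le_min tl' /=; apply/andP; split; lra.
have [d' d'0 H'] := cX.2 i a b k ab t tab e e0.
rewrite /within /=; apply/nbhs_ballP; exists (Num.min d' (d / 2)) => /=.
  by rewrite lt_min d'0; lra.
move=> s; rewrite /ball /= lt_min => /andP[s1 s2] [/andP[sl0 sl1] _].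
rewrite distrC; apply: H'; last by rewrite distrC.
rewrite ge_max le_min sl0 sl1 /=; move: s2; rewrite ltr_norml => /andP[]; lra.
Qed.

Lemma ctsec_grad g : smooth_fun g -> ctsec (fun t i => grad g i (y i t)).
Proof.
by move=> sg; split=> [t _|i a b k ab]; [exact: grad_tangent|exact: grad_cts].
Qed.

Lemma ctsec_cohess X : ctsec X -> ctsec (fun t i => cohess f i (y i t) (X t i)).
Proof.
move=> [tX cX]; split=> [t tl|i a b k ab].
  by apply: cohess_tangent => //; exact: tX.
apply: (@cts_ext _ _ _ (fun t =>
  (\sum_p X t i 0 p * pd p (fun z => grad f i z 0 k) (y i t)) +
  \sum_p \sum_q grad f i (y i t) 0 p * X t i 0 q * christoffel i (y i t) (e_ p) (e_ q) 0 k)).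
  move=> t tab; have yi := in_chart_cod ab tab.
  by rewrite /cohess addE dgrad_sum // -christoffel_sum.
apply: ctsD; apply: cts_sum => p.
  by apply: ctsM; [exact: cX ab|exact: smooth_cts ab (smooth_derive _ (grad_smooth k sf))].
apply: cts_sum => q; apply: ctsM; last exact: smooth_cts ab (christoffel_smooth _ _ k).
by apply: ctsM; [exact: grad_cts|exact: cX ab].
Qed.

(* [Ds + (Hess f) s = w] in charts: as [c' = - grad f], the Christoffel terms of
   [Ds] and of [Hess f] cancel. *)
Definition sol a b (s w : R -> tuplevec) : Prop :=
  (forall t, a <= t <= b -> is_tangent (c t) (s t)) /\
  forall i a' b', a <= a' -> b' <= b -> in_chart l c i a' b' ->
    weak_derivative a' b' (fun t => s t i)
      (fun t => w t i - dgrad f i (y i t) (s t i)).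

Lemma L2_comp X i a b k : L2_section l c X -> in_chart l c i a b ->
  intg a b (fun t => X t i 0 k) /\ intg a b (fun t => X t i 0 k ^+ 2).
Proof.
move=> /L2P[pX iX] ab.
have [a0 _ bl Hd] := ab.
have mX := comp_meas k pX ab.
have [C C0 HC] := cts_bounded (smooth_cts ab (@invmx_smooth _ _ M i k k)).
have i2 : intg a b (fun t => X t i 0 k ^+ 2).
  apply: (@intg_le _ _ _ _ (fun t => C * inn X t)).
  - apply: (meas_ext (x := fun t => X t i 0 k * X t i 0 k)) => //.
    exact: measurable_funM.
  - exact/intgZ/(intg_sub a0 bl).
  - move=> t tab; have tl := in_chart_l ab tab.
    rewrite ger0_norm ?sqr_ge0 // (inn_chart (pX.1 t tl) (Hd t tab)).
    apply: le_trans (met_coord _ _ (in_chart_cod ab tab)) _.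
    apply: ler_wpM2r; first exact: met_ge0 (in_chart_cod ab tab).
    exact: le_trans (ler_norm _) (HC t tab).
split=> //; apply: (@intg_le _ _ _ _ (fun t => 1 + X t i 0 k ^+ 2)) => //.
  by apply: intgD => //; exact: intg_cst.
move=> t _; rewrite -[X in _ <= _ + X]real_normK ?num_real //.
have := sqr_ge0 (`|X t i 0 k| - 1); rewrite -subr_ge0 => h.
have := normr_ge0 (X t i 0 k); nra.
Qed.

Lemma sol_prim a b s w i k : sol a b s w -> in_chart l c i a b ->
  prim a b (fun t => s t i 0 k)
    (fun t => w t i 0 k - dgrad f i (y i t) (s t i) 0 k).
Proof.
move=> [_ H] ab; have p := H i a b (lexx _) (lexx _) ab k.
by apply: (prim_eq p) => // t _; rewrite addE negE.
Qed.

Lemma hess_sum i j z s u k : overlap i j z ->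
  hess i j z s u 0 k = \sum_q s 0 q * 'D_u (pd q (fun z => trans i j z 0 k)) z.
Proof.
move=> zo; rewrite hessE.
have sd : smooth_on (overlap i j) (fun z => 'D_u (fun z => trans i j z 0 k) z).
  exact: smooth_derive (transk_smooth i j k).
apply: etrans (derive_dir s (overlap_open i j) sd zo) _.
apply: eq_bigr => q _.
exact: (f_equal (fun r => s 0 q * r)
  (schwarz (e_ q) u (overlap_open i j) (transk_smooth i j k) zo)).
Qed.

(** The components of [s] in chart [j] are products of partial derivatives of [trans i j] along [c]
    with the components in chart [i]. As [c' = - grad f], differentiating the former yields [- hess]
    of [s] and [grad f], exactly the defect of [dgrad] in [dgrad_jac]. *)
Lemma sol_change i j a b s w : in_chart l c i a b -> in_chart l c j a b ->
  (forall t, a <= t <= b -> is_tangent (c t) (s t)) ->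
  (forall t, a <= t <= b -> is_tangent (c t) (w t)) ->
  (forall k, prim a b (fun t => s t i 0 k)
    (fun t => w t i 0 k - dgrad f i (y i t) (s t i) 0 k)) ->
  forall k, prim a b (fun t => s t j 0 k)
    (fun t => w t j 0 k - dgrad f j (y j t) (s t j) 0 k).
Proof.
move=> iab jab ts tw H k.
have [_ _ _ Hi] := iab; have [_ _ _ Hj] := jab.
have o t : a <= t <= b -> overlap i j (y i t).
  by move=> tab; apply: overlap_coord; [exact: Hi|exact: Hj].
pose m q z := pd q (fun z => trans i j z 0 k) z.
have mp q := fun_prim iab (overlap_open i j)
  (smooth_derive (e_ q) (transk_smooth i j k)) o.
apply: (prim_eq (prim_sum (index_enum _) (fun q => primM (mp q) (H q)))) => t tab.
  rewrite (tangent_push (ts t tab) (Hi t tab) (Hj t tab)) (jac_sum _ _ (o t tab)).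
  by apply: eq_bigr => q _; rewrite mulrC.
rewrite (tangent_push (tw t tab) (Hi t tab) (Hj t tab)) (jac_sum _ _ (o t tab)).
rewrite (tangent_push (ts t tab) (Hi t tab) (Hj t tab)) -(trans_coord j (Hi t tab)).
rewrite (dgrad_jac _ sf (o t tab)) addE (jac_sum _ _ (o t tab)) (hess_sum _ _ _ (o t tab)).
rewrite opprD addrA -!sumrB; apply: eq_bigr => q _.
rewrite /m mulrN mulrBr; congr (_ - _ - _); exact: mulrC.
Qed.

Lemma sol_chart i a b s w : in_chart l c i a b ->
  (forall t, a <= t <= b -> is_tangent (c t) (s t)) ->
  (forall t, a <= t <= b -> is_tangent (c t) (w t)) ->
  (forall k, prim a b (fun t => s t i 0 k)
    (fun t => w t i 0 k - dgrad f i (y i t) (s t i) 0 k)) ->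
  sol a b s w.
Proof.
move=> iab ts tw H; split=> // j a' b' aa bb jab k.
have [a'0 ab' b'l _] := jab.
have iab' := in_chart_sub iab aa ab' bb.
have h : forall k, prim a' b' (fun t => s t j 0 k)
    (fun t => w t j 0 k - dgrad f j (y j t) (s t j) 0 k).
  apply: (sol_change iab' jab) => [t tab|t tab|q].
  - by apply: ts; exact: sub_itv tab.
  - by apply: tw; exact: sub_itv tab.
  - exact: prim_sub (H q).
by apply: (prim_eq (h k)) => // t _; rewrite addE negE.
Qed.

Lemma sol_sub a b a' b' s w : a <= a' -> b' <= b -> sol a b s w -> sol a' b' s w.
Proof.
move=> aa bb [ts H]; split=> [t tt|i a1 b1 h1 h2 ich].
  by apply: ts; exact: sub_itv tt.
by apply: H => //; [exact: le_trans h1|exact: le_trans bb].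
Qed.

Lemma sol_cat a b d s w : a <= b -> b <= d -> sol a b s w -> sol b d s w ->
  sol a d s w.
Proof.
move=> ab bd [ts1 H1] [ts2 H2]; split.
  move=> t /andP[at' td]; have [tb|bt] := leP t b; first by apply: ts1; rewrite at'.
  by apply: ts2; rewrite td ltW.
move=> i a' b' aa bb ich k; have [_ ab' _ _] := ich.
have [b'b|bb'] := leP b' b; first exact: H1.
have [ba'|a'b] := leP b a'; first exact: H2.
apply: (@prim_cat _ a' b b'); [exact: ltW|exact: ltW| |].
  by apply: H1 => //; apply: (in_chart_sub ich) => //; exact: ltW.
by apply: H2 => //; apply: (in_chart_sub ich) => //; exact: ltW.
Qed.

Lemma sol_ext a b s s' w w' :
  (forall t, a <= t <= b -> is_tangent (c t) (s' t)) ->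
  (forall t, a <= t <= b -> eq_tangent (c t) (s t) (s' t)) ->
  (forall t, a <= t <= b -> eq_tangent (c t) (w t) (w' t)) ->
  sol a b s w -> sol a b s' w'.
Proof.
move=> ts' ss ww [ts H]; split; first exact: ts'.
move=> i a' b' aa bb ich k.
have [_ _ _ Hi] := ich.
have p := H i a' b' aa bb ich k.
apply: (prim_eq p) => t tab.
  by rewrite (ss t _ i (Hi t tab)) //; exact: sub_itv tab.
by rewrite (ss t _ i (Hi t tab)) ?(ww t _ i (Hi t tab)) //; exact: sub_itv tab.
Qed.

Lemma sol_lin (r : R) a b s w s' w' : sol a b s w -> sol a b s' w' ->
  sol a b (fun t i => r *: s t i + s' t i) (fun t i => r *: w t i + w' t i).
Proof.
move=> [ts H] [ts' H']; split=> [t tab|i a' b' aa bb ich k].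
  by apply: tangent_lin; [exact: ts|exact: ts'].
apply: (prim_eq (primD (primZ r (H i a' b' aa bb ich k)) (H' i a' b' aa bb ich k))).
  by move=> t _; rewrite linE.
move=> t tab; rewrite (dgrad_lin _ _ _ sf (in_chart_cod ich tab)).
have aux (W W' D D' : V) : r * (W - D) 0 k + (W' - D') 0 k =
    (r *: W + W' - (r *: D + D')) 0 k by rewrite !mxE; ring.
exact: aux.
Qed.

Lemma sol_ctsec s w : sol 0 l s w -> ctsec s.
Proof.
move=> [ts H]; split=> // i a b k ich; have [a0 _ bl _] := ich.
exact: prim_cts (H i a b a0 bl ich k).
Qed.

Definition norm1 (u : V) : R := \sum_k `|u 0 k|.

Lemma norm1_ge0 u : 0 <= norm1 u. Proof. exact: sumr_ge0. Qed.

(** A single constant for the comparison of the metric with the coordinate norm in both directions,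
    for the zero-order term of the equation, and for the bound that [volterra] asks for. *)
Lemma chart_const i a b : in_chart l c i a b -> exists2 K : R, 0 < K &
  forall t, a <= t <= b -> forall u,
    [/\ norm1 u ^+ 2 <= K * met i (y i t) u u,
        met i (y i t) u u <= K * norm1 u ^+ 2,
        norm1 (dgrad f i (y i t) u) <= K * norm1 u &
        \sum_k \sum_q `|pd q (fun z => grad f i z 0 k) (y i t)| <= K].
Proof.
move=> ab.
pose F1 t := \sum_k \sum_q `|invmx (mmet i (y i t)) k q|.
pose F2 t := \sum_k \sum_q `|mmet i (y i t) k q|.
pose F3 t := \sum_k \sum_q `|pd q (fun z => grad f i z 0 k) (y i t)|.
have c1 : cts a b F1.
  by do 2 apply: cts_sum => ?; apply: cts_norm; exact: smooth_cts ab (@invmx_smooth _ _ M i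
    _ _).
have c2 : cts a b F2.
  by do 2 apply: cts_sum => ?; apply: cts_norm; exact: smooth_cts ab (mmet_entry_smooth _ _ _).
have c3 : cts a b F3.
  apply: cts_sum => k; apply: cts_sum => q; apply: cts_norm.
  exact: smooth_cts ab (smooth_derive _ (grad_smooth k sf)).
have [C1 C10 H1] := cts_bounded c1.
have [C2 C20 H2] := cts_bounded c2.
have [C3 C30 H3] := cts_bounded c3.
(* The square of [norm1 u] has [n ^ 2] products, each of which [uk] bounds by [C1] times the squared
   length of [u]. *)
pose C := n%:R ^+ 2 * C1.
have C0 : 0 <= C by rewrite mulr_ge0 ?exprn_ge0 // ltW.
exists (C + C2 + C3); first by rewrite ltr_wpDl // addr_ge0 // ltW.
move=> t tab u; have yi := in_chart_cod ab tab.
have h1 := le_trans (ler_norm _) (H1 t tab).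
have h2 := le_trans (ler_norm _) (H2 t tab).
have h3 := le_trans (ler_norm _) (H3 t tab).
have m0 := met_ge0 u yi.
have inv k q : `|invmx (mmet i (y i t)) k q| <= C1.
  apply: le_trans h1; rewrite /F1 (bigD1 k) //= (bigD1 q) //= -addrA lerDl.
  by apply: addr_ge0; apply: sumr_ge0 => // ? _; exact: sumr_ge0.
have uk k : u 0 k ^+ 2 <= C1 * met i (y i t) u u.
  apply: le_trans (met_coord u k yi) _; apply: ler_wpM2r => //.
  exact: le_trans (ler_norm _) (inv k k).
have E : C + C2 + C3 = C + (C2 + C3) by rewrite addrA.
split.
- apply: (@le_trans _ _ (C * met i (y i t) u u)); last first.
    by apply: ler_wpM2r => //; rewrite E lerDl addr_ge0 // ltW.
  rewrite expr2 /norm1 mulr_suml.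
  apply: (@le_trans _ _ (\sum_(k < n) \sum_(q < n) C1 * met i (y i t) u u)).
    apply: ler_sum => k _; rewrite mulr_sumr; apply: ler_sum => q _.
    have := uk k; have := uk q; rewrite -[u 0 k ^+ 2]real_normK ?num_real //.
    rewrite -[u 0 q ^+ 2]real_normK ?num_real //.
    set p1 := `|_|; set p2 := `|_|; have := sqr_ge0 (p1 - p2); rewrite sqrrB; lra.
  set Q := C1 * _; rewrite !sumr_const !card_ord -mulrnA -mulr_natl natrM.
  by rewrite /C /Q expr2 !mulrA.
- apply: le_trans (met_upper i (y i t) u) _.
  apply: ler_wpM2r; first exact: sqr_ge0.
  by apply: le_trans h2 _; rewrite addrAC lerDr addr_ge0 // ltW.
- apply: (@le_trans _ _ (C3 * norm1 u)); last first.
    by apply: ler_wpM2r; [exact: norm1_ge0|rewrite lerDr addr_ge0 // ltW].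
  apply: (@le_trans _ _ (F3 t * norm1 u)); last by apply: ler_wpM2r => //; exact: norm1_ge0.
  rewrite {1}/norm1 /F3 mulr_suml; apply: ler_sum => k _.
  rewrite dgrad_sum //; apply: le_trans (ler_norm_sum _ _ _) _.
  rewrite mulr_suml; apply: ler_sum => q _; rewrite normrM mulrC.
  apply: ler_wpM2l => //; rewrite /norm1 (bigD1 q) //= lerDl; exact: sumr_ge0.
- by apply: le_trans h3 _; rewrite lerDr addr_ge0 // ltW.
Qed.

Lemma closed_chart t i : 0 <= t <= l -> mdom i (c t) ->
  exists a b, in_chart l c i a b /\ exists2 e : R, 0 < e &
    forall s, 0 <= s <= l -> `|s - t| < e -> a <= s <= b.
Proof.
move=> tl ti; have [d d0 H] := chart_near tl ti.
pose a := Num.max 0 (t - d / 2); pose b := Num.min l (t + d / 2).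
have [t0 tl'] : 0 <= t /\ t <= l by apply/andP.
have h1 : a <= t by rewrite ge_max t0 /=; lra.
have h2 : t <= b by rewrite le_min tl' /=; lra.
have h3 : t - d / 2 <= a by rewrite le_max lexx orbT.
have h4 : b <= t + d / 2 by rewrite ge_min lexx orbT.
exists a, b; split.
  split; [by rewrite le_max lexx|exact: le_trans h2|by rewrite ge_min lexx|].
  move=> s /andP[s1 s2]; apply: H.
    by rewrite (le_trans _ s1) ?le_max ?lexx //= (le_trans s2) // ge_min lexx.
  rewrite ltr_norml; apply/andP; split; lra.
exists (d / 2); first by lra.
move=> s /andP[s0 sl]; rewrite ltr_norml => /andP[u1 u2].
by rewrite ge_max le_min s0 sl /=; apply/andP; split; lra.
Qed.

Lemma norm1_cts X i a b : in_chart l c i a b ->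
  (forall k, cts a b (fun t => X t i 0 k)) -> cts a b (fun t => norm1 (X t i)).
Proof. by move=> _ H; apply: cts_sum => k; exact: cts_norm. Qed.

(** A Gronwall estimate by absorption: the maximum [S] of the norm satisfies
    [S <= norm1 (s a i) + W + K * S * (b - a)], and the last term is at most [S / 2]. The second
    bound passes from [L^1] to [L^2]. *)
Lemma sol_bound_loc i a b (K : R) s w : in_chart l c i a b -> 0 < K ->
  (forall t, a <= t <= b -> forall u,
    [/\ norm1 u ^+ 2 <= K * met i (y i t) u u,
        met i (y i t) u u <= K * norm1 u ^+ 2,
        norm1 (dgrad f i (y i t) u) <= K * norm1 u &
        \sum_k \sum_q `|pd q (fun z => grad f i z 0 k) (y i t)| <= K]) ->
  K * (b - a) <= 1 / 2 -> L2_section l c w -> sol a b s w ->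
  (forall t, a <= t <= b ->
    norm1 (s t i) <= 2 * (norm1 (s a i) + Int a b (fun t => norm1 (w t i)))) /\
  Int a b (fun t => norm1 (w t i)) ^+ 2 <= (b - a) * K * Int a b (inn w).
Proof.
move=> ab K0 HK Kab Lw ss; have [a0 ab' bl Hi] := ab.
have wi k := L2_comp k Lw ab.
have Wi : intg a b (fun t => norm1 (w t i)).
  by apply: intg_sum => k; apply: intg_norm; exact: (wi k).1.
have iw : intg a b (inn w) by move/L2P: Lw => [_]; exact: intg_sub.
have sp k := sol_prim k ss ab.
have sc k := prim_cts (sp k).
have Nc : cts a b (fun t => norm1 (s t i)) := norm1_cts ab sc.
have [ts /=] := EVT_max ab' (iffLR (cts_within a b _) Nc).
rewrite in_itv /= => tsab Hmax.
have {}Hmax t : a <= t <= b -> norm1 (s t i) <= norm1 (s ts i).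
  by move=> tab; apply: Hmax; rewrite in_itv.
set W := Int a b (fun t => norm1 (w t i)); set S := norm1 (s ts i) in Hmax *.
have dc k : cts a b (fun t => dgrad f i (y i t) (s t i) 0 k).
  apply: (@cts_ext _ _ _ (fun t => \sum_q s t i 0 q * pd q (fun z => grad f i z 0 k) (y i t))).
    by move=> t tab; rewrite dgrad_sum //; exact: in_chart_cod ab tab.
  apply: cts_sum => q; apply: ctsM => //.
  exact: smooth_cts ab (smooth_derive _ (grad_smooth k sf)).
have step t : a <= t <= b -> norm1 (s t i) <= norm1 (s a i) + (W + K * S * (b - a)).
  move=> /andP[at' tb].
  have h k : `|s t i 0 k| <= `|s a i 0 k| +
      Int a b (fun t => `|w t i 0 k| + `|dgrad f i (y i t) (s t i) 0 k|).
    have -> : s t i 0 k = s a i 0 k + (s t i 0 k - s a i 0 k) by ring.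
    apply: le_trans (ler_normD _ _) _; apply: lerD => //.
    apply: le_trans (prim_norm (sp k) (lexx a) at' tb) _.
    have ii : intg a b (fun t => `|w t i 0 k| + `|dgrad f i (y i t) (s t i) 0 k|).
      by apply: intgD; [apply: intg_norm; exact: (wi k).1|exact/cts_intg/cts_norm].
    apply: (@le_trans _ _ (Int a t (fun t => `|w t i 0 k| + `|dgrad f i (y i t) (s t i) 0
      k|))).
      apply: le_Int; [apply: intg_norm; exact: intg_sub (sp k).1|exact: intg_sub ii|].
      by move=> r _; exact: ler_normB.
    rewrite (@Int_cat _ a t b) // lerDl; apply: Int_ge0 => r _; exact: addr_ge0.
  apply: (@le_trans _ _ (\sum_k (`|s a i 0 k| +
      Int a b (fun t => `|w t i 0 k| + `|dgrad f i (y i t) (s t i) 0 k|)))).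
    exact: ler_sum.
  rewrite big_split /= -/(norm1 _) lerD2l -Int_sum; last first.
    by move=> k; apply: intgD; [apply: intg_norm; exact: (wi k).1|exact/cts_intg/cts_norm].
  rewrite -Int_cst // /W -IntD //; last exact: intg_cst.
  apply: le_Int.
  - apply: intg_sum => k.
    by apply: intgD; [apply: intg_norm; exact: (wi k).1|exact/cts_intg/cts_norm].
  - by apply: intgD => //; exact: intg_cst.
  - move=> r rab; rewrite big_split /= lerD2l.
    have [_ _ hd _] := HK r rab (s r i).
    apply: le_trans hd _; apply: ler_wpM2l; [exact: ltW|exact: Hmax].
have S0 : 0 <= S by exact: norm1_ge0.
have Sle : S <= 2 * (norm1 (s a i) + W).
  have := step ts tsab; rewrite -/S.
  have : K * S * (b - a) <= S / 2.
    rewrite mulrAC mulrC; have := ler_wpM2l S0 Kab; lra.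
  lra.
split=> [t tab|]; first exact: le_trans (Hmax t tab) Sle.
have Wi2 : intg a b (fun t => norm1 (w t i) ^+ 2).
  apply: (@intg_le _ _ _ _ (fun t => K * inn w t)).
  - have mW := intg_meas Wi.
    apply: (meas_ext (x := fun t => norm1 (w t i) * norm1 (w t i))) => //.
    exact: measurable_funM.
  - exact: intgZ.
  - move=> t tab; rewrite ger0_norm ?sqr_ge0 //.
    have [h _ _ _] := HK t tab (w t i).
    by rewrite (inn_chart (i := i)) //; [move/L2P: Lw => [[tw _] _]; apply: tw;
      exact: in_chart_l ab tab|exact: Hi].
have := cauchy_schwarz_Int ab' Wi Wi2.
rewrite (@eq_Int _ a b (fun t => `|norm1 (w t i)|) (fun t => norm1 (w t i))); last first.
  by move=> t _; rewrite ger0_norm // norm1_ge0.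
move=> h; apply: le_trans h _; rewrite -mulrA; apply: ler_wpM2l; first by rewrite subr_ge0.
rewrite -IntZ //; apply: le_Int => //; first exact: intgZ.
move=> t tab; have [h _ _ _] := HK t tab (w t i).
by rewrite (inn_chart (i := i)) //; [move/L2P: Lw => [[tw _] _]; apply: tw;
  exact: in_chart_l ab tab|exact: Hi].
Qed.

(** The local bounds are restated with [inn], which does not depend on a chart, and can then be
    chained from one piece of the curve to the next. *)
Lemma sol_bound : exists2 C : R, 0 <= C & forall s w, L2_section l c w ->
  sol 0 l s w -> forall t, 0 <= t <= l ->
  inn s t <= C * (inn s 0 + Int 0 l (inn w)).
Proof.
apply: (curve_ind (P := fun a b => exists2 C : R, 0 <= C & forall s w,
  L2_section l c w -> sol a b s w -> forall t, a <= t <= b ->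
  inn s t <= C * (inn s a + Int a b (inn w)))) => //.
- move=> a b d a0 ab bd dl [C1 C10 H1] [C2 C20 H2].
  exists (C1 + C2 * C1 + C2).
    by rewrite !addr_ge0 // mulr_ge0.
  move=> s w Lw ss t /andP[at' td].
  have [pw iw] := (L2P w).1 Lw.
  have iwa : intg a d (inn w) by exact: intg_sub iw.
  rewrite (Int_cat ab bd iwa).
  have I1 : 0 <= Int a b (inn w) by apply: Int_ge0 => r _; exact: inn_ge0.
  have I2 : 0 <= Int b d (inn w) by apply: Int_ge0 => r _; exact: inn_ge0.
  have s0 := inn_ge0 s a.
  have h1 := H1 s w Lw (sol_sub (lexx a) bd ss).
  have h2 := H2 s w Lw (sol_sub ab (lexx d) ss).
  have C21 : 0 <= C2 * C1 by exact: mulr_ge0.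
  have [tb|bt] := leP t b.
    have := h1 t; rewrite at' tb => /(_ isT) h; apply: le_trans h _.
    apply: ler_pM => //; first exact: addr_ge0.
      by rewrite -addrA lerDl addr_ge0.
    by rewrite addrA lerDl.
  have := h2 t; rewrite td ltW // => /(_ isT) h; apply: le_trans h _.
  have := h1 b; rewrite ab lexx => /(_ isT) hb.
  have hb' := ler_wpM2l C20 hb.
  have E1 : 0 <= C1 * (inn s a + (Int a b (inn w) + Int b d (inn w))).
    by rewrite mulr_ge0 // !addr_ge0.
  have E2 : 0 <= C2 * C1 * Int b d (inn w) by exact: mulr_ge0.
  have E3 : 0 <= C2 * inn s a by exact: mulr_ge0.
  have E4 : 0 <= C2 * Int a b (inn w) by exact: mulr_ge0.
  move: hb' E1 E2 E3 E4; clear; lra.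
- move=> t i tl ti; have [a0 [b0 [ich [e e0 He]]]] := closed_chart tl ti.
  have [K K0 HK] := chart_const ich.
  (* A piece has length less than [2 * e'], so that [K * (b - a) <= 1 / 2]. *)
  pose e' := Num.min e (1 / (4 * K)).
  have e'0 : 0 < e' by rewrite lt_min e0 divr_gt0 // mulr_gt0.
  exists e' => // a b a0' ab bl ta bt iab.
  have e'e : e' <= e by rewrite ge_min lexx.
  have e'K : e' <= 1 / (4 * K) by rewrite ge_min lexx orbT.
  have Kab : K * (b - a) <= 1 / 2.
    apply: (@le_trans _ _ (K * (2 * e'))); first by apply: ler_wpM2l; [exact: ltW|lra].
    apply: (@le_trans _ _ (K * (2 * (1 / (4 * K))))).
      by apply: ler_wpM2l; [exact: ltW|lra].
    by rewrite le_eqVlt; apply/orP; left; apply/eqP; field; exact: lt0r_neq0.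
  have HK' : forall s, a <= s <= b -> a0 <= s <= b0.
    move=> s sab; apply: He; first exact: sub_itv sab.
    exact: near_itv e'e ta bt sab.
  (* The [8] comes from squaring [2 * (B + W)], and each [K] from one change between [norm1] and the
     metric; [l] bounds [b - a]. *)
  exists (8 * K * K * (1 + l)).
    by rewrite !mulr_ge0 // ?addr_ge0 // ltW.
  move=> s w Lw ss r rab.
  have [h1 h2] := sol_bound_loc iab K0 (fun s sab => HK s (HK' s sab)) Kab Lw ss.
  have [_ _ _ Hi] := iab.
  have aab : a <= a <= b by rewrite lexx.
  have [_ hr _ _] := HK r (HK' r rab) (s r i).
  have [ha _ _ _] := HK a (HK' a aab) (s a i).
  rewrite -(inn_chart (ss.1 r rab) (Hi r rab)) in hr.
  rewrite -(inn_chart (ss.1 a aab) (Hi a aab)) in ha.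
  have := h1 r rab.
  move: (norm1_ge0 (s r i)) (norm1_ge0 (s a i)) (inn_ge0 s a) hr ha h2.
  have I0 : 0 <= Int a b (inn w) by apply: Int_ge0 => q _; exact: inn_ge0.
  have W0 : 0 <= Int a b (fun t => norm1 (w t i)) by apply: Int_ge0 => q _; exact: norm1_ge0.
  have bal : b - a <= l by lra.
  have h3 : (b - a) * K * Int a b (inn w) <= l * K * Int a b (inn w).
    by apply: ler_wpM2r => //; apply: ler_wpM2r => //; exact: ltW.
  move: I0 W0 h3.
  set A := norm1 (s r i); set B := norm1 (s a i); set W := Int a b (fun t => norm1 (w t i)).
  set J := Int a b (inn w); set Q := inn s a.
  move=> J0 W0 h3 A0 B0 Q0 hr hB hW hA.
  apply: le_trans hr _.
  have hA2 : A ^+ 2 <= 8 * (B ^+ 2 + W ^+ 2).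
    have : A ^+ 2 <= (2 * (B + W)) ^+ 2 by rewrite ler_sqr ?nnegrE // mulr_ge0 // addr_ge0.
    have := sqr_ge0 (B - W); rewrite !expr2; nra.
  apply: (@le_trans _ _ (K * (8 * (K * Q + l * K * J)))).
    apply: ler_wpM2l; first exact: ltW.
    apply: le_trans hA2 _; apply: ler_wpM2l => //; apply: lerD => //.
    exact: le_trans hW h3.
  have lQ : 0 <= l * Q by exact: mulr_ge0.
  have KK : 0 <= 8 * K * K by rewrite !mulr_ge0 // ltW.
  have -> : K * (8 * (K * Q + l * K * J)) = 8 * K * K * (Q + l * J) by ring.
  rewrite -[X in _ <= X]mulrA; apply: ler_wpM2l => //; move: lQ J0; clear; lra.
Qed.

(** The length of a piece on which [volterra] applies depends on the coefficients alone. The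
    statement that is glued therefore quantifies over all initial vectors, and the end value of one
    piece starts the next. *)
Lemma sol_exists w u : L2_section l c w -> is_tangent (c 0) u ->
  exists2 s, sol 0 l s w & eq_tangent (c 0) (s 0) u.
Proof.
move=> Lw; move: u.
apply: (curve_ind (P := fun a b => forall u, is_tangent (c a) u ->
  exists2 s, sol a b s w & eq_tangent (c a) (s a) u)) => //.
- move=> a b d a0 ab bd dl H1 H2 u tu.
  have [s1 ss1 E1] := H1 u tu.
  have [s2 ss2 E2] := H2 (s1 b) (ss1.1 b ltac:(by rewrite ab lexx)).
  pose s t := if t <= b then s1 t else s2 t.
  exists s; last by rewrite /s ab.
  have t1 t : a <= t <= b -> s t = s1 t by rewrite /s => /andP[_ ->].
  have t2 t : b <= t <= d -> eq_tangent (c t) (s2 t) (s t).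
    rewrite /s => /andP[bt td]; have [tb|//] := leP t b.
    by have -> : t = b by apply/eqP; rewrite eq_le tb bt.
  apply: (sol_cat ab bd).
    apply: (sol_ext (s := s1) (w := w) _ _ _ ss1).
    - by move=> t tab; rewrite t1 //; exact: ss1.1.
    - by move=> t tab; rewrite t1.
    - by move=> t tab j.
  apply: (sol_ext (s := s2) (w := w) _ _ _ ss2).
  - move=> t tbd; rewrite /s; have [tb|bt] := leP t b; last exact: ss2.1.
    have -> : t = b by apply/eqP; rewrite eq_le tb; case/andP: tbd.
    by apply: ss1.1; rewrite ab lexx.
  - exact: t2.
  - by move=> t tab j.
- move=> t i tl ti; have [a0 [b0 [ich [e e0 He]]]] := closed_chart tl ti.
  have [K K0 HK] := chart_const ich.
  pose e' := Num.min e (1 / (4 * K)).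
  have e'0 : 0 < e' by rewrite lt_min e0 divr_gt0 // mulr_gt0.
  exists e' => // a b a0' ab bl ta bt iab u tu.
  have e'e : e' <= e by rewrite ge_min lexx.
  have e'K : e' <= 1 / (4 * K) by rewrite ge_min lexx orbT.
  have Kab : K * (b - a) <= 1 / 2.
    apply: (@le_trans _ _ (K * (2 * e'))); first by apply: ler_wpM2l; [exact: ltW|lra].
    apply: (@le_trans _ _ (K * (2 * (1 / (4 * K))))).
      by apply: ler_wpM2l; [exact: ltW|lra].
    by rewrite le_eqVlt; apply/orP; left; apply/eqP; field; exact: lt0r_neq0.
  have HK' : forall s, a <= s <= b -> a0 <= s <= b0.
    move=> s sab; apply: He; first exact: sub_itv sab.
    exact: near_itv e'e ta bt sab.
  have [_ _ _ Hi] := iab.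
  have wi k := (L2_comp k Lw iab).1.
  pose A k q t := pd q (fun z => grad f i z 0 k) (y i t).
  (* The initial value and the integrable right-hand side together form a continuous function. *)
  pose om k t := u i 0 k + Int a t (fun t => w t i 0 k).
  have Ac k q : cts a b (A k q) := smooth_cts iab (smooth_derive _ (grad_smooth k sf)).
  have op k : prim a b (om k) (fun t => w t i 0 k).
    by split=> // r rab; rewrite /om Int_pt addr0.
  have AL r : a <= r <= b -> \sum_k \sum_q `|A k q r| <= K.
    by move=> rab; have [_ _ _ h] := HK r (HK' r rab) 0.
  have [x xc xE] := volterra ab Ac (fun k => prim_cts (op k)) AL Kab.
  pose s t := push i (c t) (\row_k x k t).
  have si r k : a <= r <= b -> s r i 0 k = x k r.
    by move=> rab; rewrite /s push_id ?mxE //; exact: Hi.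
  have ts r : a <= r <= b -> is_tangent (c r) (s r).
    by move=> rab; apply: push_tangent; exact: Hi.
  have aab : a <= a <= b by rewrite lexx.
  exists s; last first.
    apply: (tangent_eq (i := i)); [exact: ts|exact: tu|exact: Hi|].
    by apply/rowP => k; rewrite si // xE // /om !Int_pt addr0 subr0.
  apply: (sol_chart iab ts).
    move=> r rab; have [[tw _] _] := (L2P w).1 Lw; apply: tw.
    exact: in_chart_l iab rab.
  move=> k.
  have Axi : intg a b (fun t => \sum_q A k q t * x q t).
    by apply: cts_intg; apply: cts_sum => q; exact: ctsM.
  have p2 : prim a b (fun t => Int a t (fun t => \sum_q A k q t * x q t))
      (fun t => \sum_q A k q t * x q t).
    by split=> // r rab; rewrite Int_pt add0r.
  apply: (prim_eq (primD (op k) (primZ (-1) p2))) => r rab.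
    by rewrite si // xE // mulN1r.
  rewrite mulN1r dgrad_sum //; last exact: in_chart_cod iab rab.
  congr (_ - _); apply: eq_bigr => q _; rewrite si //; exact: mulrC.
Qed.

Lemma christoffelN i z (u w : V) : cod i z ->
  christoffel i z (- u) w = - christoffel i z u w.
Proof.
move=> zi.
have h0 : christoffel i z 0 w = 0.
  have := christoffel_linl (-1) u u w zi.
  by rewrite !scaleN1r !addNr.
by have := christoffel_linl (-1) u 0 w zi; rewrite !scaleN1r h0 !addr0.
Qed.

Lemma sub3E (A B D : V) k : (A - B - D) 0 k = A 0 k - B 0 k - D 0 k.
Proof. by rewrite !mxE. Qed.

Lemma cohessE i (z u : V) : cohess f i z u = dgrad f i z u + christoffel i z (grad f i z) u.
Proof. by []. Qed.

Local Opaque cohess.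

Lemma ctsec_prim0 s w i a b k : sol 0 l s w -> in_chart l c i a b ->
  prim a b (fun t => s t i 0 k) (fun t => w t i 0 k - dgrad f i (y i t) (s t i) 0 k).
Proof.
move=> ss ich; have [a0 _ bl _] := ich.
exact: sol_prim (sol_sub a0 bl ss) ich.
Qed.

(** The way back from the chart equation to the covariant one: by [velocity_ae] the Christoffel
    terms of [v] and of [cohess] compensate almost everywhere. *)
Lemma sol_W12 s w : L2_section l c w -> sol 0 l s w ->
  W12_section l c v s (fun t i => w t i - cohess f i (y i t) (s t i)).
Proof.
move=> Lw ss; have cs := sol_ctsec ss; have cc := ctsec_cohess cs.
split; first exact: ss.1.
  have := L2_lin (-1) (ctsec_L2 cc) Lw.
  rewrite (_ : (fun t i => _) = (fun t i => w t i - cohess f i (y i t) (s t i))) //.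
  by apply/funext => t; apply/funext => i; rewrite scaleN1r addrC.
move=> i a b ich k; have [_ _ _ Hi] := ich.
have [_ Lv _] := cW.
have gi : intg a b (fun t => (w t i - cohess f i (y i t) (s t i)
    - christoffel i (y i t) (v t i) (s t i)) 0 k).
  apply: (@eq_intg _ _ _ (fun t => w t i 0 k - cohess f i (y i t) (s t i) 0 k -
    \sum_p \sum_q (s t i 0 q * christoffel i (y i t) (e_ p) (e_ q) 0 k) * v t i 0 p)).
    move=> t tab; apply: etrans _ (esym (sub3E (w t i) (cohess f i (y i t) (s t i)) _ k)).
    apply: (f_equal (fun r => w t i 0 k - cohess f i (y i t) (s t i) 0 k - r)).
    apply: etrans _ (esym (christoffel_sum (v t i) (s t i) k (in_chart_cod ich tab))).
    apply: eq_bigr => p _; apply: eq_bigr => q _.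
    by rewrite [LHS]mulrC mulrA.
  apply: intgB.
    apply: intgB; first exact: (L2_comp k Lw ich).1.
    by apply/cts_intg; exact: (cc.2 i a b k ich).
  apply: intg_sum => p; apply: intg_sum => q; apply: intgM; last exact: (L2_comp p Lv ich).1.
  by apply: ctsM; [exact: (cs.2 i a b q ich)|exact: smooth_cts ich (christoffel_smooth _ _ k)].
apply: (prim_ext (ctsec_prim0 k ss ich) _ gi) => //.
apply: (ae_imp velocity_ae) => t H tab.
have ti := Hi t tab; have zi := in_chart_cod ich tab.
rewrite (H (in_chart_l ich tab) i ti) (christoffelN _ _ zi) cohessE.
by rewrite !(addE, negE); ring.
Qed.

Definition null X t : Prop := eq_tangent (c t) (X t) (fun=> 0).

Lemma prim_osc a b (x x' : R -> R) r t : prim a b x x' -> a <= r <= b -> a <= t <= b ->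
  `|x t - x r| <= Int a b (fun t => `|x' t|).
Proof.
move=> p; wlog rt : r t / r <= t.
  move=> H rab tab; have [rt|tr] := leP r t; first exact: H.
  by rewrite distrC; apply: H => //; exact: ltW.
move=> /andP[ar _] /andP[_ tb]; apply: le_trans (prim_norm p ar rt tb) _.
have ni := intg_norm p.1.
rewrite (Int_cat ar (le_trans rt tb) ni) (Int_cat rt tb (intg_sub ar (lexx b) ni)).
rewrite addrCA lerDl addr_ge0 //; exact: Int_ge0.
Qed.

(** On a short piece the maximum [S] of the norm satisfies [S <= K * S * (b - a) <= S / 2]. The zero
    may sit at either end: the forward case gives uniqueness, the backward case lets the gradient
    vanish along the whole edge once it vanishes at its end. *)
Lemma sol_vanish a b s w : 0 <= a -> a <= b -> b <= l -> sol a b s w ->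
  (forall t, a <= t <= b -> null w t) -> null s a \/ null s b ->
  forall t, a <= t <= b -> null s t.
Proof.
move=> a0 ab bl; move: s w.
apply: (curve_ind (P := fun a b => forall s w, sol a b s w ->
  (forall t, a <= t <= b -> null w t) -> null s a \/ null s b ->
  forall t, a <= t <= b -> null s t)) => //.
  move=> a1 b1 d1 _ ab1 bd1 _ H1 H2 s w ss nw ns.
  have nw1 t : a1 <= t <= b1 -> null w t.
    by move=> /andP[h1 h2]; apply: nw; rewrite h1 (le_trans h2).
  have nw2 t : b1 <= t <= d1 -> null w t.
    by move=> /andP[h1 h2]; apply: nw; rewrite h2 (le_trans _ h1).
  have s1 := sol_sub (lexx a1) bd1 ss; have s2 := sol_sub ab1 (lexx d1) ss.
  have nb : null s b1.
    case: ns => n0.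
      by apply: (H1 s w s1 nw1 (or_introl n0)); rewrite ab1 lexx.
    by apply: (H2 s w s2 nw2 (or_intror n0)); rewrite bd1 lexx.
  move=> t /andP[at' td]; have [tb|bt] := leP t b1.
    by apply: (H1 s w s1 nw1 (or_intror nb)); rewrite at'.
  by apply: (H2 s w s2 nw2 (or_introl nb)); rewrite td ltW.
move=> t i tl ti; have tl' : 0 <= t <= l by exact: sub_itv tl.
have [a0' [b0 [ich [e e0 He]]]] := closed_chart tl' ti.
have [K K0 HK] := chart_const ich.
pose e' := Num.min e (1 / (4 * K)).
have e'0 : 0 < e' by rewrite lt_min e0 divr_gt0 // mulr_gt0.
exists e' => // a1 b1 a01 ab1 bl1 ta tb iab s w ss nw ns.
have e'e : e' <= e by rewrite ge_min lexx.
have e'K : e' <= 1 / (4 * K) by rewrite ge_min lexx orbT.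
have Kab : K * (b1 - a1) <= 1 / 2.
  apply: (@le_trans _ _ (K * (2 * e'))).
    by apply: ler_wpM2l; [exact: ltW|lra].
  apply: (@le_trans _ _ (K * (2 * (1 / (4 * K))))).
    by apply: ler_wpM2l; [exact: ltW|lra].
  by rewrite le_eqVlt; apply/orP; left; apply/eqP; field; exact: lt0r_neq0.
have HK' s' : a1 <= s' <= b1 -> a0' <= s' <= b0.
  move=> sab; apply: He; first exact: in_chart_l iab sab.
  exact: near_itv e'e ta tb sab.
have [_ _ _ Hi] := iab.
have [r rab nr] : exists2 r, a1 <= r <= b1 & null s r.
  by case: ns => n0; [exists a1|exists b1]; rewrite ?lexx ?ab1.
have sp k := sol_prim k ss iab.
have Nc : cts a1 b1 (fun t => norm1 (s t i)) := norm1_cts iab (fun k => prim_cts (sp k)).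
have [ts /=] := EVT_max ab1 (iffLR (cts_within a1 b1 _) Nc).
rewrite in_itv /= => tsab Hmax.
have {}Hmax t' : a1 <= t' <= b1 -> norm1 (s t' i) <= norm1 (s ts i).
  by move=> tab; apply: Hmax; rewrite in_itv.
set S := norm1 (s ts i) in Hmax.
have ni k : intg a1 b1 (fun t => `|w t i 0 k - dgrad f i (y i t) (s t i) 0 k|).
  exact: intg_norm (sp k).1.
have S0 : 0 <= S by exact: norm1_ge0.
have SK : S <= K * S * (b1 - a1).
  apply: (@le_trans _ _ (\sum_k Int a1 b1 (fun t => `|w t i 0 k - dgrad f i (y i t) (s t i)
    0 k|))).
    apply: ler_sum => k _; have := prim_osc (sp k) rab tsab.
    by rewrite (nr i (Hi r rab)) mxE subr0.
  rewrite -Int_sum // -Int_cst //; apply: le_Int; [exact: intg_sum|exact: intg_cst|].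
  move=> q qab; apply: (@le_trans _ _ (norm1 (dgrad f i (y i q) (s q i)))).
    apply: ler_sum => k _.
    by rewrite (nw q qab i (Hi q qab)) mxE sub0r normrN.
  have [_ _ hd _] := HK q (HK' q qab) (s q i).
  by apply: le_trans hd _; apply: ler_wpM2l; [exact: ltW|exact: Hmax].
have S00 : S = 0.
  apply/eqP; rewrite eq_le S0 andbT.
  have := ler_wpM2l S0 Kab; move: SK; clear; nra.
move=> q qab; apply: (tangent_eq (i := i)); [exact: ss.1|exact: tangent0|exact: Hi|].
have := Hmax q qab; rewrite S00 => N0; apply/rowP => k; rewrite mxE.
apply/eqP; rewrite -normr_le0; apply: le_trans N0.
by rewrite /norm1 (bigD1 k) //= lerDl; exact: sumr_ge0.
Qed.

Definition X0 t : tuplevec := fun i => grad f i (y i t).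

(** Up to sign [X0] is the velocity, that is, the variation of the curve by a shift of time. *)
Lemma grad_sol : sol 0 l X0 (fun _ _ => 0).
Proof.
split=> [t tl|i a b a0 bl ich k]; first exact: grad_tangent.
have p := fun_prim ich (cod_open i) (grad_smooth k sf)
  (fun t tab => in_chart_cod ich tab).
apply: (prim_eq p) => // t tab.
by rewrite addE negE mxE add0r dgradE.
Qed.

Lemma sol_scale beta theta s w : prim 0 l beta theta -> cts 0 l theta -> sol 0 l s w ->
  sol 0 l (fun t i => beta t *: s t i) (fun t i => theta t *: s t i + beta t *: w t i).
Proof.
move=> pb ct ss; split=> [t tl|i a b a0 bl ich k].
  have := tangent_lin (beta t) (ss.1 t tl) (@tangent0 R n M (c t)).
  by rewrite (_ : (fun i => _) = (fun i => beta t *: s t i)) //; apply/funext => i;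
    rewrite addr0.
have pb' := prim_sub a0 bl pb.
apply: (prim_eq (primM pb' (ctsec_prim0 k ss ich))) => t tab.
  by rewrite mxE.
have d0 : dgrad f i (y i t) 0 = 0.
  have := dgrad_lin (-1) 0 0 sf (in_chart_cod ich tab).
  by rewrite !scaleN1r oppr0 addr0 addNr.
have := dgrad_lin (beta t) (s t i) 0 sf (in_chart_cod ich tab).
rewrite addr0 d0 addr0 => ->.
have aux (r q : R) (A B D : V) : r * (B 0 k - D 0 k) + A 0 k * q =
   (q *: A + r *: B - r *: D) 0 k by rewrite !mxE; ring.
exact: aux.
Qed.

Lemma label_prim : prim 0 l (fun t => f (c t)) (fun t => - inn X0 t).
Proof.
have cX : cts 0 l (inn X0) := ctsec_inn (ctsec_grad sf).
apply: (curve_ind (P := fun a b => prim a b (fun t => f (c t)) (fun t => - inn X0 t))) => //.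
  by move=> a b d _ ab bd _; exact: prim_cat.
move=> t i tl ti; exists 1 => // a b a0 ab bl _ _ ich; have [_ _ _ Hi] := ich.
have p := fun_prim ich (cod_open i) (@sf i) (fun t tab => in_chart_cod ich tab).
apply: (prim_eq p) => r rab; first by rewrite /= mcoordK //; exact: Hi.
rewrite (inn_chart (i := i)); [|exact: grad_tangent|exact: Hi].
by rewrite (met_grad _ sf (in_chart_cod ich rab)).
Qed.

Lemma label_decr t t' : 0 <= t -> t <= t' -> t' <= l -> f (c t') <= f (c t).
Proof.
move=> t0 tt' tl; rewrite -subr_le0 (prim_diff label_prim t0 tt' tl).
have := @Int_ge0 R t t' (inn X0) (fun r _ => inn_ge0 X0 r).
have cX : cts 0 l (inn X0) := ctsec_inn (ctsec_grad sf).
have iX : intg t t' (inn X0) by apply/(intg_sub t0 tl)/cts_intg.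
have := IntZ (-1) iX.
rewrite (@eq_Int _ t t' (fun u => - inn X0 u) (fun u => -1 * inn X0 u)); last first.
  by move=> r _; rewrite mulN1r.
by move=> ->; rewrite mulN1r oppr_le0.
Qed.

Lemma label_strict t : 0 <= t -> t < l -> 0 < inn X0 l -> f (c l) < f (c t).
Proof.
move=> t0 tl Xl; rewrite -subr_lt0 (prim_diff label_prim t0 (ltW tl) (lexx l)).
have cX : cts 0 l (inn X0) := ctsec_inn (ctsec_grad sf).
have ctl : cts t l (inn X0) := cts_sub t0 (lexx l) cX.
have := IntZ (-1) (cts_intg ctl).
rewrite (@eq_Int _ t l (fun u => - inn X0 u) (fun u => -1 * inn X0 u)); last first.
  by move=> r _; rewrite mulN1r.
move=> ->; rewrite mulN1r oppr_lt0.
by apply: (Int_gt0 ctl tl (fun r _ => inn_ge0 X0 r) (t0 := l)) => //; rewrite (ltW tl) lexx.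
Qed.

Lemma lin2E (r r' : R) (A B : V) k : (r *: A + r' *: B) 0 k = r * A 0 k + r' * B 0 k.
Proof. by rewrite !mxE. Qed.

Lemma negZE (r : R) (A : V) k : (- (r *: A)) 0 k = - r * A 0 k.
Proof. by rewrite !mxE mulNr. Qed.

(* Label variations supported where [f < r]. *)
Definition localized (r : R) (g : M -> R) : M -> R := fun x => flat 0 (r - f x) * g x.

Lemma localized_smooth r g : smooth_fun g -> smooth_fun (localized r g).
Proof.
move=> sg i; apply: salg_smooth; first exact: cod_open.
have h : salg (cod i) (fun z => flat 0 (r - f (mparam i z))).
  apply: (@salg_comp1 R _ _ (@flat R) 0%N); first exact: flat_derive.
  apply: (salg_add (u := fun=> r)); first exact: salg_cst.
  rewrite (_ : (fun z => - _) = (fun z : V => (-1) * (f \o mparam i) z)); last first.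
    by apply/funext => z; rewrite mulN1r.
  by apply: salg_mul; [exact: salg_cst|exact: salg_base (@sf i)].
by apply: salg_mul h _; exact: salg_base (@sg i).
Qed.

Lemma grad_localized r g i z : smooth_fun g -> cod i z ->
  grad (localized r g) i z =
  (- flat 1 (r - f (mparam i z)) * g (mparam i z)) *: grad f i z +
  flat 0 (r - f (mparam i z)) *: grad g i z.
Proof.
move=> sg zi; apply/rowP => k.
apply: etrans (gradE _ _ _ _) (etrans _ (esym (lin2E _ _ _ _ _))).
rewrite (gradE f) (gradE g) [X in X + _]mulr_sumr [X in _ + X]mulr_sumr -big_split /=.
apply: eq_bigr => q _.
rewrite [in X in _ = X + _]mulrA [in X in _ = _ + X]mulrA -mulrDl.
apply: (f_equal (fun r => r * invmx (mmet i z) q k)).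
have dF := smooth_derivable (v := e_ q) (@sf i) zi.
have dG := smooth_derivable (v := e_ q) (@sg i) zi.
have du : is_derive z (e_ q) (fun z => r - (f \o mparam i) z) (- pd q (f \o mparam i) z).
  have := is_deriveB (is_derive_cst r z (e_ q)) (derivableP dF).
  by rewrite sub0r.
have dw := is_derive_comp1 (ex_derive (is_derive := du)) (flat_derive 0 (r - f (mparam i z))).
have := is_deriveM dw (derivableP dG).
rewrite (derive_val (is_derive := du)).
move=> [_ E]; apply: etrans E _.
rewrite /GRing.scale /= -/(pd q (g \o mparam i) z).
move: (pd q _ _) (pd q _ _) (flat 0 _) (flat 1 _) => p1 p2 p3 p4; ring.
Qed.

(** The vectors at the end of the edge, in a fixed chart there, that a label variation produces from
    a section starting at zero. *)
Definition reach (eta : V) : Prop := exists delta s, [/\ smooth_fun delta,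
  sol 0 l s (fun t i => - grad delta i (y i t)), null s 0 &
  s l (mchart (c l)) = eta].

Lemma reach_lin (r : R) eta eta' : reach eta -> reach eta' -> reach (r *: eta + eta').
Proof.
move=> [d [s [sd ss s0 <-]]] [d' [s' [sd' ss' s0' <-]]].
exists (fun x => r * d x + d' x), (fun t i => r *: s t i + s' t i); split; last by [].
- exact: smooth_lin.
- have h := sol_lin r ss ss'; apply: (sol_ext _ _ _ h).
  - by move=> t tl; exact: h.1.
  - by move=> t tl i ti.
  move=> t tl i ti; rewrite (grad_lin r sd sd' (mcoord_cod ti)).
  by rewrite opprD scalerN.
- by move=> i ti; rewrite (s0 i ti) (s0' i ti) scaler0 addr0.
Qed.

Lemma reach0 : reach 0.
Proof.
exists (fun=> 0), (fun _ _ => 0); split; [exact: smooth_fcst| |by move=> i _|by []].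
have := sol_lin (-1) grad_sol grad_sol; apply: sol_ext.
- by move=> t tl; exact: tangent0.
- by move=> t tl i ti; rewrite scaleN1r addNr.
- by move=> t tl i ti; rewrite scaleN1r addNr grad_cst oppr0.
Qed.

Lemma sol_unique a b s s' w : 0 <= a -> a <= b -> b <= l -> sol a b s w -> sol a b s' w ->
  eq_tangent (c a) (s a) (s' a) -> forall t, a <= t <= b -> eq_tangent (c t) (s t) (s' t).
Proof.
move=> a0 ab bl ss ss' E t tab i ti.
have h := sol_vanish a0 ab bl (sol_lin (-1) ss ss').
have : null (fun t i => (-1) *: s t i + s' t i) t.
  apply: h => //; last by left=> j tj; rewrite (E j tj) scaleN1r addNr.
  by move=> t' _ j _; rewrite scaleN1r addNr.
by move=> /(_ i ti) /eqP; rewrite scaleN1r addrC subr_eq0 => /eqP.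
Qed.

(** * Edges at rest *)

Section ConstantEdge.
Hypothesis Xl : null X0 l.

(** Backward uniqueness for the homogeneous equation: a flow line does not reach a critical point in
    finite time unless it rests there. *)
Lemma grad_null t : 0 <= t <= l -> null X0 t.
Proof.
apply: (sol_vanish (lexx 0) l0 (lexx l) grad_sol); last by right.
by move=> t' _ i _.
Qed.

Lemma constant_curve t : 0 <= t <= l -> c t = c l.
Proof.
suff H : forall t, 0 <= t <= l -> c t = c 0.
  by move=> tl; rewrite H // (H l) // l0 lexx.
apply: (curve_ind (P := fun a b => forall t, a <= t <= b -> c t = c a)) => //.
  move=> a b d _ ab bd _ H1 H2 t' /andP[at' td].
  have [tb|bt] := leP t' b; first by apply: H1; rewrite at'.
  rewrite H2 ?td ?ltW // H1 // ab lexx //.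
move=> s i sl si; exists 1 => // a b a0 ab bl _ _ ich r rab.
have [_ _ _ Hi] := ich; have aab : a <= a <= b by rewrite lexx.
rewrite -(mcoordK (Hi r rab)) -(mcoordK (Hi a aab)); apply: (f_equal (mparam i)).
apply/rowP => k; have [/andP[ar rb] p] := (rab, y_prim k ich).
have := p.2 r rab; rewrite (@eq_Int _ a r _ (fun=> 0)).
  by rewrite Int_cst // mul0r addr0.
move=> q /andP[aq qr]; have qab : a <= q <= b by rewrite aq (le_trans qr).
have := grad_null (in_chart_l ich qab) (Hi q qab); rewrite /X0 => ->.
by rewrite mxE oppr0.
Qed.

End ConstantEdge.

Lemma fun_with_gradient i x (u : V) : mdom i x ->
  exists2 g : M -> R, smooth_fun g & grad g i (mcoord i x) = u.
Proof.
move=> xi; have [g [sg _ Hg]] := fun_with_differential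
  (fun k => (u *m mmet i (mcoord i x)) 0 k) xi.
exists g => //; rewrite gradM.
rewrite (_ : \row_k _ = u *m mmet i (mcoord i x)).
  by rewrite mulmxK // met_unit //; exact: mcoord_cod.
by apply/rowP => k; rewrite mxE Hg.
Qed.

(** At a critical point the derivative of the metric is multiplied by the gradient and disappears.
    Hence [dgrad] is given there by the coordinate Hessian, whose symmetry makes the energy work. *)
Lemma met_dgrad i z s u : cod i z -> grad f i z = 0 ->
  met i z (dgrad f i z s) u = 'D_s (fun z => 'D_u (f \o mparam i) z) z.
Proof.
move=> zi g0; pose F (z' : V) := \sum_k \sum_q (fun z => grad f i z 0 k * (u 0 q * mmet i z
  k q)) z'.
have E : 'D_s (fun z => 'D_u (f \o mparam i) z) z = 'D_s F z.
  apply: near_eq_derive; have := near_open (cod_open i) zi; apply: filterS => z' z'i.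
  rewrite -(met_grad _ sf z'i) metE /F; apply: eq_bigr => k _; apply: eq_bigr => q _.
  by rewrite mulrA.
have dm k q : derivable (fun z => u 0 q * mmet i z k q) z s.
  by apply: derivableZ; exact: smooth_derivable (mmet_entry_smooth i k q) zi.
have dg k : derivable (fun z => grad f i z 0 k) z s.
  exact: smooth_derivable (grad_smooth k sf) zi.
have dt k q : is_derive z s (fun z => grad f i z 0 k * (u 0 q * mmet i z k q))
    (u 0 q * mmet i z k q * dgrad f i z s 0 k).
  have h := is_deriveM (derivableP (dg k)) (derivableP (dm k q)).
  apply: is_derive_eq h _; rewrite g0 mxE scale0r add0r dgradE //.
rewrite E; have -> : F = \sum_k \sum_q (fun z => grad f i z 0 k * (u 0 q * mmet i z k q)).
  by apply/funext => z'; rewrite /F fct_sumE; apply: eq_bigr => k _; rewrite fct_sumE.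
rewrite derive_sum; last by move=> k; apply: derivable_sum => q; have [] := dt k q.
rewrite metE; apply: eq_bigr => k _; rewrite derive_sum; last by move=> q; have [] := dt k q.
apply: eq_bigr => q _; have [_ ->] := dt k q.
by rewrite [RHS]mulrC mulrA.
Qed.

(* The energy [<Hs, s> / 2 + <a, s>] is decreasing along [s' = - (a + Hs)], so
   that [s] can vanish at both ends only if [a = 0]. *)
Lemma const_inj (lp : 0 < l) (Xl : null X0 l) delta s : smooth_fun delta ->
  sol 0 l s (fun t i => - grad delta i (y i t)) -> null s 0 ->
  s l (mchart (c l)) = 0 -> grad delta (mchart (c l)) (y (mchart (c l)) l) = 0.
Proof.
set i := mchart (c l); set z := y i l => sd ss s0 sl.
have li : mdom i (c l) := mchartP (c l).
have cc := constant_curve Xl.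
have ich : in_chart l c i 0 l.
  by split=> // t tl; rewrite cc.
have yz t : 0 <= t <= l -> y i t = z by move=> tl; rewrite cc.
have zi : cod i z by exact: mcoord_cod.
have g0 : grad f i z = 0 by exact: Xl.
set a := grad delta i z; apply: contrapT => /eqP a0.
pose F := f \o mparam i.
pose Q p q := pd p (pd q F) z.
have Qs p q : Q p q = Q q p := schwarz (e_ p) (e_ q) (cod_open i) (@sf i) zi.
have dsum u p : met i z (dgrad f i z u) (e_ p) = \sum_q u 0 q * Q q p.
  apply: etrans (met_dgrad u (e_ p) zi g0) _.
  exact: (derive_dir u (cod_open i) (smooth_derive (e_ p) (@sf i)) zi).
(* Minus the derivative of [s]: the curve rests, so the equation has constant coefficients in the
   chart [i]. *)
pose rho t : V := a + dgrad f i z (s t i).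
pose A p := met i z a (e_ p).
pose r p t := A p + \sum_q s t i 0 q * Q q p.
have rE p t : r p t = met i z (rho t) (e_ p).
  have := met_linl i z 1 a (dgrad f i z (s t i)) (e_ p).
  by rewrite scale1r mul1r /rho => ->; rewrite dsum.
have sp k : prim 0 l (fun t => s t i 0 k) (fun t => - rho t 0 k).
  apply: (prim_eq (ctsec_prim0 k ss ich)) => // t tl.
  by rewrite (yz t tl) negE /rho addE opprD.
have rp p : prim 0 l (r p) (fun t => \sum_q - rho t 0 q * Q q p).
  have h := primD (prim_cst 0 l (A p))
     (prim_sum (index_enum _) (fun q => primZ (Q q p) (sp q))).
  apply: (prim_eq h) => t _.
    by rewrite /r; congr (_ + _); apply: eq_bigr => q _; rewrite mulrC.
  by rewrite add0r; apply: eq_bigr => q _; rewrite mulrC.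
(* The sum of the [s_p * (r_p + A_p)] is twice the energy. It is zero at both ends, while its
   derivative is [-2] times the squared length of [rho], which is positive at time [0] if [a] is
   nonzero. *)
have Ep := prim_sum (index_enum _) (fun p => primM (sp p) (primD (rp p) (prim_cst 0 l (A p)))).
have rhoc k : cts 0 l (fun t => rho t 0 k).
  have cs := sol_ctsec ss.
  apply: (@cts_ext _ _ _ (fun t => a 0 k + \sum_q s t i 0 q * pd q (fun z => grad f i z 0
    k) z)).
    by move=> t _; rewrite /rho addE dgrad_sum.
  apply: ctsD; first exact: cts_cst.
  by apply: cts_sum => q; apply: ctsM; [exact: (cs.2 i 0 l q ich)|exact: cts_cst].
have mE t : met i z (rho t) (rho t) = \sum_p rho t 0 p * r p t.
  apply: etrans (lin_sum (F := fun w => met i z w (rho t)) (rho t) _) _.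
    by move=> k u w; exact: met_linl.
  by apply: eq_bigr => p _; rewrite rE; apply: (f_equal (fun x => rho t 0 p * x));
    exact: met_sym.
have mc : cts 0 l (fun t => met i z (rho t) (rho t)).
  apply: (cts_ext (x := fun t => \sum_p rho t 0 p * r p t)) => [t _|]; first by rewrite mE.
  by apply: cts_sum => p; apply: ctsM => //; exact: prim_cts (rp p).
have s0i : s 0 i = 0 by apply: s0; have [_ _ _] := ich; apply; rewrite lexx.
have := prim_diff Ep (lexx 0) l0 (lexx l).
rewrite big1; last by move=> p _; rewrite sl mxE mul0r.
rewrite big1; last by move=> p _; rewrite s0i mxE mul0r.
rewrite subrr (@eq_Int _ 0 l _ (fun t => (-2) * met i z (rho t) (rho t))); last first.
  move=> t tl; rewrite big_split /=.
  have -> : \sum_p s t i 0 p * ((\sum_q - rho t 0 q * Q q p) + 0) =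
      - \sum_q rho t 0 q * (r q t - A q).
    under eq_bigr do rewrite addr0 mulr_sumr.
    rewrite exchange_big -sumrN; apply: eq_bigr => q _.
    rewrite /r addrAC subrr add0r -mulrN -sumrN mulr_sumr; apply: eq_bigr => p _.
    by rewrite (Qs q p); ring.
  rewrite mE mulr_sumr -sumrN -big_split /=; apply: eq_bigr => p _; ring.
rewrite IntZ; last exact: cts_intg.
have m0 t : 0 <= t <= l -> 0 <= met i z (rho t) (rho t) by move=> _; exact: met_ge0.
have r0 : rho 0 = a.
  rewrite /rho s0i; have := dgrad_lin (-1) 0 0 sf zi.
  by rewrite !scaleN1r oppr0 addr0 addNr => ->; rewrite addr0.
have ma : 0 < met i z (rho 0) (rho 0) by rewrite r0; exact: met_pos.
have z0l : 0 <= (0 : R) <= l by rewrite lexx.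
have := Int_gt0 mc lp m0 z0l ma.
by move=> p /eqP; rewrite eq_sym mulf_eq0 oppr_eq0 pnatr_eq0 /= => /eqP E; rewrite E ltxx in p.
Qed.

Lemma L2_neg_grad d : smooth_fun d -> L2_section l c (fun t i => - grad d i (y i t)).
Proof.
move=> sd; have := L2_lin (-1) (ctsec_L2 (ctsec_grad sd)) (ctsec_L2 (ctsec_grad
  (@smooth_fcst R n M 0))).
rewrite (_ : (fun t i => _) = (fun t i => - grad d i (y i t))) //.
by apply/funext => t; apply/funext => j; rewrite grad_cst addr0 scaleN1r.
Qed.

Lemma const_reach (lp : 0 < l) (Xl : null X0 l) eta : reach eta.
Proof.
set i := mchart (c l); pose P (u w : V) := exists delta s, [/\ smooth_fun delta,
  sol 0 l s (fun t i => - grad delta i (y i t)), null s 0, grad delta i (y i l) = u &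
  s l i = w].
have zi : cod i (y i l) by exact: mcoord_cod (mchartP _).
suff [u [d [s [sd ss s0 _ E]]]] : exists u, P u eta by exists d, s.
apply: linear_rel_surj; move=> {eta}.
- have [d [s [sd ss s0 E]]] := reach0; exists d, s; split=> //.
  exact: const_inj ss s0 E.
- move=> r u w u' w' [d [s [sd ss s0 <- <-]]] [d' [s' [sd' ss' s0' <- <-]]].
  exists (fun x => r * d x + d' x), (fun t i => r *: s t i + s' t i); split; last by [].
  + exact: smooth_lin.
  + have h := sol_lin r ss ss'; apply: (sol_ext _ _ _ h).
    * by move=> t tl; exact: h.1.
    * by move=> t tl j tj.
    move=> t tl j tj; rewrite (grad_lin r sd sd' (mcoord_cod tj)).
    by rewrite opprD scalerN.
  + by move=> j tj; rewrite (s0 j tj) (s0' j tj) scaler0 addr0.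
  + exact: grad_lin.
- move=> u; have [d sd E] := fun_with_gradient u (mchartP (c l)).
  have Ld := L2_neg_grad sd.
  have [s ss s0] := sol_exists Ld (@tangent0 R n M (c 0)).
  by exists (s l i), d, s.
- move=> u [d [s [sd ss s0 <- E]]]; exact: const_inj ss s0 E.
Qed.

Lemma cts_flat (j : nat) a b x : cts a b x -> cts a b (fun t => flat j (x t)).
Proof.
move=> xc t tab e e0.
have cf : {for x t, continuous (flat (R := R) j)}.
  apply: differentiable_continuous; apply/derivable1_diffP.
  by have [] := flat_derive j (x t).
have /cvgrPdist_lt /(_ e e0) /nbhs_ballP[d /= d0 H] := cf.
have [d' d'0 H'] := xc t tab d d0; exists d' => // t' t'ab tt'.
by rewrite distrC; apply: H; rewrite /ball /= distrC; exact: H'.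
Qed.

Lemma fun_cts g : smooth_fun g -> cts 0 l (fun t => g (c t)).
Proof.
move=> sg; apply: (curve_ind (P := fun a b => cts a b (fun t => g (c t)))) => //.
  by move=> a b d _ ab bd _; exact: cts_cat.
move=> t i tl ti; exists 1 => // a b a0 ab bl _ _ ich; have [_ _ _ Hi] := ich.
apply: (cts_ext _ (smooth_cts ich (@sg i))) => r rab.
by rewrite /= mcoordK //; exact: Hi.
Qed.

Lemma cts_prim a b x : cts a b x -> prim a b (fun t => Int a t x) x.
Proof. by move=> xc; split; [exact: cts_intg|move=> t tab; rewrite Int_pt add0r]. Qed.

(** * Edges in motion *)

Section MovingEdge.
Hypotheses (lp : 0 < l) (Xl : 0 < inn X0 l).
Local Notation i := (mchart (c l)).

(* [X0] solves the homogeneous equation, so [beta *: X0] solves the equation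
   with right-hand side [theta *: X0] when [beta' = theta]; for
   [theta = flat 1 (r - f)] this is [- grad delta] with [delta = flat 0 (r - f)]. *)
Lemma reach_velocity : reach (X0 l i).
Proof.
pose th t := flat 1 (f (c 0) - f (c t)).
have thc : cts 0 l th.
  by apply: cts_flat; apply: ctsB; [exact: cts_cst|exact: fun_cts].
have th0 t : 0 <= t <= l -> 0 <= th t by move=> _; exact: flat1_ge0.
have thl : 0 < th l.
  by apply: flat1_gt0; rewrite subr_gt0; exact: label_strict.
have ll : 0 <= l <= l by rewrite l0 lexx.
have b0 := Int_gt0 thc lp th0 ll thl.
have s1 := smooth_fcst (M := M) 1.
have ss := sol_scale (cts_prim thc) thc grad_sol.
suff H : reach (Int 0 l th *: X0 l i).
  have := reach_lin (Int 0 l th)^-1 H reach0.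
  by rewrite addr0 scalerA mulVf ?scale1r // gt_eqF.
exists (localized (f (c 0)) (fun=> 1)), (fun t i => Int 0 t th *: X0 t i).
split; [exact: localized_smooth| | |by []].
  apply: (sol_ext _ _ _ ss).
  - by move=> t tl; exact: ss.1.
  - by move=> t tl j tj.
  move=> t tl j tj; rewrite (grad_localized _ s1 (mcoord_cod tj)) grad_cst !scaler0 !addr0.
  by rewrite mulr1 scaleNr opprK mcoordK.
by move=> j tj; rewrite Int_pt scale0r.
Qed.

(** The solution for the full gradient of the localized variation is [s] plus a multiple of [X0],
    and [reach_velocity] allows that multiple to be subtracted. *)
Lemma reach_localized t1 g s : smooth_fun g ->
  sol 0 l s (fun t j => - (flat 0 (f (c t1) - f (c t)) *: grad g j (y j t))) ->
  null s 0 -> reach (s l i).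
Proof.
move=> sg ss s0; pose th t := flat 1 (f (c t1) - f (c t)) * g (c t).
have thc : cts 0 l th.
  apply: ctsM; last exact: fun_cts.
  by apply: cts_flat; apply: ctsB; [exact: cts_cst|exact: fun_cts].
have s1 := sol_scale (cts_prim thc) thc grad_sol.
suff H : reach (Int 0 l th *: X0 l i + s l i).
  have := reach_lin (- Int 0 l th) reach_velocity H.
  by rewrite scaleNr addrA addNr add0r.
exists (localized (f (c t1)) g), (fun t j => 1 *: (Int 0 t th *: X0 t j) + s t j).
split; [exact: localized_smooth| | |by rewrite scale1r].
  apply: (sol_ext _ _ _ (sol_lin 1 s1 ss)).
  - by move=> t tl; exact: (sol_lin 1 s1 ss).1.
  - by move=> t tl j tj.
  move=> t tl j tj; rewrite (grad_localized _ sg (mcoord_cod tj)).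
  by rewrite scale1r scaler0 addr0 mcoordK // opprD mulNr scaleNr opprK.
by move=> j tj; rewrite (s0 j tj) Int_pt scale0r scaler0 addr0.
Qed.

(** A covector [lam] killing [reach] turns the approximation in every direction into the control of
    one sign. With [grad g = lam] in coordinates at [c l] and the variation confined to the last
    [tau] of the edge, the pairing of [lam] with [s l] is at most [- (L / 2) * Psi] plus an error of
    order [tau * Psi], so it cannot vanish. *)
Lemma moving_reach eta : reach eta.
Proof.
move: eta; have [//|[lam lam0 Hlam]] := annihilator reach0 reach_lin.
exfalso.
have ll : 0 <= l <= l by rewrite l0 lexx.
have li := mchartP (c l).
have [g sg gl] := fun_with_gradient lam li.
have [a0 [b0 [ich [e e0 He]]]] := closed_chart ll li.
have [K K0 HK] := chart_const ich.
have gc k : cts a0 b0 (fun t => grad g i (y i t) 0 k) by exact: grad_cts.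
have [G G0 HG] := cts_bounded (cts_sum (index_enum _) (fun k => cts_norm (gc k))).
pose h t := \sum_k lam 0 k * grad g i (y i t) 0 k.
have hc : cts a0 b0 h by apply: cts_sum => k; exact: ctsZ.
pose L := \sum_k lam 0 k ^+ 2.
have L0 : 0 < L.
  have [k lk] : exists k, lam 0 k != 0.
    apply: contrapT => /forallNP H; move/eqP: lam0; apply; apply/rowP => k.
    by rewrite mxE; apply/eqP/negPn/negP; exact: H.
  rewrite /L (bigD1 k) //= ltr_pwDl //; first by rewrite exprn_even_gt0.
  by apply: sumr_ge0 => q _; exact: sqr_ge0.
have hl : h l = L by rewrite /h gl; apply: eq_bigr => k _; rewrite expr2.
have lab : a0 <= l <= b0 by apply: He => //; rewrite subrr normr0.
have L2p : 0 < L / 2 by lra.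
have [d d0 Hd] := hc l lab _ L2p.
pose Lam := norm1 lam + 1.
have Lam0 : 0 < Lam by rewrite ltr_wpDl // norm1_ge0.
(* In this order: stay in the chart, keep [h] above [L / 2], make [sol_bound_loc] applicable, and
   keep the error below [L / 4 * Psi], half of the main term. *)
pose m := Num.min (e / 2) (Num.min (d / 2) (Num.min (1 / (2 * K)) (L / (8 * (Lam * K * G))))).
have m0 : 0 < m.
  by rewrite !lt_min; apply/and4P; split; rewrite divr_gt0 ?mulr_gt0.
pose tau := Num.min l m.
have tau0 : 0 < tau by rewrite lt_min lp.
have taul : tau <= l by rewrite ge_min lexx.
have taum : tau <= m by rewrite ge_min lexx orbT.
have m1 : m <= e / 2 by rewrite ge_min lexx.
have m2 : m <= d / 2 by rewrite !ge_min lexx !orbT.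
have m3 : m <= 1 / (2 * K) by rewrite !ge_min lexx !orbT.
have m4 : m <= L / (8 * (Lam * K * G)) by rewrite !ge_min lexx !orbT.
pose t1 := l - tau.
have t10 : 0 <= t1 by rewrite subr_ge0.
have t1l : t1 < l by rewrite ltrBlDr ltrDl.
have lt1 : l - t1 = tau by rewrite /t1; ring.
have near_l t : t1 <= t <= l -> `|t - l| <= tau.
  by move=> /andP[h1 h2]; rewrite ler_norml; apply/andP; split; lra.
have sub t : t1 <= t <= l -> a0 <= t <= b0.
  move=> tl; apply: He; first by case/andP: tl => h1 ->; rewrite (le_trans t10).
  have := near_l t tl; lra.
have ha t : t1 <= t <= l -> L / 2 <= h t.
  move=> tl; have td : `|t - l| < d by have := near_l t tl; lra.
  have := Hd t (sub t tl) td; rewrite hl ltr_norml => /andP[].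
  by lra.
have iab : in_chart l c i t1 l.
  by split=> //; [exact: ltW|move=> t tl; have [_ _ _] := ich; apply; exact: sub].
pose psi t := flat 0 (f (c t1) - f (c t)).
have psic : cts 0 l psi.
  by apply: cts_flat; apply: ctsB; [exact: cts_cst|exact: fun_cts].
have psi0 t : 0 <= psi t by exact: flat_ge0.
have psil : 0 < psi l by apply: flat_gt0; rewrite subr_gt0; exact: label_strict.
pose w t j : V := - (psi t *: grad g j (y j t)).
have wc : ctsec w.
  split=> [t tl|j a b k ich'].
    have := tangent_lin (- psi t) (grad_tangent (x := c t) sg) (@tangent0 R n M (c t)).
    by rewrite (_ : (fun i => _) = w t) //; apply/funext => j; rewrite addr0 scaleNr.
  have [aa _ bb _] := ich'.
  apply: (cts_ext (x := fun t => - psi t * grad g j (y j t) 0 k)).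
    by move=> t _; rewrite /w negZE.
  by apply: ctsM; [apply/ctsN; exact: cts_sub psic|exact: grad_cts].
have Lw := ctsec_L2 wc.
have [s ss s0] := sol_exists Lw (@tangent0 R n M (c 0)).
have sl : \sum_k lam 0 k * s l i 0 k = 0 by apply: Hlam; exact: reach_localized sg ss s0.
(* Before [t1] the label [f] is at least [f (c t1)], so the cutoff is zero and the section does not
   leave zero. *)
have s1 : null s t1.
  have ss1 := sol_sub (lexx 0) (ltW t1l) ss.
  have nw t : 0 <= t <= t1 -> null w t.
    move=> /andP[h1 h2] j tj; rewrite /w /psi flat_le0 ?scale0r ?oppr0 //.
    by rewrite subr_le0; apply: label_decr => //; exact: ltW.
  apply: (sol_vanish (lexx 0) t10 (ltW t1l) ss1 nw (or_introl s0)).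
  by rewrite t10 lexx.
have ss2 := sol_sub t10 (lexx l) ss.
have Kt : K * (l - t1) <= 1 / 2.
  rewrite lt1; apply: (@le_trans _ _ (K * (1 / (2 * K)))).
    by apply: ler_wpM2l; [exact: ltW|lra].
  by rewrite le_eqVlt; apply/orP; left; apply/eqP; field; exact: lt0r_neq0.
have [Hs _] := sol_bound_loc iab K0 (fun t tl => HK t (sub t tl)) Kt Lw ss2.
have [_ _ _ Hi] := iab.
have tl1 : t1 <= t1 <= l by rewrite lexx ltW.
have psic1 : cts t1 l psi := cts_sub t10 (lexx l) psic.
set Psi := Int t1 l psi.
have Psi0 : 0 < Psi.
  by apply: (Int_gt0 psic1 t1l (fun t _ => psi0 t) (t0 := l)) => //; rewrite ltW //= lexx.
have Gt t : t1 <= t <= l -> norm1 (grad g i (y i t)) <= G.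
  by move=> tl; apply: le_trans (ler_norm _) (HG t (sub t tl)).
have wn t : t1 <= t <= l -> norm1 (w t i) <= G * psi t.
  move=> tl; rewrite /w /norm1; under eq_bigr do rewrite negZE normrM normrN.
  rewrite -mulr_sumr ger0_norm // mulrC; apply: ler_wpM2r => //; exact: Gt.
have sn t : t1 <= t <= l -> norm1 (s t i) <= 2 * (G * Psi).
  move=> tl; apply: le_trans (Hs t tl) _; apply: ler_wpM2l => //.
  rewrite (s1 i (Hi _ tl1)) (_ : norm1 0 = 0) ?add0r; last first.
    by rewrite /norm1 big1 // => k _; rewrite mxE normr0.
  rewrite -IntZ; last exact: cts_intg.
  apply: le_Int; last exact: wn.
    by apply/cts_intg/(norm1_cts iab) => k; exact: (wc.2 i t1 l k iab).
  exact/intgZ/cts_intg.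
have pk k := sol_prim k ss2 iab.
have E : 0 = Int t1 l (fun t => \sum_k lam 0 k * (w t i 0 k - dgrad f i (y i t) (s t i) 0 k)).
  rewrite Int_sum; last by move=> k; apply: intgZ; exact: (pk k).1.
  rewrite -[LHS]sl; apply: eq_bigr => k _; rewrite IntZ; last exact: (pk k).1.
  rewrite -(prim_diff (pk k) (lexx _) (ltW t1l) (lexx _)).
  by rewrite (s1 i (Hi _ tl1)) mxE subr0.
(* Bounds the pairing of [lam] with the zero-order term, by [sn] and the constant [K]; integrated
   over length [tau], it is the error. *)
pose D := Lam * (K * (2 * (G * Psi))).
have : 0 <= Int t1 l (fun t => - (L / 2) * psi t + D).
  rewrite [leLHS]E; apply: le_Int.
  - by apply: intg_sum => k; apply: intgZ; exact: (pk k).1.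
  - by apply: intgD; [exact/intgZ/cts_intg|exact: intg_cst].
  move=> t tl; under eq_bigr do rewrite mulrBr.
  rewrite sumrB; apply: lerD.
    have -> : \sum_k lam 0 k * w t i 0 k = - (psi t * h t).
      rewrite /h mulr_sumr -sumrN; apply: eq_bigr => k _.
      by rewrite /w negZE; ring.
    rewrite mulNr lerN2 [leLHS]mulrC; apply: ler_wpM2l => //; exact: ha.
  rewrite -sumrN; apply: le_trans (ler_norm _) _; apply: le_trans (ler_norm_sum _ _ _) _.
  apply: (@le_trans _ _ (\sum_k Lam * `|dgrad f i (y i t) (s t i) 0 k|)).
    apply: ler_sum => k _; rewrite normrN normrM; apply: ler_wpM2r => //.
    rewrite /Lam /norm1 (bigD1 k) //= -addrA lerDl addr_ge0 //; exact: sumr_ge0.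
  rewrite -mulr_sumr; apply: ler_wpM2l; first exact: ltW.
  have [_ _ hd _] := HK t (sub t tl) (s t i).
  by apply: le_trans hd _; apply: ler_wpM2l; [exact: ltW|exact: sn].
rewrite IntD; [|exact/intgZ/cts_intg|exact: intg_cst].
rewrite IntZ; last exact: cts_intg.
rewrite (Int_cst _ (ltW t1l)) lt1 -/Psi /D.
have kg0 : 0 < Lam * K * G by rewrite !mulr_gt0.
have tk : 8 * (Lam * K * G) * tau <= L.
  have h8 : 0 < 8 * (Lam * K * G) by rewrite mulr_gt0.
  by rewrite mulrC -ler_pdivlMr //; exact: le_trans taum m4.
have aux (A B P T : R) : 0 < P -> 0 < B -> 8 * A * T <= B ->
  - (B / 2) * P + 2 * A * P * T < 0 by move=> *; nra.
have -> : Lam * (K * (2 * (G * Psi))) * tau = 2 * (Lam * K * G) * Psi * tau by ring.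
by rewrite leNgt aux.
Qed.

End MovingEdge.

(** * The right inverse on a single edge *)

Lemma reach_all (lp : 0 < l) eta : reach eta.
Proof.
have li := mchartP (c l).
have [E|X] := eqVneq (X0 l (mchart (c l))) 0.
  apply: const_reach => //; apply: (tangent_eq (i := mchart (c l))) => //.
    exact: grad_tangent.
  exact: tangent0.
by apply: moving_reach => //; exact: met_pos (mcoord_cod li) X.
Qed.

(** The last clause concerns only end values of solutions that start at zero. This form includes
    edges of length zero, where such an end value is zero and any solution may serve as [sg k]. *)
Lemma edge_basis : exists (delta : 'I_n -> M -> R) (sg : 'I_n -> R -> tuplevec),
  [/\ forall k, smooth_fun (delta k),
      forall k, sol 0 l (sg k) (fun t i => - grad (delta k) i (y i t)),
      forall k, null (sg k) 0 &
      forall s w, sol 0 l s w -> null s 0 ->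
        \sum_k s l (mchart (c l)) 0 k *: sg k l (mchart (c l)) = s l (mchart (c l))].
Proof.
have [lp|] := ltP 0 l; last first.
  move=> l00; have lE : l = 0 by apply/eqP; rewrite eq_le l00 l0.
  have [d [s [sd ss s0 _]]] := reach0.
  exists (fun _ => d), (fun _ => s); split=> // s' w' _ s'0.
  have -> : s' l (mchart (c l)) = 0.
    by rewrite lE; apply: s'0; exact: mchartP.
  by rewrite big1 // => k _; rewrite mxE scale0r.
have /choice[d Hd] : forall k, exists d, exists s, [/\ smooth_fun d,
    sol 0 l s (fun t i => - grad d i (y i t)), null s 0 & s l (mchart (c l)) = e_ k].
  by move=> k; exact: reach_all.
have /choice[s Hs] := Hd; exists d, s; split=> [k|k|k|s' w' _ _]; try by have [] := Hs k.
rewrite [RHS]row_sum; apply: eq_bigr => k _; by have [_ _ _ ->] := Hs k.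
Qed.

Lemma sol_sum (r : seq 'I_n) (kap : 'I_n -> R) (sg om : 'I_n -> R -> tuplevec) s w :
  (forall k, sol 0 l (sg k) (om k)) -> sol 0 l s w ->
  sol 0 l (fun t i => \sum_(k <- r) kap k *: sg k t i + s t i)
    (fun t i => \sum_(k <- r) kap k *: om k t i + w t i).
Proof.
move=> H ss; elim: r => [|k r IH].
  rewrite (_ : (fun t i => _ + s t i) = s); last first.
    by apply/funext => t; apply/funext => i; rewrite big_nil add0r.
  rewrite (_ : (fun t i => _ + w t i) = w) //.
  by apply/funext => t; apply/funext => i; rewrite big_nil add0r.
have := sol_lin (kap k) (H k) IH.
rewrite (_ : (fun t i => _ *: sg k t i + _) = (fun t i => \sum_(k <- k :: r) kap k *: sg k
  t i + s t i)); last first.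
  by apply/funext => t; apply/funext => i; rewrite big_cons addrA.
rewrite (_ : (fun t i => _ *: om k t i + _) = (fun t i => \sum_(k <- k :: r) kap k *: om k
  t i + w t i)) //.
by apply/funext => t; apply/funext => i; rewrite big_cons addrA.
Qed.

Lemma L2_sum (r : seq 'I_n) (kap : 'I_n -> R) (om : 'I_n -> R -> tuplevec) w :
  (forall k, L2_section l c (om k)) -> L2_section l c w ->
  L2_section l c (fun t i => \sum_(k <- r) kap k *: om k t i + w t i).
Proof.
move=> H Lw; elim: r => [|k r IH].
  rewrite (_ : (fun t i => _ + w t i) = w) //.
  by apply/funext => t; apply/funext => i; rewrite big_nil add0r.
have := L2_lin (kap k) (H k) IH.
rewrite (_ : (fun t i => _ *: om k t i + _) = (fun t i => \sum_(k <- k :: r) kap k *: om k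
  t i + w t i)) //.
by apply/funext => t; apply/funext => i; rewrite big_cons addrA.
Qed.

Lemma inn_parallelogram (r : R) X Z t :
  inn (fun t i => r *: X t i + Z t i) t <= 2 * r ^+ 2 * inn X t + 2 * inn Z t.
Proof. exact: met_parallelogram (mcoord_cod (mchartP _)). Qed.

Lemma inn_null X t : null X t -> inn X t = 0.
Proof.
move=> /(_ _ (mchartP (c t))) E; rewrite /inn /inner E.
by have := metZ (mchart (c t)) (y (mchart (c t)) t) 0 0 0; rewrite scale0r mul0r.
Qed.

Lemma inn_sum (r : seq 'I_n) (X : 'I_n -> R -> tuplevec) :
  (forall k, ctsec (X k)) -> exists2 C : R, 0 <= C &
  forall (kap : 'I_n -> R) (B : R) Z t, (forall k, kap k ^+ 2 <= B) -> 0 <= B -> 0 <= t <= l ->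
  inn (fun t i => \sum_(k <- r) kap k *: X k t i + Z t i) t <= C * (B + inn Z t).
Proof.
move=> cX; elim: r => [|k r [C C0 IH]].
  exists 1 => // kap B Z t _ B0 tl; rewrite mul1r.
  rewrite (_ : inn _ t = inn Z t) ?lerDr //.
  by rewrite /inn /inner; congr bilin; rewrite big_nil add0r.
have [D D0 HD] := cts_bounded (ctsec_inn (cX k)).
exists (2 * D + 2 * C); first by rewrite addr_ge0 // mulr_ge0 // ltW.
move=> kap B Z t HB B0 tl.
rewrite (_ : inn _ t = inn (fun t i => kap k *: X k t i +
  (fun t i => \sum_(k <- r) kap k *: X k t i + Z t i) t i) t); last first.
  by rewrite /inn /inner; congr bilin; rewrite big_cons addrA.
apply: le_trans (inn_parallelogram _ _ _ _) _; rewrite [leRHS]mulrDl; apply: lerD.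
  have -> : 2 * kap k ^+ 2 * inn (X k) t = 2 * (inn (X k) t * kap k ^+ 2) by ring.
  rewrite -mulrA; apply: ler_wpM2l => //; apply: ler_pM => //.
  - exact: inn_ge0.
  - exact: sqr_ge0.
  - exact: le_trans (ler_norm _) (HD t tl).
  - by apply: le_trans (HB k) _; rewrite lerDl inn_ge0.
by rewrite -mulrA; apply: ler_wpM2l => //; exact: IH.
Qed.

Lemma cohess_bound : exists2 C : R, 0 <= C & forall X t, 0 <= t <= l ->
  is_tangent (c t) (X t) ->
  inn (fun t i => cohess f i (y i t) (X t i)) t <= C * inn X t.
Proof.
apply: (curve_ind (P := fun a b => exists2 C : R, 0 <= C & forall X t, a <= t <= b ->
  is_tangent (c t) (X t) ->
  inn (fun t i => cohess f i (y i t) (X t i)) t <= C * inn X t)) => //.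
  move=> a b d _ ab bd _ [C1 C10 H1] [C2 C20 H2]; exists (C1 + C2); first exact: addr_ge0.
  move=> X t /andP[at' td] tX; have I0 := inn_ge0 X t; rewrite mulrDl.
  have [tb|bt] := leP t b.
    have := H1 X t; rewrite at' tb => /(_ isT tX) h; apply: le_trans h _.
    by rewrite lerDl mulr_ge0.
  have := H2 X t; rewrite td (ltW bt) => /(_ isT tX) h; apply: le_trans h _.
  by rewrite lerDr mulr_ge0.
move=> t i tl ti; have [a0 [b0 [ich [e e0 He]]]] := closed_chart tl ti.
have [K K0 HK] := chart_const ich.
have cc (p k : 'I_n) : cts a0 b0 (fun t => cohess f i (y i t) (e_ p) 0 k).
  apply: (@cts_ext _ _ _ (fun t => pd p (fun z => grad f i z 0 k) (y i t) +
    \sum_q \sum_r grad f i (y i t) 0 q * e_ p 0 r * christoffel i (y i t) (e_ q) (e_ r) 0 k)).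
    move=> s sab; have yi := in_chart_cod ich sab.
    rewrite -(christoffel_sum (grad f i (y i s)) (e_ p) k yi) cohessE.
    apply: etrans _ (esym (addE _ _ _)).
    exact: (f_equal (fun r => r + christoffel i (y i s) (grad f i (y i s)) (e_ p) 0 k)
      (esym (@dgradE _ _ M f i (y i s) (e_ p) k))).
  apply: ctsD; first exact: smooth_cts ich (smooth_derive _ (grad_smooth k sf)).
  apply: cts_sum => q; apply: cts_sum => r; apply: ctsM;
    last exact: smooth_cts ich (christoffel_smooth _ _ k).
  by apply: ctsM; [exact: grad_cts ich|exact: cts_cst].
pose F p q t := met i (y i t) (cohess f i (y i t) (e_ p)) (cohess f i (y i t) (e_ q)).
have cF p q : cts a0 b0 (F p q).
  apply: (@cts_ext _ _ _ (fun t => \sum_k \sum_r cohess f i (y i t) (e_ p) 0 k *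
      cohess f i (y i t) (e_ q) 0 r * mmet i (y i t) k r)).
    by move=> s _; rewrite /F metE.
  apply: cts_sum => k; apply: cts_sum => r; apply: ctsM; first exact: ctsM.
  exact: smooth_cts ich (mmet_entry_smooth i k r).
have [D D0 HD] := cts_bounded (cts_sum (index_enum _) (fun p => cts_sum (index_enum _) (fun
  q => cts_norm (cF p q)))).
exists e => // a b a0' ab bl ta bt iab; exists (D * K); first by rewrite mulr_ge0 // ltW.
move=> X s sab tX; have sl := in_chart_l iab sab.
have sab' : a0 <= s <= b0 by apply: He => //; exact: near_itv (lexx e) ta bt sab.
have [_ _ _ Hi] := iab; have si := Hi s sab; have yi := mcoord_cod si.
have tC : is_tangent (c s) (fun i => cohess f i (y i s) (X s i)) by exact: cohess_tangent.
rewrite (inn_chart tC si) (inn_chart tX si).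
have E : met i (y i s) (cohess f i (y i s) (X s i)) (cohess f i (y i s) (X s i)) =
    \sum_p \sum_q X s i 0 p * X s i 0 q * F p q s.
  apply: etrans (lin_sum (F := fun u => met i (y i s) (cohess f i (y i s) u) (cohess f i (y
    i s) (X s i))) (X s i) _) _.
    by move=> r u w; rewrite (cohess_lin _ _ _ sf yi) met_linl.
  apply: eq_bigr => p _.
  rewrite (lin_sum (F := fun u => met i (y i s) (cohess f i (y i s) (e_ p)) (cohess f i (y
    i s) u)) (X s i)).
    by rewrite mulr_sumr; apply: eq_bigr => q _; rewrite mulrA.
  by move=> r u w; rewrite (cohess_lin _ _ _ sf yi) (met_linr _ _ _ _ yi).
rewrite E; apply: (@le_trans _ _ (D * norm1 (X s i) ^+ 2)); last first.
  by rewrite -mulrA; apply: ler_wpM2l; [exact: ltW|have [] := HK s sab' (X s i)].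
apply: (@le_trans _ _ ((\sum_p \sum_q `|F p q s|) * norm1 (X s i) ^+ 2)); last first.
  by apply: ler_wpM2r; [exact: sqr_ge0|exact: le_trans (ler_norm _) (HD s sab')].
rewrite mulr_suml; apply: ler_sum => p _; rewrite mulr_suml; apply: ler_sum => q _.
apply: le_trans (ler_norm _) _; rewrite !normrM mulrC; apply: ler_wpM2l => //.
rewrite expr2; apply: ler_pM => //.
  by rewrite /norm1 (bigD1 p) //= lerDl; exact: sumr_ge0.
by rewrite /norm1 (bigD1 q) //= lerDl; exact: sumr_ge0.
Qed.

(** The solution [S w] starting at zero is corrected by the [sg k], weighted with minus the
    coordinates of its own end value. The [delta k] do not depend on [w], which keeps the label
    directions finite in number. [S] is obtained by choice; its linearity is recovered from
    [sol_unique], hence holds up to [eq_tangent]. *)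
Lemma edge_inverse : exists (delta : 'I_n -> M -> R) (kap : (R -> tuplevec) -> 'I_n -> R)
    (s ds : (R -> tuplevec) -> R -> tuplevec) (C : R),
  [/\ forall k, smooth_fun (delta k), 0 <= C,
   forall w, L2_section l c w ->
     [/\ W12_section l c v (s w) (ds w), null (s w) 0, null (s w) l,
      forall t, 0 <= t <= l -> forall i, mdom i (c t) ->
        ds w t i + cohess f i (y i t) (s w t i) +
        \sum_k kap w k *: grad (delta k) i (y i t) = w t i &
      [/\ forall k, ((kap w k ^+ 2)%:E <= C%:E * l2sq l c w)%E,
        (l2sq l c (s w) <= C%:E * l2sq l c w)%E &
        (l2sq l c (ds w) <= C%:E * l2sq l c w)%E]] &
   forall r w w', L2_section l c w -> L2_section l c w' ->
     (forall k, kap (fun t i => r *: w t i + w' t i) k = r * kap w k + kap w' k) /\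
     forall t, 0 <= t <= l -> eq_tangent (c t) (s (fun t i => r *: w t i + w' t i) t)
       (fun i => r *: s w t i + s w' t i)].
Proof.
have aux (a m : R) : a ^+ 2 <= a * m -> 0 <= m -> 0 <= a.
  move=> h m0; rewrite leNgt; apply/negP => a0.
  have : 0 < a ^+ 2 by rewrite exprn_even_gt0 //= lt_eqF.
  by have : a * m <= 0 by [rewrite nmulr_rle0]; lra.
have [delta [sg [dS sS s0 sE]]] := edge_basis.
have /choice[S HS] : forall w, exists s, L2_section l c w -> sol 0 l s w /\ null s 0.
  (* Outside the square integrable fields [w] itself serves as a dummy value. *)
  move=> w; have [Lw|nw] := pselect (L2_section l c w); last by exists w.
  by have [s ss z] := sol_exists Lw (@tangent0 R n M (c 0)); exists s.
set il := mchart (c l); have li : mdom il (c l) := mchartP (c l).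
pose kap w k : R := - S w l il 0 k.
pose s w t i : V := \sum_k kap w k *: sg k t i + S w t i.
pose om k t i : V := - grad (delta k) i (y i t).
pose ws w t i : V := \sum_k kap w k *: om k t i + w t i.
pose ds w t i : V := ws w t i - cohess f i (y i t) (s w t i).
have ss w : L2_section l c w -> sol 0 l (s w) (ws w).
  by move=> Lw; exact: (sol_sum (index_enum _) (kap w) sS (HS w Lw).1).
have Lom k : L2_section l c (om k) by exact: L2_neg_grad.
have Lws w : L2_section l c w -> L2_section l c (ws w).
  by move=> Lw; exact: (L2_sum (index_enum _) (kap w) Lom Lw).
have com k : ctsec (om k).
  have := ctsec_grad (smooth_lin (-1) (dS k) (@smooth_fcst R n M 0)).
  move=> [h1 h2]; split=> [t tl|i a b q ich].
    move=> i j ti tj; have := h1 t tl i j ti tj.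
    rewrite (grad_lin _ (dS k) (@smooth_fcst R n M 0) (mcoord_cod ti)).
    rewrite (grad_lin _ (dS k) (@smooth_fcst R n M 0) (mcoord_cod tj)).
    by rewrite !grad_cst !addr0 !scaleN1r.
  by apply: (cts_ext (x := fun t => - grad (delta k) i (y i t) 0 q)) => [t _|];
    [rewrite /om negE|apply/ctsN; exact: grad_cts].
have [C1 C10 H1] := sol_bound.
have [C2 C20 H2] := inn_sum (index_enum _) (fun k => sol_ctsec (sS k)).
have [C3 C30 H3] := inn_sum (index_enum _) com.
have [C4 C40 H4] := cohess_bound.
pose N := \sum_k `|invmx (mmet il (y il l)) k k|.
have N0 : 0 <= N by exact: sumr_ge0.
pose J w := Int 0 l (inn w).
have J0 w : 0 <= J w by apply: Int_ge0 => t _; exact: inn_ge0.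
have ll : 0 <= l <= l by rewrite l0 lexx.
have bS w t : L2_section l c w -> 0 <= t <= l -> inn (S w) t <= C1 * J w.
  move=> Lw tl; have [h1 h2] := HS w Lw.
  by have := H1 _ _ Lw h1 t tl; rewrite (inn_null h2) add0r.
have bk w k : L2_section l c w -> kap w k ^+ 2 <= N * C1 * J w.
  move=> Lw; rewrite /kap sqrrN.
  apply: le_trans (met_coord _ _ (mcoord_cod li)) _; rewrite -mulrA; apply: ler_pM => //.
  (* The diagonal entry of the inverse Gram matrix is nonnegative: [met_coord] for the corresponding
     row of that inverse bounds the square of the entry by the entry times a squared length. *)
  - have := met_coord (e_ k *m invmx (mmet il (y il l))) k (mcoord_cod li).
    rewrite -rowE mxE => h.
    exact: aux h (met_ge0 _ (mcoord_cod li)).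
  - exact: met_ge0 (mcoord_cod li).
  - apply: le_trans (ler_norm _) _; rewrite /N (bigD1 k) //= lerDl; exact: sumr_ge0.
  - exact: bS.
have b0 w : 0 <= N * C1 * J w by rewrite !mulr_ge0.
pose Cs := C2 * (N * C1 + C1).
have Cs0 : 0 <= Cs by rewrite mulr_ge0 // addr_ge0 // mulr_ge0.
have bs w t : L2_section l c w -> 0 <= t <= l -> inn (s w) t <= Cs * J w.
  move=> Lw tl; apply: le_trans (H2 _ _ (S w) t (fun k => bk w k Lw) (b0 w) tl) _.
  rewrite /Cs -[leRHS]mulrA; apply: ler_wpM2l => //; rewrite mulrDl lerD2l; exact: bS.
have bd w t : L2_section l c w -> 0 <= t <= l ->
    inn (ds w) t <= (2 * C4 * Cs + 2 * C3 * (N * C1)) * J w + 2 * C3 * inn w t.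
  move=> Lw tl.
  have -> : inn (ds w) t = inn (fun t i => (-1) *: cohess f i (y i t) (s w t i) + ws w t i) t.
    by rewrite /inn /inner; congr bilin; rewrite scaleN1r addrC.
  apply: le_trans (inn_parallelogram (-1) (fun t i => cohess f i (y i t) (s w t i)) (ws w)
    t) _.
  rewrite sqrrN expr1n mulr1.
  have h1 := H4 (s w) t tl ((ss w Lw).1 t tl).
  have h2 := ler_wpM2l C40 (bs w t Lw tl).
  have h3 := H3 _ _ w t (fun k => bk w k Lw) (b0 w) tl.
  have -> : (2 * C4 * Cs + 2 * C3 * (N * C1)) * J w + 2 * C3 * inn w t =
     2 * (C4 * (Cs * J w)) + 2 * (C3 * (N * C1 * J w + inn w t)) by ring.
  by apply: lerD; apply: ler_wpM2l => //; exact: le_trans h1 h2.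
pose Cd := (2 * C4 * Cs + 2 * C3 * (N * C1)) * l + 2 * C3.
have Cd0 : 0 <= Cd by rewrite !(addr_ge0, mulr_ge0).
have nl w : L2_section l c w -> null (s w) l.
  move=> Lw; apply: (tangent_eq (i := il)) => //; [exact: (ss w Lw).1|exact: tangent0|].
  rewrite /s /kap; have [h1 h2] := HS w Lw; rewrite -[X in _ + X](sE _ _ h1 h2).
  by rewrite -big_split /= big1 // => k _; rewrite scaleNr addNr.
(* The sum of the constants for [kap], [s] and [ds]. The pointwise bound [Cs] is integrated over
   length [l], which [Cd] already contains. *)
exists delta, kap, s, ds, (N * C1 + Cs * l + Cd); split=> //.
- by rewrite !(addr_ge0, mulr_ge0).
- move=> w Lw; have W := sol_W12 (Lws w Lw) (ss w Lw).
  split=> //; first 1 last.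
  + exact: nl.
  + move=> t tl i ti; rewrite /ds subrK /ws addrAC -big_split /= big1 ?add0r // => k _.
    by rewrite /om scalerN addNr.
  + have Ls := ctsec_L2 (sol_ctsec (ss w Lw)); have [_ Ld _] := W.
    have [_ iw] := (L2P w).1 Lw; have [_ is'] := (L2P _).1 Ls; have [_ id'] := (L2P _).1 Ld.
    have e1 : 0 <= N * C1 * J w by [].
    have e2 : 0 <= Cs * l * J w := mulr_ge0 (mulr_ge0 Cs0 l0) (J0 w).
    have e3 : 0 <= Cd * J w := mulr_ge0 Cd0 (J0 w).
    have eC : (N * C1 + Cs * l + Cd) * J w = N * C1 * J w + Cs * l * J w + Cd * J w by ring.
    rewrite !l2sq_Int //; split.
    * move=> k; rewrite -EFinM lee_fin -/(J w) eC; apply: le_trans (bk w k Lw) _.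
      by move: e1 e2 e3; set A1 := N * C1 * J w; lra.
    * rewrite -EFinM lee_fin -/(J w) eC; apply: (@le_trans _ _ (Cs * J w * l)); last first.
        by rewrite mulrAC; lra.
      rewrite -[X in _ * X]subr0 -Int_cst //; apply: le_Int => //; first exact: intg_cst.
      by move=> t tl; exact: bs.
    * rewrite -EFinM lee_fin -/(J w) eC; apply: (@le_trans _ _ (Cd * J w)); last by lra.
      apply: (@le_trans _ _ (Int 0 l (fun t => (2 * C4 * Cs + 2 * C3 * (N * C1)) * J w + 2
        * C3 * inn w t))).
        apply: le_Int => //; first by apply: intgD; [exact: intg_cst|exact: intgZ].
        by move=> t tl; exact: bd.
      rewrite IntD; [|exact: intg_cst|exact: intgZ].
      by rewrite Int_cst // IntZ // subr0 -/(J w) /Cd [leRHS]mulrDl lerD2r mulrAC.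
  + by move=> i ti; rewrite /s ((HS w Lw).2 i ti) addr0 big1 // => k _;
    rewrite (s0 k i ti) scaler0.
- move=> r w w' Lw Lw'; have [h1 h2] := HS w Lw; have [h1' h2'] := HS w' Lw'.
  have [g1 g2] := HS _ (L2_lin r Lw Lw').
  have E t : 0 <= t <= l -> eq_tangent (c t) (S (fun t i => r *: w t i + w' t i) t)
      (fun i => r *: S w t i + S w' t i).
    apply: (sol_unique (lexx 0) l0 (lexx l) g1 (sol_lin r h1 h1')).
    by move=> i ti; rewrite (g2 i ti) (h2 i ti) (h2' i ti) scaler0 addr0.
  have Ek k : kap (fun t i => r *: w t i + w' t i) k = r * kap w k + kap w' k.
    by rewrite /kap (E l ll il li) linE; ring.
  split=> // t tl i ti; rewrite /s (E t tl i ti) scalerDr addrACA; congr (_ + _).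
  rewrite scaler_sumr -big_split /=; apply: eq_bigr => k _.
  by rewrite Ek scalerDl scalerA.
Qed.

(** * The derivative of the flow map on an edge *)

Section EdgeDerivative.
Context (delta : M -> R) (sd : smooth_fun delta) (dl : R) (s ds : R -> tuplevec).
Context (sW : W12_section l c v s ds).

(** The term with [dl / l] is the derivative of the reparametrization factor [l / (l + h * dl)]; for
    [l = 0] the quotient is [0] by convention. *)
Definition edge_lin t : tuplevec := fun i =>
  ds t i - (dl / l) *: v t i + cohess f i (y i t) (s t i) + grad delta i (y i t).

Lemma W12_ctsec : ctsec s.
Proof.
have [ts _ H] := sW; split=> // i a b k ich; exact: prim_cts (H i a b ich k).
Qed.

Lemma edge_lin_L2 : L2_section l c edge_lin.
Proof.
have [_ Ld _] := sW; have [_ Lv _] := cW.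
have h1 := L2_lin (- (dl / l)) Lv Ld.
have h2 := L2_lin 1 (ctsec_L2 (ctsec_cohess W12_ctsec)) h1.
have := L2_lin 1 (ctsec_L2 (ctsec_grad sd)) h2.
rewrite (_ : (fun t i => _) = edge_lin) //.
apply/funext => t; apply/funext => i; rewrite /edge_lin !scale1r scaleNr.
by rewrite addrC [X in X + _]addrC [X in X + _ + _]addrC.
Qed.

(** The expression [local_Phi] in terms of the data of a single edge. *)
Definition moved (h t : R) i : V :=
  (l / (l + h * dl)) *: (v t i + h *: (ds t i - christoffel i (y i t) (v t i) (s t i)))
  + grad (fun z => f z + h * delta z) i (y i t + h *: s t i).

Lemma smooth_moved h : smooth_fun (fun z => f z + h * delta z).
Proof.
rewrite (_ : (fun z => _) = (fun z => h * delta z + f z)); first exact: smooth_lin.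
by apply/funext => z; rewrite addrC.
Qed.

Lemma grad_moved h i z : cod i z ->
  grad (fun z => f z + h * delta z) i z = grad f i z + h *: grad delta i z.
Proof.
move=> zi; rewrite addrC -(grad_lin h sd sf zi); congr (grad _ i z).
by apply/funext => x; rewrite addrC.
Qed.

Lemma movedE h t i k : moved h t i 0 k = (l / (l + h * dl)) *
  (v t i 0 k + h * (ds t i 0 k - christoffel i (y i t) (v t i) (s t i) 0 k)) +
  grad (fun z => f z + h * delta z) i (y i t + h *: s t i) 0 k.
Proof.
have aux (r q : R) (A B C D : V) : (r *: (A + q *: (B - C)) + D) 0 k =
    r * (A 0 k + q * (B 0 k - C 0 k)) + D 0 k by rewrite !mxE.
exact: aux.
Qed.

Lemma moved_meas i a b h k : in_chart l c i a b ->
  (forall t, a <= t <= b -> cod i (y i t + h *: s t i)) ->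
  measurable_fun (`[a, b] : set R) (fun t => moved h t i 0 k).
Proof.
move=> ich yc; have [_ /L2P[pd _] _] := sW; have [_ /L2P[pv _] _] := cW.
have cs := W12_ctsec.
apply: (meas_ext (x := fun t => (l / (l + h * dl)) * (v t i 0 k + h * (ds t i 0 k -
    \sum_p \sum_q v t i 0 p * (s t i 0 q * christoffel i (y i t) (e_ p) (e_ q) 0 k))) +
    grad (fun z => f z + h * delta z) i (y i t + h *: s t i) 0 k)).
  move=> t tab; rewrite movedE (christoffel_sum (v t i) (s t i) k (in_chart_cod ich tab)).
  congr (_ * (_ + _ * (_ - _)) + _).
  by apply: eq_bigr => p _; apply: eq_bigr => q _; rewrite mulrA.
have mv p := comp_meas p pv ich.
apply: measurable_funD; last first.
  apply: cts_meas; apply: (@cts_comp R n a b (fun t => y i t + h *: s t i)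
    (fun z => grad (fun z => f z + h * delta z) i z 0 k)) => [q|t tab].
    apply: (cts_ext (x := fun t => y i t 0 q + h * s t i 0 q)) => [t _|].
      by rewrite !mxE.
    by apply: ctsD; [exact: y_cts ich|apply: ctsZ; exact: (cs.2 i a b q ich)].
  exact: smooth_continuous (grad_smooth k (smooth_moved h)) (yc t tab).
apply: measurable_funM; first exact: measurable_cst.
apply: measurable_funD => //; apply: measurable_funM; first exact: measurable_cst.
apply: measurable_funB; first exact: comp_meas pd ich.
apply: measurable_sum => p; apply: measurable_sum => q; apply: measurable_funM => //.
apply: cts_meas; apply: ctsM; first exact: (cs.2 i a b q ich).
exact: smooth_cts ich (christoffel_smooth _ _ k).
Qed.

(** For small [h] the error [r] is, almost everywhere, at most [e] times one fixed square integrable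
    function. The smooth terms are controlled by [uniform_variation], the factor of
    reparametrization by explicit bounds. *)
Lemma edge_derivative i a b : in_chart l c i a b ->
  (\int[mu]_(t in `[a, b])
     (let r : V := h^-1 *: (moved h t i - moved 0 t i) - edge_lin t i in
      bilin 1%:M r r)%:E)%E @[h --> 0^'] --> 0%E.
Proof.
move=> ich; have [a0 ab bl Hi] := ich.
pose r h t k := h^-1 * (moved h t i 0 k - moved 0 t i 0 k) - edge_lin t i 0 k.
rewrite (_ : (fun h => _) = (fun h => (\int[mu]_(t in `[a, b]) (\sum_k r h t k ^+
  2)%:E)%E)); last first.
  apply/funext => h; apply: eq_integral => t _; congr (_%:E).
  rewrite /bilin /= mulmx1 mxE; apply: eq_bigr => k _.
  have aux (q : R) (A B C : V) : (q *: (A - B) - C) 0 k = q * (A 0 k - B 0 k) - C 0 k.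
    by rewrite !mxE.
  by rewrite [X in _ * X = _]mxE !aux expr2.
(* On an edge of length zero the interval is a point and the integral vanishes. *)
have [lp|] := ltP 0 l; last first.
  move=> l00; have -> : b = a by apply/eqP; rewrite eq_le ab (le_trans bl) // (le_trans l00).
  apply: (cvg0_le (lexx 0)) => [h|e e0].
    by apply: integral_ge0 => t _; rewrite lee_fin sumr_ge0 // => k _; exact: sqr_ge0.
  by exists 1 => // h _ _; rewrite set_itv1 integral_set1 mulr0.
have cs := W12_ctsec.
have [_ Ld _] := sW; have [_ Lv _] := cW.
have [pD _] := (L2P _).1 edge_lin_L2.
have yc k := y_cts k ich; have sc k := cs.2 i a b k ich.
pose g k t := christoffel i (y i t) (grad f i (y i t)) (s t i) 0 k.
have gc k : cts a b (g k).
  apply: (@cts_ext _ _ _ (fun t => \sum_p \sum_q grad f i (y i t) 0 p * s t i 0 q *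
    christoffel i (y i t) (e_ p) (e_ q) 0 k)).
    by move=> t tab; rewrite /g (christoffel_sum _ _ k (in_chart_cod ich tab)).
  apply: cts_sum => p; apply: cts_sum => q; apply: ctsM;
    last exact: smooth_cts ich (christoffel_smooth _ _ k).
  by apply: ctsM => //; exact: grad_cts.
have [B B0 HB] := @cts_norm1 R n a b
  (fun t => christoffel i (y i t) (grad f i (y i t)) (s t i)) gc.
(* The square of a sum of three terms is at most three times the sum of the squares. *)
pose m t := \sum_k 3 * (v t i 0 k ^+ 2 + ds t i 0 k ^+ 2 + (B + 2) ^+ 2).
have mi : intg a b m.
  apply: intg_sum => k; apply/intgZ/intgD; last exact: intg_cst.
  by apply: intgD; [exact: (L2_comp k Lv ich).2|exact: (L2_comp k Ld ich).2].
have m0 t : 0 <= m t.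
  by apply: sumr_ge0 => k _; rewrite mulr_ge0 // !addr_ge0 // sqr_ge0.
apply: (@cvg0_le _ _ (Int a b m)).
- exact: Int_ge0.
- by move=> h; apply: integral_ge0 => t _; rewrite lee_fin sumr_ge0 // => k _; exact: sqr_ge0.
(* The integrand is a square, so the final bound carries [e ^+ 2], which is at most [e0] as
   [e <= 1]. *)
move=> e0 e00; pose e := Num.min e0 1.
have e0p : 0 < e by rewrite lt_min e00 ltr01.
have ee0 : e ^+ 2 <= e0.
  have h1 : e <= e0 by rewrite ge_min lexx.
  have h2 : e <= 1 by rewrite ge_min lexx orbT.
  by rewrite expr2; apply: (@le_trans _ _ (e * 1)); [apply: ler_wpM2l => //;
    exact: ltW|rewrite mulr1].
have yi t : a <= t <= b -> cod i (y i t) := in_chart_cod ich.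
have /choice[df Hf] : forall k, exists d : R, 0 < d /\ forall h, `|h| < d ->
  forall t, a <= t <= b -> [/\ cod i (y i t + h *: s t i),
    `|grad f i (y i t + h *: s t i) 0 k - grad f i (y i t) 0 k| <= e &
    `|grad f i (y i t + h *: s t i) 0 k - grad f i (y i t) 0 k - h * 'D_(s t i) (fun z =>
      grad f i z 0 k) (y i t)| <= e * `|h|].
  move=> k; have [d d0 H] := uniform_variation ab (cod_open i) (grad_smooth k sf) yc sc yi e0p.
  by exists d.
have /choice[dd Hd] : forall k, exists d : R, 0 < d /\ forall h, `|h| < d ->
  forall t, a <= t <= b -> [/\ cod i (y i t + h *: s t i),
    `|grad delta i (y i t + h *: s t i) 0 k - grad delta i (y i t) 0 k| <= e &
    `|grad delta i (y i t + h *: s t i) 0 k - grad delta i (y i t) 0 k - h * 'D_(s t i)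
      (fun z => grad delta i z 0 k) (y i t)| <= e * `|h|].
  move=> k; have [d d0 H] := uniform_variation ab (cod_open i) (grad_smooth k sd) yc sc yi e0p.
  by exists d.
have [d1 d10 Hd1] := uniform_variation ab (cod_open i) (@smooth_cst R V R (cod i) 0) yc sc
  yi e0p.
pose Dl := `|dl| + 1; have Dl0 : 0 < Dl by rewrite ltr_wpDl.
have Dle : `|dl| <= Dl by rewrite lerDl.
(* Chosen so that [dE * Dl] and [dE * (Dl ^+ 2 / l)] are both at most [e * (l / 2)]: the first
   bounds [lam - 1], the second the first-order error of [lam], given that [l + h * dl] is at least
   [l / 2]. *)
pose dE := e * l / (2 * Dl ^+ 2 / l + 2 * Dl).
have dE0 : 0 < dE.
  by rewrite divr_gt0 ?mulr_gt0 // addr_gt0 ?divr_gt0 ?mulr_gt0 // exprn_gt0.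
have [dm dm0 Hm] := @fin_min R 'I_n (fun k => Num.min (df k) (dd k))
  ltac:(by move=> k; rewrite lt_min (Hf k).1 (Hd k).1).
pose d := Num.min (Num.min d1 (l / (2 * Dl))) (Num.min dE dm).
have d0 : 0 < d.
  have dq : 0 < l / (2 * Dl) by rewrite divr_gt0 // mulr_gt0.
  by rewrite !lt_min d10 dq dE0.
exists d => // h hn hd.
have hd1 : `|h| < d1 by apply: lt_le_trans hd _; rewrite !ge_min lexx.
have hdl : `|h| < l / (2 * Dl) by apply: lt_le_trans hd _; rewrite !ge_min lexx !orbT.
have hdE : `|h| < dE by apply: lt_le_trans hd _; rewrite !ge_min lexx !orbT.
have hk k : `|h| < df k /\ `|h| < dd k.
  have : `|h| < Num.min (df k) (dd k).
    by apply: lt_le_trans hd _; apply: le_trans (Hm k); rewrite !ge_min lexx !orbT.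
  by rewrite lt_min => /andP.
have yh t : a <= t <= b -> cod i (y i t + h *: s t i).
  by move=> tab; have [] := Hd1 h hd1 t tab.
have y0h t : a <= t <= b -> cod i (y i t + 0 *: s t i).
  by move=> tab; rewrite scale0r addr0; exact: yi.
have rm k : measurable_fun (`[a, b] : set R) (fun t => r h t k).
  apply: measurable_funB; last exact: comp_meas pD ich.
  apply: measurable_funM; first exact: measurable_cst.
  by apply: measurable_funB; apply: moved_meas.
pose lam := l / (l + h * dl).
have hdl2 : `|h * dl| <= l / 2.
  rewrite normrM; apply: (@le_trans _ _ (l / (2 * Dl) * Dl)).
    by apply: ler_pM => //; exact: ltW.
  by rewrite le_eqVlt; apply/orP; left; apply/eqP; field; exact: lt0r_neq0.
have q0 : l / 2 <= l + h * dl by move: hdl2; rewrite ler_norml => /andP[]; lra.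
have q1 : 0 < l + h * dl by lra.
have el : 0 < e * (l / 2) by rewrite mulr_gt0 // divr_gt0.
have lb : `|lam - 1| <= e.
  have -> : lam - 1 = - (h * dl) / (l + h * dl).
    by rewrite /lam; field; exact: lt0r_neq0.
  rewrite normrM normrN normfV (gtr0_norm q1) ler_pdivrMr //.
  apply: (@le_trans _ _ (e * (l / 2))); last by apply: ler_wpM2l => //; exact: ltW.
  rewrite normrM; apply: (@le_trans _ _ (dE * Dl)); first by apply: ler_pM => //; exact: ltW.
  rewrite /dE mulrAC ler_pdivrMr; last by rewrite addr_gt0 ?divr_gt0 ?mulr_gt0 // exprn_gt0.
  have p1 : 0 < 2 * Dl ^+ 2 / l by rewrite divr_gt0 // mulr_gt0 // exprn_gt0.
  have p2 := mulr_ge0 (ltW el) (ltW p1).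
  have -> : e * (l / 2) * (2 * Dl ^+ 2 / l + 2 * Dl) = e * (l / 2) * (2 * Dl ^+ 2 / l) + e
    * l * Dl by field; exact: lt0r_neq0.
  by rewrite lerDr.
have lb2 : `|h^-1 * (lam - 1) + dl / l| <= e.
  have -> : h^-1 * (lam - 1) + dl / l = h * (dl ^+ 2 / l) / (l + h * dl).
    by rewrite /lam; field; rewrite hn !lt0r_neq0.
  rewrite normrM normfV (gtr0_norm q1) ler_pdivrMr //.
  apply: (@le_trans _ _ (e * (l / 2))); last by apply: ler_wpM2l => //; exact: ltW.
  rewrite normrM [X in _ * X]normrM normfV (gtr0_norm lp) normrX.
  apply: (@le_trans _ _ (dE * (Dl ^+ 2 / l))).
    apply: ler_pM => //; [by rewrite divr_ge0 ?exprn_ge0 // ltW|exact: ltW|].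
    apply: ler_wpM2r; first by rewrite invr_ge0 ltW.
    by apply: lerXn2r => //; rewrite nnegrE // ltW.
  rewrite /dE mulrAC ler_pdivrMr; last by rewrite addr_gt0 ?divr_gt0 ?mulr_gt0 // exprn_gt0.
  have p2 : 0 <= e * (l / 2) * (2 * Dl).
    by apply: mulr_ge0; [exact: ltW|apply: mulr_ge0 => //; exact: ltW].
  have -> : e * (l / 2) * (2 * Dl ^+ 2 / l + 2 * Dl) = e * l * (Dl ^+ 2 / l) + e * (l / 2)
    * (2 * Dl) by field; exact: lt0r_neq0.
  by rewrite lerDl.
(* Replacing the velocity by [- grad f] turns the Christoffel term into a continuous function
   bounded by [B]; the [2] stands for the errors in the gradients of the label and of its
   variation. *)
have key : {ae mu, forall t, a <= t <= b -> forall k,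
    `|r h t k| <= e * (`|v t i 0 k| + `|ds t i 0 k| + (B + 2))}.
  apply: (ae_imp velocity_ae) => t H tab k.
  have vE := H (in_chart_l ich tab) i (Hi t tab).
  have zi := yi t tab.
  have [_ _ K1] := (Hf k).2 h (hk k).1 t tab.
  have [_ K2 _] := (Hd k).2 h (hk k).2 t tab.
  have gE : christoffel i (y i t) (v t i) (s t i) 0 k = - g k t.
    by rewrite vE (christoffelN _ _ zi) negE.
  have m0E : moved 0 t i 0 k = v t i 0 k + grad f i (y i t) 0 k.
    rewrite movedE !mul0r !addr0 divff ?lt0r_neq0 // mul1r scale0r addr0.
    by rewrite (grad_moved 0 zi) scale0r addr0.
  have mhE : moved h t i 0 k = lam * (v t i 0 k + h * (ds t i 0 k + g k t)) +
     (grad f i (y i t + h *: s t i) 0 k + h * grad delta i (y i t + h *: s t i) 0 k).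
    rewrite movedE gE opprK (grad_moved h (yh t tab)) -/lam; congr (_ + _).
    by move: (grad f i _) (grad delta i _) => A1 A2; rewrite addrC linE addrC.
  have DE : edge_lin t i 0 k = ds t i 0 k - dl / l * v t i 0 k +
      ('D_(s t i) (fun z => grad f i z 0 k) (y i t) + g k t) + grad delta i (y i t) 0 k.
    have aux (q : R) (A1 A2 A3 A4 : V) : (A1 - q *: A2 + A3 + A4) 0 k =
      A1 0 k - q * A2 0 k + A3 0 k + A4 0 k by rewrite !mxE.
    apply: etrans (aux _ _ _ _ _) _.
    apply: (f_equal (fun r => ds t i 0 k - dl / l * v t i 0 k + r + grad delta i (y i t) 0 k)).
    rewrite cohessE; apply: etrans (addE _ _ _) _.
    exact: (f_equal (fun r => r + g k t) (@dgradE _ _ M f i (y i t) (s t i) k)).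
  rewrite /r m0E mhE DE.
  move: K1 K2; set G1 := grad f i (_ + _) 0 k; set G0 := grad f i _ 0 k.
  set E1 := grad delta i (_ + _) 0 k; set E0 := grad delta i _ 0 k; set Q := 'D_(s t i) _ _.
  move: (HB t tab k) => gB K1 K2.
  set v1 := v t i 0 k; set w1 := ds t i 0 k; set g1 := g k t in gB *.
  have -> : h^-1 * (lam * (v1 + h * (w1 + g1)) + (G1 + h * E1) - (v1 + G0)) -
      (w1 - dl / l * v1 + (Q + g1) + E0) =
    (h^-1 * (lam - 1) + dl / l) * v1 + (lam - 1) * (w1 + g1) + h^-1 * (G1 - G0 - h * Q) +
      (E1 - E0).
    by field; rewrite hn lt0r_neq0.
  apply: le_trans (ler_normD _ _) _.
  have n1 : `|(h^-1 * (lam - 1) + dl / l) * v1| <= e * `|v1|.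
    by rewrite normrM; apply: ler_wpM2r.
  have n2 : `|(lam - 1) * (w1 + g1)| <= e * (`|w1| + B).
    rewrite normrM; apply: ler_pM => //; apply: le_trans (ler_normD _ _) _.
    by rewrite lerD2l.
  have n3 : `|h^-1 * (G1 - G0 - h * Q)| <= e.
    by rewrite normrM normfV mulrC ler_pdivrMr ?normr_gt0.
  have -> : e * (`|v1| + `|w1| + (B + 2)) = e * `|v1| + e * (`|w1| + B) + e + e by ring.
  apply: lerD => //; apply: le_trans (ler_normD _ _) _; apply: lerD => //.
  by apply: le_trans (ler_normD _ _) _; apply: lerD.
apply: (@le_trans _ _ (\int[mu]_(t in `[a, b]) (e ^+ 2 * m t)%:E)%E).
  apply: ae_ge0_le_integral => //.
  - by move=> t _; rewrite lee_fin sumr_ge0 // => k _; exact: sqr_ge0.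
  - apply/measurable_EFinP; apply: measurable_sum => k.
    apply: (meas_ext (x := fun t => r h t k * r h t k)) => [t _|]; first by rewrite expr2.
    by apply: measurable_funM; exact: rm.
  - by move=> t _; rewrite lee_fin mulr_ge0 // sqr_ge0.
  - by apply/measurable_EFinP; exact: intg_meas (intgZ (e ^+ 2) mi).
  apply: (ae_imp key) => t H; rewrite /= in_itv /= => tab; rewrite lee_fin /m mulr_sumr.
  apply: ler_sum => k _; have := H tab k.
  set A1 := v t i 0 k; set A2 := ds t i 0 k; set X := r h t k => HX.
  apply: (@le_trans _ _ ((e * (`|A1| + `|A2| + (B + 2))) ^+ 2)).
    rewrite -[X ^+ 2]real_normK ?num_real //; apply: lerXn2r => //.
    by rewrite nnegrE; exact: le_trans HX.
  rewrite exprMn; apply: ler_wpM2l; first exact: sqr_ge0.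
  rewrite -[A1 ^+ 2]real_normK ?num_real // -[A2 ^+ 2]real_normK ?num_real //.
  move: `|A1| `|A2| (B + 2) => p1 p2 p3.
  rewrite -subr_ge0 (_ : _ - _ = (p1 - p2) ^+ 2 + (p1 - p3) ^+ 2 + (p2 - p3) ^+ 2);
    last by ring.
  by rewrite !addr_ge0 // sqr_ge0.
have ei := intgZ (e ^+ 2) mi.
have -> : (\int[mu]_(t in `[a, b]) (e ^+ 2 * m t)%:E)%E = (Int a b (fun t => e ^+ 2 * m t))%:E.
  by rewrite /Int /Rintegral fineK //; exact: integrable_fin_num ei.
rewrite IntZ // lee_fin; apply: ler_wpM2r => //; exact: Int_ge0.
Qed.

End EdgeDerivative.

End Curve.

(** * The graph *)

Local Opaque derive met jac hess dmet christoffel grad dgrad cohess.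

(** Carries the bounds on the coefficients [kap] over to the coordinates of the label variations in
    the basis of a label space. *)
Lemma sqr_sum_bound (R : realType) (I : Type) (r : seq I) (b : I -> R) :
  exists2 C : R, 0 <= C & forall (kap : I -> R) (B : R), (forall k, kap k ^+ 2 <= B) ->
    (\sum_(k <- r) kap k * b k) ^+ 2 <= C * B.
Proof.
elim: r => [|k r [C C0 IH]].
  by exists 0 => // kap B _; rewrite big_nil expr0n mul0r.
exists (2 * b k ^+ 2 + 2 * C); first by rewrite addr_ge0 // mulr_ge0 // sqr_ge0.
move=> kap B HB; rewrite big_cons.
have h1 := IH kap B HB; have h2 := ler_wpM2r (sqr_ge0 (b k)) (HB k).
have := sqr_ge0 (kap k * b k - \sum_(k <- r) kap k * b k).
move: h1 h2; set S := \sum_(k <- r) _; rewrite !expr2; nra.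
Qed.

Section Graph.
Context (R : realType) (n : nat) (M : closed_riemannian R n).
Context (b p q : nat) (G : gobj b p q) (x : mapping_space M G).
Local Notation V := 'rV[R]_n.
Local Notation mu := (@lebesgue_measure R).
Local Notation E := (edge (top_graph x)).
Hypothesis xZ : is_zero x.

Lemma len_ge0 (e : E) : 0 <= len e.
Proof. by apply: sumr_ge0 => i _; rewrite mulr_ge0 ?bary_ge0. Qed.

Lemma edge_zero (e : E) : {ae mu, forall t, 0 <= t <= len e ->
  eq_tangent (on_edge e t)
    (fun i => velocity e t i + grad (label e) i (mcoord i (on_edge e t))) (fun=> 0)}.
Proof. exact: (xZ e). Qed.

Lemma dlen_lin (a : R) (u v : Defs.variation x) e :
  dlen (lin_variation a u v) e = a * dlen u e + dlen v e.
Proof.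
rewrite /dlen /edge_length mulr_sumr -big_split; apply: eq_bigr => i _ /=.
by rewrite mulrDl mulrA.
Qed.

Definition linPhi (v : Defs.variation x) : field x := fun e =>
  edge_lin (len e) (on_edge e) (velocity e) (label e) (dlabel v e) (dlen v e)
    (sedge v e) (dsedge v e).

Lemma linPhi_linearization : vertical_linearization linPhi.
Proof.
split.
- move=> v vv e; exact: (edge_lin_L2 (len_ge0 e) (on_edge_W12 e) (@label_smooth _ _ _ _ _ _
  _ _ e) (dlabel_smooth vv e) (dlen v e) (sedge_W12 vv e)).
- move=> a u v uu vv e; apply: ae_all => t _ i ti.
  have zi := mcoord_cod ti.
  rewrite /linPhi /edge_lin /lin_field dlen_lin /=.
  rewrite (cohess_lin a _ _ (@label_smooth _ _ _ _ _ _ _ _ e) zi).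
  rewrite (grad_lin a (dlabel_smooth uu e) (dlabel_smooth vv e) zi).
  have aux (r1 r2 r3 : R) (A1 A2 B C1 C2 D1 D2 : V) :
    a *: A1 + A2 - ((a * r1 + r2) / r3) *: B + (a *: C1 + C2) + (a *: D1 + D2) =
    a *: (A1 - (r1 / r3) *: B + C1 + D1) + (A2 - (r2 / r3) *: B + C2 + D2).
    by apply/rowP => k; rewrite !mxE; ring.
  exact: aux.
- move=> v vv e i a c ich.
  exact: (edge_derivative (len_ge0 e) (on_edge_W12 e) (@label_smooth _ _ _ _ _ _ _ _ e)
    (edge_zero e) (dlabel_smooth vv e) (dlen v e) (sedge_W12 vv e) ich).
Qed.

Lemma smooth_scale (a : R) (g : M -> R) : smooth_fun g -> smooth_fun (fun z => a * g z).
Proof.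
move=> sg; have := smooth_lin a sg (@smooth_fcst R n M 0).
by rewrite (_ : (fun z => _ + _) = (fun z => a * g z)) //; apply/funext => z; rewrite addr0.
Qed.

Lemma In_enum (I : finType) (T : Type) (F : I -> T) (k : I) :
  List.In (F k) [seq F k | k <- enum I].
Proof.
have : k \in enum I by rewrite mem_enum.
elim: (enum I) => [//|j r IH] /=; rewrite in_cons => /orP[/eqP ->|/IH]; by [left|right].
Qed.

Lemma In_map (I : finType) (T : Type) (F : I -> T) (h : T) :
  List.In h [seq F k | k <- enum I] -> exists k, h = F k.
Proof.
elim: (enum I) => [//|j r IH] /= [<-|/IH]; by [exists j|].
Qed.

(** The edgewise inverses fit together because their sections vanish at both ends, which matches
    zero at the vertices, and the labels of distinct edges vary independently. *)
Lemma linPhi_right_inverse : exists S : field x -> Defs.variation x, Defs.right_inverse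
  linPhi S.
Proof.
have /choice[delta /choice[kap /choice[s /choice[ds /choice[C H]]]]] := fun e : E =>
  edge_inverse (len_ge0 e) (on_edge_W12 e) (@label_smooth _ _ _ _ _ _ _ _ e) (edge_zero e).
pose S (w : field x) : Defs.variation x := {|
  dbary := fun=> 0;
  dlabel := fun e y => \sum_k kap e (w e) k * delta e k y;
  svert := fun _ _ => 0;
  sedge := fun e => s e (w e);
  dsedge := fun e => ds e (w e) |}.
have C0 e : 0 <= C e by have [] := H e.
have sdelta e k : smooth_fun (delta e k) by have [] := H e.
exists S; split.
- move=> w Lw; split.
    split=> /=.
    + by rewrite big1.
    + by [].
    + move=> e; apply: smooth_sum => k; exact: smooth_scale.
    + by move=> v; exact: tangent0.
    + move=> e i; rewrite -on_edge_src => ti.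
      by have [_ _ /(_ _ (Lw e))[_ h _ _ _] _] := H e; exact: h.
    + move=> e i; rewrite -on_edge_tgt => ti.
      by have [_ _ /(_ _ (Lw e))[_ _ h _ _] _] := H e; exact: h.
    + by move=> e; have [_ _ /(_ _ (Lw e))[h _ _ _ _] _] := H e; exact: h.
  move=> e; apply: ae_all => t tl i ti.
  have [_ _ /(_ _ (Lw e))[_ _ _ h _] _] := H e.
  rewrite -[RHS](h t tl i ti) /linPhi /edge_lin /=.
  (* The simplex coordinates do not move, so the lengths are fixed and the velocity term
     disappears. *)
  rewrite (_ : dlen (S w) e = 0) ?mul0r ?scale0r ?subr0; last first.
    by rewrite /dlen /edge_length big1 // => j _; rewrite mul0r.
  by rewrite (grad_sum (index_enum _) (kap e (w e)) (sdelta e) (mcoord_cod ti)).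
- move=> a w w' Lw Lw'; split=> /=.
  + by move=> i; rewrite mulr0 addr0.
  + move=> e y; have [_ _ _ /(_ a _ _ (Lw e) (Lw' e))[h _]] := H e.
    rewrite mulr_sumr -big_split /=; apply: eq_bigr => k _.
    by rewrite (h k) mulrDl mulrA.
  + by move=> v i _; rewrite scaler0 addr0.
  + move=> e t tl; have [_ _ _ /(_ a _ _ (Lw e) (Lw' e))[_ h]] := H e.
    exact: h.
(* The labels and all the directions [delta e k], chosen before [w]: one label space serves every
   [w]. *)
- pose fs0 := [seq label e | e <- enum E] ++
    [seq delta ek.1 ek.2 | ek : E * 'I_n <- enum {: E * 'I_n}].
  have sfs h : List.In h fs0 -> smooth_fun h.
    move=> hin; have [h1|h1] := List.in_app_or _ _ _ hin.
      by have [e ->] := In_map h1; exact: label_smooth.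
    by have [ek ->] := In_map h1; exact: sdelta.
  have [m [f [sf fI fspan fs]]] := label_space_exists sfs.
  have /choice[bb Hbb] : forall ek : E * 'I_n, exists a : 'I_m -> R,
      forall y, delta ek.1 ek.2 y = \sum_(j < m) a j * f j y.
    move=> ek; apply: fs; apply: List.in_or_app; right.
    exact: (In_enum (fun ek : E * 'I_n => delta ek.1 ek.2) ek).
  have /choice[Cb HCb] : forall ej : E * 'I_m, exists Cb : R, 0 <= Cb /\
      forall (kp : 'I_n -> R) (B : R), (forall k, kp k ^+ 2 <= B) ->
      (\sum_k kp k * bb (ej.1, k) ej.2) ^+ 2 <= Cb * B.
    move=> ej; have [Cb Cb0 h] := sqr_sum_bound (index_enum 'I_n) (fun k => bb (ej.1, k) ej.2).
    by exists Cb.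
  (* The factor [2] accounts for the two norms, of [sedge] and of [dsedge]; the inner sum dominates
     the bound for each label coordinate. *)
  pose Ct := \sum_e (2 * C e + \sum_j Cb (e, j) * C e).
  have Cte e : 2 * C e <= Ct /\ forall j, Cb (e, j) * C e <= Ct.
    have t0 e' : 0 <= 2 * C e' + \sum_j Cb (e', j) * C e'.
      rewrite addr_ge0 ?mulr_ge0 // sumr_ge0 // => j _; rewrite mulr_ge0 //.
      by have [] := HCb (e', j).
    have te : 2 * C e + \sum_j Cb (e, j) * C e <= Ct.
      by rewrite /Ct (bigD1 e) //= lerDl sumr_ge0.
    have j0 j : 0 <= Cb (e, j) * C e by rewrite mulr_ge0 //; have [] := HCb (e, j).
    split=> [|j]; apply: le_trans te; first by rewrite lerDl sumr_ge0.
    rewrite (bigD1 j) //= addrCA lerDl addr_ge0 ?mulr_ge0 // sumr_ge0 //.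
  have Ct0 : 0 <= Ct.
    apply: sumr_ge0 => e _; rewrite addr_ge0 ?mulr_ge0 // sumr_ge0 // => j _.
    by rewrite mulr_ge0 //; have [] := HCb (e, j).
  exists m, f, Ct; split.
    split=> // e; apply: fs; apply: List.in_or_app; left.
    exact: (In_enum (fun e : E => label e) e).
  move=> w Lw.
  pose J e := fine (l2sq (len e) (on_edge e) (w e)).
  have JE e : l2sq (len e) (on_edge e) (w e) = (J e)%:E.
    by rewrite /J (l2sq_Int (len_ge0 e) (on_edge_W12 e) (Lw e)).
  have J0 e : 0 <= J e.
    rewrite fine_ge0 //; apply: integral_ge0 => t _; rewrite lee_fin.
    exact: inn_ge0.
  have TE : l2sq_field w = (\sum_e J e)%:E.
    by rewrite /l2sq_field -sumEFin; apply: eq_bigr => e _; exact: JE.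
  have JT e : J e <= \sum_e J e by rewrite (bigD1 e) //= lerDl sumr_ge0.
  have T0 : 0 <= \sum_e J e by exact: sumr_ge0.
  rewrite TE; split.
  + by move=> i /=; rewrite expr0n -EFinM lee_fin mulr_ge0.
  + move=> e; have [_ _ /(_ _ (Lw e))[_ _ _ _ [hk _ _]] _] := H e.
    exists (fun j => \sum_k kap e (w e) k * bb (e, k) j); split=> [y|j] /=.
      under eq_bigr do rewrite (Hbb (e, _)) mulr_sumr.
      rewrite exchange_big /=; apply: eq_bigr => j _; rewrite mulr_suml.
      by apply: eq_bigr => k _; rewrite mulrA.
    rewrite -EFinM lee_fin; have [Cb0 h] := HCb (e, j).
    have hk' k : kap e (w e) k ^+ 2 <= C e * J e.
      by have := hk k; rewrite JE -EFinM lee_fin.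
    apply: le_trans (h _ _ hk') _; rewrite mulrA; apply: ler_pM => //.
    * by rewrite mulr_ge0.
    * exact: (Cte e).2.
  + have bnd (X : field x) : (forall e, (l2sq (len e) (on_edge e) (X e) <= (C e)%:E * l2sq
    (len e) (on_edge e) (w e))%E) ->
        (l2sq_field X <= (\sum_e C e * J e)%:E)%E.
      move=> hX; rewrite /l2sq_field -sumEFin; apply: lee_sum => e _.
      by apply: le_trans (hX e) _; rewrite JE.
    have b1 := bnd (dsedge (S w)) ltac:(by move=> e;
      have [_ _ /(_ _ (Lw e))[_ _ _ _ [_ _ h]] _] := H e).
    have b2 := bnd (sedge (S w)) ltac:(by move=> e;
      have [_ _ /(_ _ (Lw e))[_ _ _ _ [_ h _]] _] := H e).
    apply: le_trans (leeD b1 b2) _; rewrite -EFinD -EFinM lee_fin -big_split mulr_sumr.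
    apply: ler_sum => e _ /=; rewrite -mulr2n -mulr_natl mulrA.
    by apply: ler_wpM2r => //; exact: (Cte e).1.
Qed.

End Graph.

Theorem theorem24 (R : realType) (n : nat) (M : closed_riemannian R n)
    (b p q : nat) (G : gobj b p q) (x : mapping_space M G) :
  is_zero x -> transverse_at x.
Proof.
move=> xZ; exists (@linPhi _ _ _ _ _ _ _ x); first exact: linPhi_linearization.
exact: linPhi_right_inverse.
Qed.
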